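(* Let $n\ge 1$, let $U\subseteq\mathbb C$ be the domain associated with $a>0$ and the open interval $\left]\tau_{\min};\tau_{\max}\right[$ as described in the context, and let $\Lambda,R$ be analytic $n\times n$ matrix-valued functions on $U$, with $\Lambda(z)=\mathrm{diag}(\Lambda_{11}(z),\dots,\Lambda_{nn}(z))$ diagonal. Consider the differential equation $$\frac{dY}{dz}=\left(\Lambda(z)+R(z)\right)Y,\qquad z\in U .$$ If $(U,\Lambda)$ satisfies the $L$-condition and $(U,R)$ satisfies the good decay condition (both defined in the context), then, $z_o\in U$ being fixed arbitrarily, the differential equation admits a unique fundamental matrix solution $Y\colon U\to GL(n,\mathbb C)$ such that $$Y(z)=\left(I_n+o(1)\right)\exp\int_{z_o}^z\Lambda(\zeta)\,d\zeta,\qquad z\to\infty,\quad \alpha\leq\arg z\leq\beta+\pi,$$ for arbitrary $\alpha,\beta$ satisfying $\tau_{\min}<\alpha\leq\beta<\tau_{\max}$.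
   Context: The domain $U$. Fix $a>0$ and an open interval $\left]\tau_{\min};\tau_{\max}\right[\subseteq\mathbb R$. $U\subseteq\mathbb C$ is an unbounded simply-connected domain which is the union of the lines $\ell$ whose distance from $0$ is greater than $a$ and whose slopes (angular directions, for the natural orientation below) vary in $\left]\tau_{\min};\tau_{\max}\right[$. Explicitly, these are the lines $\{z:\operatorname{Im}(e^{-\sqrt{-1}\tau}z)=d\}$ with $d>a$, $\tau\in\left]\tau_{\min};\tau_{\max}\right[$. The arguments of the points of $U$ are taken in $\left]\tau_{\min};\tau_{\max}+\pi\right[$ (the point $z$ of a line of direction $\tau$ has $\arg z\in\left]\tau;\tau+\pi\right[$). Natural orientation. Any such line $\ell\subseteq U$ is the boundary of a half-plane $\mathbb H\subseteq U$; $\ell$ is oriented as the boundary $\partial\mathbb H$ of $\mathbb H$ (with the complex orientation), i.e. it is traversed in the direction $e^{\sqrt{-1}\tau}$. Segments. For $z_1,z_2\in U$, $[z_1,z_2]$ denotes the segment $\{(1-t)z_1+tz_2,\ 0\le t\le1\}$ oriented from $z_1$ to $z_2$. $\mathcal P_U$ is the set of all oriented segments in $U$ obtained by truncating the naturally oriented lines in $U$ (with the induced orientation). $L$-condition. $(U,\Lambda)$ satisfies the $L$-condition if for any pair $(i,j)$, $i,j=1,\dots,n$, $i\ne j$, the set of real numbers $$A_{i,j}:=\left\{\operatorname{Re}\int_{[z_1,z_2]}\left(\Lambda_{ii}(\zeta)-\Lambda_{jj}(\zeta)\right)d\zeta,\quad [z_1,z_2]\in\mathcal P_U\right\}$$ has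 an upper bound and/or a lower bound. Good decay condition. For a line $\ell\subseteq U$ let $d_\ell$ be its distance from $0$. $(U,R)$ satisfies the good decay condition if the restriction of $R$ to any line $\ell\subseteq U$ is $L^1$-integrable along $\ell$ and $\|R|_\ell\|_1\to0$ for $d_\ell\to+\infty$, where $\|\cdot\|_1$ is the norm of $L^1(\ell,dz)$ (with respect to an arbitrary fixed norm on $n\times n$ matrices; the convergence is as $d_\ell\to+\infty$ over all such lines). *)

(* Defs.v *)
From HB Require Import structures.
From Stdlib Require Import Reals List.
From Coquelicot Require Import Coquelicot.
From mathcomp Require Import all_boot all_algebra.
From mathcomp Require Import Rstruct.

Set Implicit Arguments.
Unset Strict Implicit.
Unset Printing Implicit Defensive.

Local Open Scope ring_scope.

(* Coquelicot's complex numbers as a MathComp field, so that the matrix library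
   applies to ['M[C]_n]; the operations are Coquelicot's own. *)
HB.instance Definition _ := Choice.copy C (R * R)%type.

Fact C_addNr : left_inverse (RtoC 0) Copp Cplus.
Proof. by move=> z; rewrite Cplus_comm Cplus_opp_r. Qed.

HB.instance Definition _ :=
  GRing.isZmodule.Build C Cplus_assoc Cplus_comm Cplus_0_l C_addNr.

Fact C_mulDl : left_distributive Cmult Cplus.
Proof. by move=> x y z; rewrite Cmult_plus_distr_r. Qed.

Fact C_oner_neq0 : RtoC 1 != RtoC 0.
Proof. by apply/eqP => -[]; apply: R1_neq_R0. Qed.

HB.instance Definition _ :=
  GRing.Zmodule_isComNzRing.Build C
    Cmult_assoc Cmult_comm Cmult_1_l C_mulDl C_oner_neq0.

(* MathComp requires [0^-1 = 0], which Coquelicot's [Cinv] also satisfies. *)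
Fact C_mulVf (z : C) : z != 0 -> Cinv z * z = 1.
Proof. by move=> /eqP z0; apply: Cinv_l. Qed.

Fact C_invr0 : Cinv 0 = 0.
Proof.
by rewrite /Cinv /= /Rdiv Ropp_0 !Rmult_0_l.
Qed.

HB.instance Definition _ := GRing.ComNzRing_isField.Build C C_mulVf C_invr0.

(* Real inequalities and operations below are those of Stdlib; [%R] refers to
   MathComp's rings. *)
Local Open Scope R_scope.

Definition cexp (z : C) : C := (exp (Re z) * (cos (Im z), sin (Im z)))%C.

Definition cis (t : R) : C := (cos t, sin t).

(* The line of direction [tau] at signed distance [d] from [0], and its
   arc-length parametrization in the direction [cis tau]. *)
Definition on_line (tau d : R) (z : C) : Prop := Im (cis (- tau) * z)%C = d.

Definition line_pt (tau d s : R) : C := (cis tau * (s, d))%C.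

Definition admissible (a tmin tmax tau d : R) : Prop :=
  (tmin < tau < tmax) /\ (a < d).

Definition domainU (a tmin tmax : R) (z : C) : Prop :=
  exists tau d : R, admissible a tmin tmax tau d /\ on_line tau d z.

Definition unit_interval (t : R) : Prop := (0 <= t <= 1).

Definition path_in (U : C -> Prop) (g : R -> C) : Prop :=
  continuous_on (T := R_UniformSpace) (U := C_UniformSpace) unit_interval g /\
  forall t, unit_interval t -> U (g t).

Definition path_connected (U : C -> Prop) : Prop :=
  forall z w, U z -> U w -> exists g, [/\ path_in U g, g 0 = z & g 1 = w].

(* [h (s, t)] deforms the loop [g] (at [s = 0]) to a constant loop (at [s = 1])
   inside [U], with fixed base point. *)
Definition null_homotopic (U : C -> Prop) (g : R -> C) : Prop :=
  exists h : R * R -> C,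
    let square p := unit_interval (fst p) /\ unit_interval (snd p) in
    [/\ continuous_on
          (T := prod_UniformSpace R_UniformSpace R_UniformSpace)
          (U := C_UniformSpace) square h,
        forall p, square p -> U (h p),
        forall t, unit_interval t -> h (0, t) = g t /\ h (1, t) = g 0
      & forall s, unit_interval s -> h (s, 0) = g 0 /\ h (s, 1) = g 0].

Definition simply_connected (U : C -> Prop) : Prop :=
  path_connected U /\
  forall g, path_in U g -> g 0 = g 1 -> null_homotopic U g.

Definition segment_pt (z w : C) (t : R) : C := ((1 - t) * z + t * w)%C.

Definition segment_int (f : C -> C) (z w : C) : C :=
  RInt (V := C_R_CompleteNormedModule)
    (fun t => f (segment_pt z w t) * (w - z))%C 0 1.

(* The polygonal path [z0 :: p] runs through the segments joining its successive
   vertices; [polygon_int f z0 p] is the integral of [f] along it.  In a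
   connected open set, these paths are enough to define the
   path-independent integral of a holomorphic function between two points. *)
Fixpoint polygon_in (U : C -> Prop) (z0 : C) (p : seq C) : Prop :=
  if p is z1 :: p' then
    (forall t, unit_interval t -> U (segment_pt z0 z1 t)) /\ polygon_in U z1 p'
  else U z0.

Fixpoint polygon_int (f : C -> C) (z0 : C) (p : seq C) : C :=
  if p is z1 :: p' then (segment_int f z0 z1 + polygon_int f z1 p')%C
  else RtoC 0.

(* Entrywise complex differentiability at every point; for open [U] this is
   analyticity. *)
Definition analytic_on (U : C -> Prop) n (M : C -> 'M[C]_n) : Prop :=
  forall z, U z -> forall i j : 'I_n,
    ex_derive (K := C_AbsRing) (V := C_NormedModule) (fun w => M w i j) z.

Definition mxnorm n (M : 'M[C]_n) : R := \sum_(i < n) \sum_(j < n) Cmod (M i j).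

(* The exponential of the diagonal matrix with diagonal entries [v i]. *)
Definition exp_diag n (v : 'I_n -> C) : 'M[C]_n := diag_mx (\row_i cexp (v i)).

Definition fundamental_solution (U : C -> Prop) n (A Y : C -> 'M[C]_n) : Prop :=
  forall z, U z ->
    Y z \in unitmx /\
    forall i j : 'I_n,
      is_derive (K := C_AbsRing) (V := C_NormedModule)
        (fun w => Y w i j) z ((A z *m Y z)%R i j).

(* [[z1, z2]] is a truncation of an admissible line, traversed in the direction
   [cis tau]. *)
Definition oriented_segment (a tmin tmax : R) (z1 z2 : C) : Prop :=
  exists tau d s1 s2, [/\ admissible a tmin tmax tau d, (s1 <= s2),
    z1 = line_pt tau d s1 & z2 = line_pt tau d s2].

Definition L_set (a tmin tmax : R) n (Lam : C -> 'M[C]_n) (i j : 'I_n) (x : R)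
    : Prop :=
  exists z1 z2, oriented_segment a tmin tmax z1 z2 /\
    x = Re (segment_int (fun w => Lam w i i - Lam w j j)%C z1 z2).

Definition L_condition (a tmin tmax : R) n (Lam : C -> 'M[C]_n) : Prop :=
  forall i j : 'I_n, i != j ->
    (exists M, forall x, L_set a tmin tmax Lam i j x -> (x <= M)) \/
    (exists M, forall x, L_set a tmin tmax Lam i j x -> (M <= x)).

(* The functions to which this is applied are continuous on the lines, so that
   being in L^1 amounts to the convergence of the improper Riemann integral of
   the norm, which is then the L^1 norm. *)
Definition L1_on_line n (M : C -> 'M[C]_n) (tau d : R) : Prop :=
  ex_RInt_gen (fun s => mxnorm (M (line_pt tau d s)))
    (Rbar_locally m_infty) (Rbar_locally p_infty).

Definition L1_norm_on_line n (M : C -> 'M[C]_n) (tau d : R) : R :=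
  RInt_gen (fun s => mxnorm (M (line_pt tau d s)))
    (Rbar_locally m_infty) (Rbar_locally p_infty).

Definition good_decay (a tmin tmax : R) n (M : C -> 'M[C]_n) : Prop :=
  (forall tau d, admissible a tmin tmax tau d -> L1_on_line M tau d) /\
  (forall eps : R, (0 < eps) -> exists D : R,
     forall tau d, admissible a tmin tmax tau d -> (D < d) ->
       (L1_norm_on_line M tau d < eps)).

(* [z] has a determination of the argument in [[alpha, beta + PI]]. *)
Definition in_sector (alpha beta : R) (z : C) : Prop :=
  exists r theta : R, [/\ (0 < r), (alpha <= theta <= beta + PI)
    & z = (r * cis theta)%C].

(* [Y z = (1 + o(1)) exp (int_z0^z Lam)] as [z] tends to infinity in [U] with
   argument in [[alpha, beta + PI]]; [F] is the [o(1)]. *)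
Definition asymptotic_in_sector (U : C -> Prop) n (Lam Y : C -> 'M[C]_n)
    (z0 : C) (alpha beta : R) : Prop :=
  exists F : C -> 'M[C]_n,
    (forall z p, U z -> in_sector alpha beta z ->
       polygon_in U z0 p -> last z0 p = z ->
       Y z = (1%:M + F z)%R
             *m exp_diag (fun i => polygon_int (fun w => Lam w i i) z0 p)) /\
    (forall eps : R, (0 < eps) -> exists B : R,
       forall z, U z -> in_sector alpha beta z -> (B < Cmod z) ->
         (mxnorm (F z) < eps)).

Definition asymptotic_solution (a tmin tmax : R) n (Lam M Y : C -> 'M[C]_n)
    (z0 : C) : Prop :=
  let U := domainU a tmin tmax in
  fundamental_solution U (fun z => Lam z + M z)%R Y /\
  forall alpha beta : R, (tmin < alpha) -> (alpha <= beta) ->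
    (beta < tmax) -> asymptotic_in_sector U Lam Y z0 alpha beta.

(* Main.v *)
(** The substitution [Y = E X], [E = exp (diag P_i)] with [P_i] a primitive of
    [Lam i i], turns the equation into [X' = B X], where
    [B i j = exp (- (P_i - P_j)) * Rm i j].  Far from the origin it is solved by
    the series of iterates [Phi_0 = 1], [Phi_(k+1)' = B Phi_k], where the [(i, j)]
    entry of [Phi_(k+1)] is the primitive that vanishes at one of the two ends of
    every line.  The end is the one prescribed by the L-condition, so that the
    entry is bounded by [exp (- Re (P_i - P_j))] times the L^1 norm of [Rm] on the
    line.  Such a primitive exists because its limit along a line does not depend
    on the line: for two lines through [z], in the coordinate [w] of
    [z + cexp w], this is Goursat's theorem on a half-strip.  The solution then
    extends to [U], which is a union of half-planes any three of which meet; this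
    is where simple connectedness enters, as it forces [tmax - tmin <= PI].

    For uniqueness, two solutions differ by a constant matrix [C] with
    [exp (P_i - P_j) * C i j] tending to the identity at both ends of a line,
    which the L-condition only allows for [C = 1]. *)
Require Import Defs.
From Stdlib Require Import Reals Lra ClassicalEpsilon.
From Coquelicot Require Import Coquelicot.
From mathcomp Require Import all_boot all_algebra.
From mathcomp Require Import Rstruct.

Set Implicit Arguments.
Unset Strict Implicit.
Unset Printing Implicit Defensive.

Local Open Scope R_scope.

(** The bounds [exp (- Re (P_i - P_j))] are multiplicative in the pair of indices, since
    [P_i - P_j = (P_i - P_l) + (P_l - P_j)]. They therefore pass through matrix products unchanged,
    and conjugation by [E] removes them at the end, leaving only the L^1 norm of [Rm] on a line. The
    L-condition bounds the growth of such a weight towards the prescribed end by a factor [exp M]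
    that is the same for all lines. Good decay then supplies a distance beyond which [exp M] times
    the L^1 norm is at most 1/2, and the iteration is a geometric series there; this is the meaning
    of far from the origin. Because each entry is integrated from its own end, no single base point
    at infinity serves the whole matrix, and the bounds are kept entry by entry. The error becomes
    o(1) in a closed sector because every point of the sector lies on an admissible line whose
    distance from 0 is at least a fixed multiple of the modulus. The bound on the width holds
    because a larger width would put a circle about 0 inside [U], which omits 0. *)

(** * Complex differentiability in terms of increments *)

Definition cdiff (f : C -> C) (z l : C) : Prop :=
  forall eps, 0 < eps -> exists delta, 0 < delta /\
    forall h : C, Cmod h < delta ->
      Cmod (f (z + h) - f z - l * h)%C <= eps * Cmod h.

(** Explicit increments [z + h] turn the later estimates into inequalities between moduli; the
    derivatives in the hypotheses and in the conclusion of the theorem are translated through this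
    equivalence. *)
Lemma is_derive_cdiff (f : C -> C) (z l : C) :
  is_derive (K := C_AbsRing) (V := C_NormedModule) f z l <-> cdiff f z l.
Proof.
split.
- move=> [_ H] eps Heps.
  have Hz : is_filter_lim (locally (T := AbsRing_UniformSpace C_AbsRing) z) z by [].
  have [d Hd] := H z Hz (mkposreal eps Heps).
  exists d; split; first exact: cond_pos.
  move=> h hd.
  have e : (z + h - z)%C = h by ring.
  have Hb : ball (M := AbsRing_UniformSpace C_AbsRing) z d (z + h)%C.
    by rewrite /ball /= /AbsRing_ball /abs /= /minus /plus /opp /= -/(Cminus _ _) e.
  have := Hd _ Hb.
  rewrite /norm /= /abs /minus /scal /plus /opp /= /mult /=.
  have -> : (z + h + - z = h)%C by ring.
  by have -> : (f (z + h) - f z - l * h = f (z + h) + - f z + - (h * l))%C by ring.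
- move=> H; split.
    exact: is_linear_scal_l.
  move=> y Hy.
  have <- : z = y by apply: (is_filter_lim_locally_unique (V := AbsRing_NormedModule C_AbsRing)).
  move=> eps.
  have [d [d0 Hd]] := H eps (cond_pos eps).
  exists (mkposreal d d0) => w /=.
  rewrite /ball /= /AbsRing_ball /abs /= /minus /plus /opp /= => Hw.
  have := Hd _ Hw.
  have -> : (z + (w + - z) = w)%C by ring.
  rewrite /norm /= /abs /minus /scal /plus /opp /= /mult /=.
  by have -> : (f w - f z - l * (w + - z) = f w + - f z + - ((w + - z) * l))%C by ring.
Qed.

Lemma cdiff_const (c z : C) : cdiff (fun _ => c) z 0.
Proof.
move=> eps He; exists 1; split; first lra.
move=> h _; have -> : (c - c - 0 * h = 0)%C by ring.
rewrite Cmod_0; apply: Rmult_le_pos; [lra | exact: Cmod_ge_0].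
Qed.

Lemma cdiff_id (z : C) : cdiff (fun w => w) z 1.
Proof.
move=> eps He; exists 1; split; first lra.
move=> h _; have -> : (z + h - z - 1 * h = 0)%C by ring.
rewrite Cmod_0; apply: Rmult_le_pos; [lra | exact: Cmod_ge_0].
Qed.

Lemma cdiff_plus (f g : C -> C) (z l m : C) :
  cdiff f z l -> cdiff g z m -> cdiff (fun w => f w + g w)%C z (l + m)%C.
Proof.
move=> Hf Hg eps He.
have He2 : 0 < eps / 2 by lra.
have [d1 [d1p H1]] := Hf _ He2; have [d2 [d2p H2]] := Hg _ He2.
exists (Rmin d1 d2); split; first exact: Rmin_pos.
move=> h hd.
have h1 := H1 h (Rlt_le_trans _ _ _ hd (Rmin_l _ _)).
have h2 := H2 h (Rlt_le_trans _ _ _ hd (Rmin_r _ _)).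
have -> : (f (z + h) + g (z + h) - (f z + g z) - (l + m) * h =
  (f (z + h) - f z - l * h) + (g (z + h) - g z - m * h))%C by ring.
apply: Rle_trans (Cmod_triangle _ _) _; lra.
Qed.

Lemma cdiff_near (f : C -> C) (z l : C) : cdiff f z l ->
  exists K delta, 0 < K /\ 0 < delta /\
    forall h, Cmod h < delta -> Cmod (f (z + h) - f z)%C <= K * Cmod h.
Proof.
move=> Hf; have [d [dp H]] := Hf 1 Rlt_0_1.
have l0 := Cmod_ge_0 l.
exists (1 + Cmod l), d; split; first lra.
split=> // h hd.
have -> : (f (z + h) - f z = (f (z + h) - f z - l * h) + l * h)%C by ring.
apply: Rle_trans (Cmod_triangle _ _) _; rewrite Cmod_mult.
have := H h hd; lra.
Qed.

Lemma cdiff_mult (f g : C -> C) (z l m : C) :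
  cdiff f z l -> cdiff g z m ->
  cdiff (fun w => f w * g w)%C z (l * g z + f z * m)%C.
Proof.
move=> Hf Hg eps He.
have [K [dk [Kp [dkp HK]]]] := cdiff_near Hg.
have [g0 [f0 l0]] : 0 <= Cmod (g z) /\ 0 <= Cmod (f z) /\ 0 <= Cmod l
  by split; [|split]; exact: Cmod_ge_0.
pose G := Cmod (g z) + K + 1.
have e1 : 0 < eps / (3 * G).
  by apply: Rdiv_lt_0_compat => //; rewrite /G; lra.
have e2 : 0 < eps / (3 * (Cmod (f z) + 1)).
  by apply: Rdiv_lt_0_compat => //; lra.
have [d1 [d1p H1]] := Hf _ e1; have [d2 [d2p H2]] := Hg _ e2.
(* Each of the three terms of the product increment gets [eps / 3]; [d3] serves the quadratic one,
   [l * h * (g (z + h) - g z)]. *)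
pose d3 := eps / (3 * (K * Cmod l + 1)).
have Kl : 0 <= K * Cmod l by apply: Rmult_le_pos; lra.
have d3p : 0 < d3 by apply: Rdiv_lt_0_compat => //; lra.
exists (Rmin (Rmin d1 d2) (Rmin (Rmin dk 1) d3)); split.
  by repeat apply: Rmin_pos => //; lra.
move=> h hd.
have := Rmin_l (Rmin d1 d2) (Rmin (Rmin dk 1) d3).
have := Rmin_r (Rmin d1 d2) (Rmin (Rmin dk 1) d3).
have := Rmin_l d1 d2; have := Rmin_r d1 d2.
have := Rmin_l (Rmin dk 1) d3; have := Rmin_r (Rmin dk 1) d3.
have := Rmin_l dk 1; have := Rmin_r dk 1.
move=> m1 m2 m3 m4 m5 m6 m7 m8.
have h0 := Cmod_ge_0 h.
have {}H1 := H1 h ltac:(lra); have {}H2 := H2 h ltac:(lra).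
have {}HK := HK h ltac:(lra).
have Hgz : Cmod (g (z + h)%C) <= G.
  have -> : (g (z + h) = g z + (g (z + h) - g z))%C by ring.
  apply: Rle_trans (Cmod_triangle _ _) _; rewrite /G.
  have : K * Cmod h <= K * 1 by apply: Rmult_le_compat_l; lra.
  lra.
have -> : (f (z + h) * g (z + h) - f z * g z - (l * g z + f z * m) * h =
  (f (z + h) - f z - l * h) * g (z + h) + (f z * (g (z + h) - g z - m * h)
   + l * h * (g (z + h) - g z)))%C by ring.
apply: Rle_trans (Cmod_triangle _ _) _.
apply: Rle_trans (Rplus_le_compat_l _ _ _ (Cmod_triangle _ _)) _.
rewrite !Cmod_mult.
have t1 : Cmod (f (z + h) - f z - l * h)%C * Cmod (g (z + h)%C) <= eps / 3 * Cmod h.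
  apply: Rle_trans (Rmult_le_compat _ _ _ _ _ _ H1 Hgz) _; try exact: Cmod_ge_0.
  by right; field; rewrite /G; lra.
have t2 : Cmod (f z) * Cmod (g (z + h) - g z - m * h)%C <= eps / 3 * Cmod h.
  apply: Rle_trans (Rmult_le_compat_l _ _ _ f0 H2) _.
  rewrite -Rmult_assoc; apply: Rmult_le_compat_r => //.
  have -> : Cmod (f z) * (eps / (3 * (Cmod (f z) + 1))) =
    eps / 3 * (Cmod (f z) / (Cmod (f z) + 1)) by field; lra.
  rewrite -[X in _ <= X]Rmult_1_r; apply: Rmult_le_compat_l; first lra.
  apply/Rle_div_l; lra.
have t3 : Cmod l * Cmod h * Cmod (g (z + h) - g z)%C <= eps / 3 * Cmod h.
  apply: Rle_trans (Rmult_le_compat_l _ _ _ _ HK) _; first by apply: Rmult_le_pos.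
  have -> : Cmod l * Cmod h * (K * Cmod h) = (K * Cmod l * Cmod h) * Cmod h by ring.
  apply: Rmult_le_compat_r => //.
  have : K * Cmod l * Cmod h <= (K * Cmod l + 1) * d3.
    apply: Rmult_le_compat; lra.
  have -> : (K * Cmod l + 1) * d3 = eps / 3 by rewrite /d3; field; lra.
  lra.
lra.
Qed.

Lemma cdiff_comp (f g : C -> C) (z l m : C) :
  cdiff f z l -> cdiff g (f z) m -> cdiff (fun w => g (f w)) z (m * l)%C.
Proof.
move=> Hf Hg eps He.
have [K [dk [Kp [dkp HK]]]] := cdiff_near Hf.
have m0 := Cmod_ge_0 m.
have e1 : 0 < eps / (2 * (Cmod m + 1)) by apply: Rdiv_lt_0_compat; lra.
have e2 : 0 < eps / (2 * K) by apply: Rdiv_lt_0_compat; lra.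
have [d1 [d1p H1]] := Hf _ e1; have [d2 [d2p H2]] := Hg _ e2.
exists (Rmin (Rmin d1 dk) (d2 / K)); split.
  by repeat apply: Rmin_pos => //; apply: Rdiv_lt_0_compat.
move=> h hd.
have := Rmin_l (Rmin d1 dk) (d2 / K).
have := Rmin_r (Rmin d1 dk) (d2 / K).
have := Rmin_l d1 dk; have := Rmin_r d1 dk.
move=> m1 m2 m3 m4.
have h0 := Cmod_ge_0 h.
have {}H1 := H1 h ltac:(lra).
have {}HK := HK h ltac:(lra).
have Kh : K * Cmod h < d2.
  have : Cmod h < d2 / K by lra.
  by move/(Rlt_div_r _ _ _ Kp); rewrite Rmult_comm.
have {}H2 := H2 (f (z + h) - f z)%C ltac:(lra).
have e : (f z + (f (z + h) - f z) = f (z + h))%C by ring.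
rewrite e in H2.
have -> : (g (f (z + h)) - g (f z) - m * l * h =
  (g (f (z + h)) - g (f z) - m * (f (z + h) - f z)) + m * (f (z + h) - f z - l * h))%C by ring.
apply: Rle_trans (Cmod_triangle _ _) _; rewrite Cmod_mult.
have t1 : Cmod (g (f (z + h)) - g (f z) - m * (f (z + h) - f z))%C <= eps / 2 * Cmod h.
  apply: Rle_trans H2 _.
  apply: Rle_trans (Rmult_le_compat_l _ _ _ _ HK) _; first lra.
  by right; field; lra.
have t2 : Cmod m * Cmod (f (z + h) - f z - l * h)%C <= eps / 2 * Cmod h.
  apply: Rle_trans (Rmult_le_compat_l _ _ _ m0 H1) _.
  rewrite -Rmult_assoc; apply: Rmult_le_compat_r => //.
  have -> : Cmod m * (eps / (2 * (Cmod m + 1))) =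
    eps / 2 * (Cmod m / (Cmod m + 1)) by field; lra.
  rewrite -[X in _ <= X]Rmult_1_r; apply: Rmult_le_compat_l; first lra.
  apply/Rle_div_l; lra.
lra.
Qed.

Lemma cdiff_ext_loc (f g : C -> C) (z l : C) (r : R) : 0 < r ->
  (forall h, Cmod h < r -> f (z + h)%C = g (z + h)%C) ->
  cdiff f z l -> cdiff g z l.
Proof.
move=> r0 e Hf eps He; have [d [dp H]] := Hf _ He.
exists (Rmin d r); split; first exact: Rmin_pos.
move=> h hd.
have hd1 := Rlt_le_trans _ _ _ hd (Rmin_l _ _).
have hd2 := Rlt_le_trans _ _ _ hd (Rmin_r _ _).
rewrite -e //.
have -> : g z = f z.
  by have := e 0%C; rewrite Cplus_0_r Cmod_0 => ->.
exact: H.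
Qed.

Lemma cdiff_ext (f g : C -> C) (z l : C) :
  (forall w, f w = g w) -> cdiff f z l -> cdiff g z l.
Proof. by move=> e; apply: (@cdiff_ext_loc f g z l 1 Rlt_0_1) => h _; exact: e. Qed.

Lemma cdiff_val (f : C -> C) (z l m : C) : l = m -> cdiff f z l -> cdiff f z m.
Proof. by move=> ->. Qed.

Lemma cdiff_scal (c : C) (f : C -> C) (z l : C) :
  cdiff f z l -> cdiff (fun w => c * f w)%C z (c * l)%C.
Proof.
move=> H; apply: cdiff_val (cdiff_mult (cdiff_const c z) H); ring.
Qed.

Lemma cdiff_minus (f g : C -> C) (z l m : C) :
  cdiff f z l -> cdiff g z m -> cdiff (fun w => f w - g w)%C z (l - m)%C.
Proof.
move=> Hf Hg; apply: (cdiff_ext (f := fun w => (f w + (- (1)) * g w)%C)).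
  by move=> w; ring.
apply: cdiff_val (cdiff_plus Hf (cdiff_scal (- (1))%C Hg)); ring.
Qed.

Lemma cdiff_affine (c d z : C) : cdiff (fun w => c * w + d)%C z c.
Proof.
apply: cdiff_val (cdiff_plus (cdiff_scal c (cdiff_id z)) (cdiff_const d z)); ring.
Qed.

Lemma cdiff_sum n (f : 'I_n -> C -> C) (z : C) (l : 'I_n -> C) :
  (forall i, cdiff (f i) z (l i)) ->
  cdiff (fun w => \sum_(i < n) f i w)%R z (\sum_(i < n) l i)%R.
Proof.
elim: n f l => [|n IH] f l H.
  rewrite big_ord0; apply: (cdiff_ext (f := fun=> 0%C)) (cdiff_const _ _).
  by move=> w; rewrite big_ord0.
rewrite big_ord_recl.
apply: (cdiff_ext (f := fun w => (f ord0 w + \sum_(i < n) f (lift ord0 i) w)%R)).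
  by move=> w; rewrite big_ord_recl.
by apply: cdiff_plus; [exact: H | apply: IH => i; exact: H].
Qed.

Lemma Cmod_sum n (f : 'I_n -> C) :
  Cmod (\sum_(i < n) f i)%R <= (\sum_(i < n) Cmod (f i))%R.
Proof.
elim: n f => [|n IH] f; first by rewrite !big_ord0 Cmod_0; right.
rewrite !big_ord_recl; apply: Rle_trans (Cmod_triangle _ _) _.
exact: Rplus_le_compat_l.
Qed.

(** * Curves *)

(** Stated on the two coordinates so that the real mean value theorem and [auto_derive] apply
    directly. *)
Definition rdiff (u : R -> C) (t : R) (l : C) : Prop :=
  is_derive (fun s => Re (u s)) t (Re l) /\ is_derive (fun s => Im (u s)) t (Im l).

Lemma is_derive_R_eps (f : R -> R) (t l : R) :
  (forall eps, 0 < eps -> exists delta, 0 < delta /\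
    forall h, Rabs h < delta -> Rabs (f (t + h) - f t - l * h) <= eps * Rabs h) ->
  is_derive f t l.
Proof.
move=> H; apply/is_derive_Reals => eps He.
have [d [dp Hd]] := H (eps / 2) ltac:(lra).
exists (mkposreal d dp) => h h0 hd.
have hp : 0 < Rabs h by apply: Rabs_pos_lt.
have -> : (f (t + h) - f t) / h - l = (f (t + h) - f t - l * h) / h by field.
rewrite /Rdiv Rabs_mult Rabs_inv.
apply/(Rlt_div_l _ _ _ hp).
have := Hd h hd; have := Rmult_lt_0_compat _ _ He hp; lra.
Qed.

Lemma im_le_Cmod (z : C) : Rabs (Im z) <= Cmod z.
Proof. exact: Rle_trans (Rmax_r _ _) (Rmax_Cmod z). Qed.

Lemma cdiff_rdiff (f : C -> C) (z v : C) (t : R) (l : C) :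
  cdiff f (z + t * v)%C l -> rdiff (fun s => f (z + s * v)%C) t (l * v)%C.
Proof.
move=> Hf; have v0 := Cmod_ge_0 v.
have K : forall eps, 0 < eps -> exists delta, 0 < delta /\ forall h : R,
    Rabs h < delta ->
    Cmod (f (z + RtoC (t + h) * v) - f (z + t * v) - l * v * h)%C <= eps * Rabs h.
  move=> eps He.
  have He' : 0 < eps / (Cmod v + 1) by apply: Rdiv_lt_0_compat; lra.
  have [d [dp Hd]] := Hf _ He'.
  exists (d / (Cmod v + 1)); split; first by apply: Rdiv_lt_0_compat; lra.
  have vp : 0 < Cmod v + 1 by lra.
  move=> h /(Rlt_div_r _ _ _ vp) hd.
  have r0 := Rabs_pos h.
  have e : (z + RtoC (t + h) * v = z + t * v + h * v)%C by rewrite RtoC_plus; ring.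
  have := Hd (h * v)%C; rewrite e Cmod_mult Cmod_R => Hd'.
  have -> : (l * v * h = l * (h * v))%C by ring.
  apply: Rle_trans (Hd' _) _; first nra.
  have -> : eps / (Cmod v + 1) * (Rabs h * Cmod v) =
     eps * Rabs h * (Cmod v / (Cmod v + 1)) by field; lra.
  rewrite -[X in _ <= X]Rmult_1_r; apply: Rmult_le_compat_l; first nra.
  apply/Rle_div_l; lra.
split; apply: is_derive_R_eps => eps He; have [d [dp Hd]] := K _ He;
  exists d; split=> // h hd; apply: Rle_trans (Hd h hd).
  apply: Rle_trans (re_le_Cmod _); right; congr Rabs; rewrite /Re /Im /=; ring.
apply: Rle_trans (im_le_Cmod _); right; congr Rabs; rewrite /Re /Im /=; ring.
Qed.

(* Project on the direction of the increment of [u] and compare with [v]. *)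
Lemma mean_value_le (u du : R -> C) (v dv : R -> R) (a b : R) : a <= b ->
  (forall t, a <= t <= b -> rdiff u t (du t)) ->
  (forall t, a <= t <= b -> is_derive v t (dv t)) ->
  (forall t, a <= t <= b -> Cmod (du t) <= dv t) ->
  Cmod (u b - u a)%C <= v b - v a.
Proof.
move=> ab Hu Hv Hle.
set w := (u b - u a)%C.
pose phi t := Cmod w * v t - (Re w * Re (u t) + Im w * Im (u t)).
pose dphi t := Cmod w * dv t - (Re w * Re (du t) + Im w * Im (du t)).
have w0 := Cmod_ge_0 w.
have Hphi : forall t, a <= t <= b -> is_derive phi t (dphi t).
  move=> t Ht; have [h1 h2] := Hu t Ht; have h3 := Hv t Ht.
  apply: (is_derive_minus (V := R_NormedModule)).
    exact: (is_derive_scal v t (Cmod w)).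
  apply: (is_derive_plus (V := R_NormedModule)).
    exact: (is_derive_scal (fun s => Re (u s)) t (Re w)).
  exact: (is_derive_scal (fun s => Im (u s)) t (Im w)).
have [c [Hc1 Hc2]] : exists c, Rmin a b <= c <= Rmax a b /\ phi b - phi a = dphi c * (b - a).
  apply: MVT_gen => t; rewrite Rmin_left // Rmax_right // => Ht.
    by apply: Hphi; lra.
  apply/continuity_pt_filterlim; apply: (ex_derive_continuous (V := R_NormedModule)).
  by exists (dphi t); apply: Hphi.
rewrite Rmin_left // Rmax_right // in Hc1.
have CS : Re w * Re (du c) + Im w * Im (du c) <= Cmod w * Cmod (du c).
  have -> : Re w * Re (du c) + Im w * Im (du c) = Re (Cconj w * du c)%C by rewrite /Re /Im /=; ring.
  apply: Rle_trans (Rle_abs _) _; apply: Rle_trans (re_le_Cmod _) _.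
  by rewrite Cmod_mult Cmod_conj; right.
have dphi0 : 0 <= dphi c.
  have := Rmult_le_compat_l _ _ _ w0 (Hle c Hc1); rewrite /dphi; lra.
have E : Re w * (Re (u b) - Re (u a)) + Im w * (Im (u b) - Im (u a)) = Cmod w * Cmod w.
  have -> : Cmod w * Cmod w = Cmod w ^ 2 by ring.
  by rewrite Cmod2_alt /w /Re /Im /=; ring.
have P : 0 <= dphi c * (b - a) by apply: Rmult_le_pos; lra.
have F : Cmod w * Cmod w <= Cmod w * (v b - v a).
  rewrite -Hc2 /phi in P; lra.
case: (Req_dec (Cmod w) 0) => [z0|nz].
  rewrite z0.
  have : 0 <= v b - v a; last by [].
  have [c' [Hc'1 Hc'2]] : exists c', Rmin a b <= c' <= Rmax a b /\ v b - v a = dv c' * (b - a).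
    apply: MVT_gen => t; rewrite Rmin_left // Rmax_right // => Ht.
      by apply: Hv; lra.
    apply/continuity_pt_filterlim; apply: (ex_derive_continuous (V := R_NormedModule)).
    by exists (dv t); apply: Hv.
  rewrite Rmin_left // Rmax_right // in Hc'1.
  rewrite Hc'2; apply: Rmult_le_pos; last lra.
  exact: Rle_trans (Cmod_ge_0 _) (Hle c' Hc'1).
apply: (Rmult_le_reg_l (Cmod w)) => //; lra.
Qed.

Lemma cdiff_le_const (f df : C -> C) (z w : C) (K : R) :
  (forall t, 0 <= t <= 1 -> cdiff f (z + t * (w - z))%C (df (z + t * (w - z))%C)) ->
  (forall t, 0 <= t <= 1 -> Cmod (df (z + t * (w - z))%C) <= K) ->
  Cmod (f w - f z)%C <= K * Cmod (w - z)%C.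
Proof.
move=> Hf Hle; have c0 := Cmod_ge_0 (w - z)%C.
have := @mean_value_le (fun t => f (z + t * (w - z))%C)
  (fun t => (df (z + t * (w - z)) * (w - z))%C)
  (fun t => (K * Cmod (w - z)%C) * t) (fun _ => K * Cmod (w - z)%C) 0 1 Rle_0_1.
have -> : (z + 1 * (w - z) = w)%C by ring.
have -> : (z + 0 * (w - z) = z)%C by ring.
rewrite Rmult_1_r Rmult_0_r Rminus_0_r; apply => t Ht.
- exact: cdiff_rdiff (Hf t Ht).
- auto_derive => //; ring.
- by rewrite Cmod_mult; apply: Rmult_le_compat_r; [|exact: Hle].
Qed.

(** * Line integrals and Goursat's theorem *)

Lemma C_reim (z : C) : z = (Re z + Im z * Ci)%C.
Proof. by apply: injective_projections; rewrite /Re /Im /=; ring. Qed.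

Lemma Cmod_le_abs (z : C) : Cmod z <= Rabs (Re z) + Rabs (Im z).
Proof.
rewrite {1}(C_reim z); apply: Rle_trans (Cmod_triangle _ _) _.
by rewrite Cmod_mult Cmod_Ci !Cmod_R Rmult_1_r; right.
Qed.

Lemma rdiff_is_derive (u : R -> C) (t : R) (l : C) : rdiff u t l ->
  is_derive (V := C_R_NormedModule) u t l.
Proof.
move=> [[_ H1] [_ H2]]; split.
  exact: (is_linear_scal_l (V := C_R_NormedModule)).
move=> y Hy eps.
have He2 : 0 < eps / 2 by have := cond_pos eps; lra.
have K1 := H1 y Hy (mkposreal _ He2); have K2 := H2 y Hy (mkposreal _ He2).
apply: filter_imp (filter_and _ _ K1 K2) => s [/= h1 h2].
rewrite -Cmod_norm.
have -> : norm (minus s y) = Rabs (s - y) by [].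
apply: Rle_trans (Cmod_le_abs _) _.
have -> : pos eps * Rabs (s - y) = eps / 2 * Rabs (s - y) + eps / 2 * Rabs (s - y).
  lra.
exact: (Rplus_le_compat _ _ _ _ h1 h2).
Qed.

Lemma rdiff_continuous (u : R -> C) (t : R) (l : C) : rdiff u t l ->
  continuous (U := C_R_NormedModule) u t.
Proof.
move=> H; apply: ex_derive_continuous; exists l; exact: rdiff_is_derive.
Qed.

Definition lint (f : C -> C) (z v : C) (a b : R) : C :=
  RInt (V := C_R_CompleteNormedModule) (fun t => f (z + t * v) * v)%C a b.

Lemma is_lint (f : C -> C) (z v : C) (a b : R) :
  (forall t, Rmin a b <= t <= Rmax a b -> exists l, cdiff f (z + t * v)%C l) ->
  is_RInt (V := C_R_CompleteNormedModule) (fun t => f (z + t * v) * v)%C a b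
    (lint f z v a b).
Proof.
move=> H; apply: RInt_correct; apply: ex_RInt_continuous => t Ht.
have [l Hl] := H t Ht.
apply: (@rdiff_continuous _ _ (v * l * v)%C).
apply: (cdiff_rdiff (f := fun w => (f w * v)%C)).
exact: cdiff_ext (fun w => Cmult_comm v (f w)) (cdiff_scal v Hl).
Qed.

Lemma lint_ftc (f F df : C -> C) (z v : C) (a b : R) :
  (forall t, Rmin a b <= t <= Rmax a b ->
     cdiff F (z + t * v)%C (f (z + t * v)%C)) ->
  (forall t, Rmin a b <= t <= Rmax a b -> cdiff f (z + t * v)%C (df (z + t * v)%C)) ->
  is_RInt (V := C_R_CompleteNormedModule) (fun t => f (z + t * v) * v)%C a b
    (F (z + b * v) - F (z + a * v))%C.
Proof.
move=> HF Hf.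
apply: (is_RInt_derive (V := C_R_CompleteNormedModule) (fun t => F (z + t * v)%C)).
  by move=> t Ht; apply: rdiff_is_derive; apply: cdiff_rdiff; exact: HF.
move=> t Ht; apply: (@rdiff_continuous _ _ (v * df (z + t * v) * v)%C).
apply: (cdiff_rdiff (f := fun w => (f w * v)%C)).
apply: (cdiff_ext (f := fun w => (v * f w)%C)); first by move=> w; ring.
exact: cdiff_scal (Hf t Ht).
Qed.

(** Replacing [f] by a nearby function with a known primitive evaluates the integral up to a
    controlled error. Goursat's theorem takes [g] affine, the construction of primitives takes [g]
    constant. *)
Lemma lint_approx (f g G dg : C -> C) (z v : C) (a b K : R) : a <= b -> Cmod v = 1 ->
  (forall t, a <= t <= b -> exists l, cdiff f (z + t * v)%C l) ->
  (forall t, a <= t <= b -> cdiff G (z + t * v)%C (g (z + t * v)%C)) ->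
  (forall t, a <= t <= b -> cdiff g (z + t * v)%C (dg (z + t * v)%C)) ->
  (forall t, a <= t <= b -> Cmod (f (z + t * v) - g (z + t * v))%C <= K) ->
  Cmod (lint f z v a b - (G (z + b * v) - G (z + a * v)))%C <= K * (b - a).
Proof.
move=> ab v1 Hf HG Hg HK.
have I1 := @is_lint f z v a b; have I2 := @lint_ftc g G dg z v a b.
rewrite Rmin_left // Rmax_right // in I1, I2.
have I := is_RInt_minus (V := C_R_CompleteNormedModule) _ _ _ _ _ _ (I1 Hf) (I2 HG Hg).
rewrite Rmult_comm Cmod_norm.
apply: (norm_RInt_le_const (V := C_R_CompleteNormedModule)) ab _ I => t Ht.
rewrite -Cmod_norm.
have E : (f (z + t * v) * v - g (z + t * v) * v = (f (z + t * v) - g (z + t * v)) * v)%C.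
  by ring.
rewrite -[minus _ _]/(f (z + t * v) * v - g (z + t * v) * v)%C E.
by rewrite Cmod_mult v1 Rmult_1_r; exact: HK.
Qed.

Lemma lint_Chasles (f : C -> C) (z v : C) (a b c : R) :
  (forall t, Rmin a b <= t <= Rmax a b -> exists l, cdiff f (z + t * v)%C l) ->
  (forall t, Rmin b c <= t <= Rmax b c -> exists l, cdiff f (z + t * v)%C l) ->
  lint f z v a c = (lint f z v a b + lint f z v b c)%C.
Proof.
move=> H1 H2; symmetry; apply: (RInt_Chasles (V := C_R_CompleteNormedModule)).
  by exists (lint f z v a b); exact: is_lint.
by exists (lint f z v b c); exact: is_lint.
Qed.

Lemma lint_swap (f : C -> C) (z v : C) (a b : R) :
  (forall t, Rmin a b <= t <= Rmax a b -> exists l, cdiff f (z + t * v)%C l) ->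
  lint f z v b a = (- lint f z v a b)%C.
Proof.
move=> H; apply: (is_RInt_unique (V := C_R_CompleteNormedModule)).
exact: (is_RInt_swap (V := C_R_CompleteNormedModule)) (is_lint H).
Qed.

Definition rect_int (f : C -> C) (x1 x2 y1 y2 : R) : C :=
  (lint f (y1 * Ci) 1 x1 x2 + lint f x2 Ci y1 y2
   - lint f (y2 * Ci) 1 x1 x2 - lint f x1 Ci y1 y2)%C.

Definition holo_rect (f : C -> C) (x1 x2 y1 y2 : R) : Prop :=
  forall x y, x1 <= x <= x2 -> y1 <= y <= y2 -> exists l, cdiff f (x + y * Ci)%C l.

Lemma holo_rect_h (f : C -> C) (x1 x2 y1 y2 y a b : R) : holo_rect f x1 x2 y1 y2 ->
  y1 <= y <= y2 -> x1 <= a <= x2 -> x1 <= b <= x2 ->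
  forall t, Rmin a b <= t <= Rmax a b -> exists l, cdiff f (y * Ci + t * 1)%C l.
Proof.
move=> H Hy Ha Hb t Ht; have e : (y * Ci + t * 1 = t + y * Ci)%C by ring.
by rewrite e; apply: H => //; move: Ht; rewrite /Rmin /Rmax; case: Rle_dec => ?; lra.
Qed.

Lemma holo_rect_v (f : C -> C) (x1 x2 y1 y2 x a b : R) : holo_rect f x1 x2 y1 y2 ->
  x1 <= x <= x2 -> y1 <= a <= y2 -> y1 <= b <= y2 ->
  forall t, Rmin a b <= t <= Rmax a b -> exists l, cdiff f (x + t * Ci)%C l.
Proof.
move=> H Hy Ha Hb t Ht.
by apply: H => //; move: Ht; rewrite /Rmin /Rmax; case: Rle_dec => ?; lra.
Qed.

Lemma rect_int_quarter (f : C -> C) (x1 x x2 y1 y y2 : R) :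
  holo_rect f x1 x2 y1 y2 -> x1 <= x <= x2 -> y1 <= y <= y2 ->
  rect_int f x1 x2 y1 y2 =
  (rect_int f x1 x y1 y + rect_int f x x2 y1 y
   + rect_int f x1 x y y2 + rect_int f x x2 y y2)%C.
Proof.
move=> H Hx Hy; rewrite /rect_int.
rewrite (@lint_Chasles f (y1 * Ci) 1 x1 x x2); try (apply: (holo_rect_h H); lra).
rewrite (@lint_Chasles f (y2 * Ci) 1 x1 x x2); try (apply: (holo_rect_h H); lra).
rewrite (@lint_Chasles f x1 Ci y1 y y2); try (apply: (holo_rect_v H); lra).
rewrite (@lint_Chasles f x2 Ci y1 y y2); try (apply: (holo_rect_v H); lra).
ring.
Qed.

Lemma exists_quarter (A B P Q : C) (c : R) : c <= Cmod (A + B + P + Q)%C ->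
  c / 4 <= Cmod A \/ c / 4 <= Cmod B \/ c / 4 <= Cmod P \/ c / 4 <= Cmod Q.
Proof.
move=> H.
have := Cmod_triangle (A + B + P)%C Q; have := Cmod_triangle (A + B)%C P.
have := Cmod_triangle A B; lra.
Qed.

Lemma rect_int_small (f : C -> C) (x1 x2 y1 y2 : R) (p l : C) (eps d : R) :
  holo_rect f x1 x2 y1 y2 -> x1 <= x2 -> y1 <= y2 -> 0 <= eps ->
  (forall x y, x1 <= x <= x2 -> y1 <= y <= y2 -> Cmod (x + y * Ci - p)%C <= d) ->
  (forall h, Cmod h <= d -> Cmod (f (p + h) - f p - l * h)%C <= eps * Cmod h) ->
  Cmod (rect_int f x1 x2 y1 y2) <= 2 * (eps * d) * ((x2 - x1) + (y2 - y1)).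
Proof.
move=> H Hx Hy e0 Hd Hf.
pose g w := (f p + l * (w - p))%C.
pose G w := (f p * w + l / 2 * ((w - p) * (w - p)))%C.
have Hg w : cdiff g w l.
  apply: (cdiff_ext (f := fun w => (l * w + (f p - l * p))%C)).
    by move=> u; rewrite /g; ring.
  exact: cdiff_affine.
have HG w : cdiff G w (g w).
  have D := cdiff_affine 1 (- p) w.
  apply: (cdiff_ext (f := fun w => (f p * w + l / 2 * ((1 * w + - p) * (1 * w + - p)))%C)).
    by move=> u; rewrite /G; ring.
  apply: cdiff_val (cdiff_plus (cdiff_scal (f p) (cdiff_id w)) (cdiff_scal (l / 2) (cdiff_mult D D))).
  by rewrite /g; field; apply: RtoC_neq; lra.
have Hfg w : Cmod (w - p)%C <= d -> Cmod (f w - g w)%C <= eps * d.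
  move=> Hw; have := Hf _ Hw; have -> : (p + (w - p) = w)%C by ring.
  have -> : (f w - f p - l * (w - p) = f w - g w)%C by rewrite /g; ring.
  move=> h; apply: Rle_trans h _; exact: Rmult_le_compat_l.
have AH y : y1 <= y <= y2 ->
    Cmod (lint f (y * Ci) 1 x1 x2 - (G (y * Ci + x2 * 1) - G (y * Ci + x1 * 1)))%C
      <= eps * d * (x2 - x1).
  move=> Hy'; apply: (lint_approx (g := g) (dg := fun=> l)) => //; first exact: Cmod_1.
    have := @holo_rect_h f x1 x2 y1 y2 y x1 x2 H Hy'.
    rewrite Rmin_left // Rmax_right //; apply; lra.
  move=> t Ht; apply: Hfg.
  by have -> : (y * Ci + t * 1 = t + y * Ci)%C by [ring]; apply: Hd.
have AV x : x1 <= x <= x2 ->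
    Cmod (lint f x Ci y1 y2 - (G (x + y2 * Ci) - G (x + y1 * Ci)))%C
      <= eps * d * (y2 - y1).
  move=> Hx'; apply: (lint_approx (g := g) (dg := fun=> l)) => //; first exact: Cmod_Ci.
    have := @holo_rect_v f x1 x2 y1 y2 x y1 y2 H Hx'.
    rewrite Rmin_left // Rmax_right //; apply; lra.
  by move=> t Ht; apply: Hfg; apply: Hd.
have h1 := AH y1 ltac:(lra); have h2 := AH y2 ltac:(lra).
have h3 := AV x1 ltac:(lra); have h4 := AV x2 ltac:(lra).
have E x y : (y * Ci + x * 1 = x + y * Ci)%C by ring.
rewrite !E in h1 h2.
set a1 := (lint f (y1 * Ci) 1 x1 x2 - _)%C in h1.
set a2 := (lint f (y2 * Ci) 1 x1 x2 - _)%C in h2.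
set a3 := (lint f x1 Ci y1 y2 - _)%C in h3.
set a4 := (lint f x2 Ci y1 y2 - _)%C in h4.
(* The values of [G] at the four corners cancel. *)
have -> : rect_int f x1 x2 y1 y2 = (a1 + a4 + - a2 + - a3)%C.
  by rewrite /rect_int /a1 /a2 /a3 /a4; ring.
have := Cmod_triangle (a1 + a4 + - a2)%C (- a3)%C.
have := Cmod_triangle (a1 + a4)%C (- a2)%C.
have := Cmod_triangle a1 a4; rewrite !Cmod_opp; lra.
Qed.

Section NestedIntervals.

Variables (x : nat -> R) (w : R).
Hypothesis step : forall k, x k <= x (S k) /\ x (S k) + w / 2 ^ (S k) <= x k + w / 2 ^ k.
Hypothesis w0 : 0 <= w.

(** The common point is the supremum of the left ends, as every left end lies below every right
    end. *)
Lemma nested_lim : exists X, forall k, x k <= X <= x k + w / 2 ^ k.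
Proof.
have pos k : 0 <= w / 2 ^ k.
  by apply: Rdiv_le_0_compat => //; apply: pow_lt; lra.
have mono k j : x k <= x (k + j)%coq_nat /\
    x (k + j)%coq_nat + w / 2 ^ (k + j)%coq_nat <= x k + w / 2 ^ k.
  elim: j => [|j [IH1 IH2]]; first by rewrite Nat.add_0_r; lra.
  rewrite Nat.add_succ_r; have [s1 s2] := step (k + j)%coq_nat.
  split; [exact: Rle_trans IH1 s1 | exact: Rle_trans s2 IH2].
have ub k j : x j <= x k + w / 2 ^ k.
  case: (Nat.le_ge_cases j k) => h.
    have := mono j (k - j)%coq_nat; have := pos k.
    have -> : (j + (k - j) = k)%coq_nat by rewrite Nat.add_comm Nat.sub_add.
    lra.
  have := mono k (j - k)%coq_nat; have := pos j.
  have -> : (k + (j - k) = j)%coq_nat by rewrite Nat.add_comm Nat.sub_add.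
  lra.
have [X [HX1 HX2]] : {m | is_lub (fun r => exists k, r = x k) m}.
  apply: completeness; last by exists (x 0%nat), 0%nat.
  by exists (x 0%nat + w / 2 ^ 0) => r [k ->].
exists X => k; split; first by apply: HX1; exists k.
by apply: HX2 => r [j ->].
Qed.

End NestedIntervals.

Lemma pow2_small (A d : R) : 0 < d -> exists k, A / 2 ^ k < d.
Proof.
move=> dp.
have [N HN] := pow_lt_1_zero (/ 2) ltac:(rewrite Rabs_pos_eq; lra) (d / (Rabs A + 1))
  ltac:(apply: Rdiv_lt_0_compat => //; have := Rabs_pos A; lra).
exists N; have := HN N (le_n _).
have p2 : 0 < / 2 ^ N by apply: Rinv_0_lt_compat; apply: pow_lt; lra.
rewrite pow_inv Rabs_pos_eq; last lra.
have A0 := Rabs_pos A; have A1 := Rle_abs A.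
have A2 : 0 < Rabs A + 1 by lra.
move/(Rlt_div_r _ _ _ A2) => h.
rewrite /Rdiv; nra.
Qed.

(** Bisection: if the integral had modulus [c > 0], some quarter at depth [k] would keep at least
    [c / 4 ^ k], while differentiability at the limit point of these quarters allows only an
    arbitrarily small multiple of [/ 4 ^ k]. *)
Lemma goursat_le (f : C -> C) (x0 w y0 h : R) : 0 <= w -> 0 <= h ->
  holo_rect f x0 (x0 + w) y0 (y0 + h) ->
  rect_int f x0 (x0 + w) y0 (y0 + h) = 0.
Proof.
move=> w0 h0 H; apply: Cmod_eq_0; apply: Rle_antisym; last exact: Cmod_ge_0.
set c := Cmod _; apply: Rnot_gt_le => c0.
pose W k := w / 2 ^ k; pose L k := h / 2 ^ k.
have p2 k : 0 < 2 ^ k by apply: pow_lt; lra.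
have Wp k : 0 <= W k by exact: Rdiv_le_0_compat.
have Lp k : 0 <= L k by exact: Rdiv_le_0_compat.
have WS k : W (S k) = W k / 2 by rewrite /W /=; field; apply: Rgt_not_eq.
have LS k : L (S k) = L k / 2 by rewrite /L /=; field; apply: Rgt_not_eq.
pose Inv k (p : R * R) := x0 <= p.1 /\ p.1 + W k <= x0 + w /\ y0 <= p.2 /\
  p.2 + L k <= y0 + h /\
  c / 4 ^ k <= Cmod (rect_int f p.1 (p.1 + W k) p.2 (p.2 + L k)).
pose next k (p q : R * R) := Inv (S k) q /\ (p.1 <= q.1 <= p.1 + W (S k)) /\
  (p.2 <= q.2 <= p.2 + L (S k)).
have stepP k p : Inv k p -> exists q, next k p q.
  case: p => x y [/= i1 [i2 [i3 [i4 i5]]]].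
  have Wk := Wp k; have Lk := Lp k.
  have WSk := WS k; have LSk := LS k.
  have hR : holo_rect f x (x + W k) y (y + L k).
    by move=> u v Hu Hv; apply: H; lra.
  have e1 : x + W (S k) + W (S k) = x + W k by lra.
  have e2 : y + L (S k) + L (S k) = y + L k by lra.
  have E := @rect_int_quarter f x (x + W (S k)) (x + W k) y (y + L (S k)) (y + L k) hR
    ltac:(lra) ltac:(lra).
  rewrite E in i5.
  have c4 : c / 4 ^ S k = c / 4 ^ k / 4.
    by rewrite /=; field; apply: pow_nonzero; lra.
  case: (exists_quarter i5) => [q|[q|[q|q]]].
  - exists (x, y); rewrite /next /Inv /= -/(4 ^ S k) c4; repeat split; lra.
  - exists (x + W (S k), y); rewrite /next /Inv /= -/(4 ^ S k) c4 e1; repeat split; lra.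
  - exists (x, y + L (S k)); rewrite /next /Inv /= -/(4 ^ S k) c4 e2; repeat split; lra.
  - exists (x + W (S k), y + L (S k)); rewrite /next /Inv /= -/(4 ^ S k) c4 e1 e2; repeat split; lra.
(* Dependent choice of one quarter per step; a rectangle is recorded by its lower left corner. *)
pose fix P k : R * R := if k is S k' then epsilon (inhabits (0, 0)) (next k' (P k')) else (x0, y0).
have P0 : Inv 0%nat (P 0%nat).
  by rewrite /Inv /W /L /= !Rdiv_1_r -/c; repeat split; lra.
have PS k : Inv k (P k) -> next k (P k) (P (S k)).
  by move=> i; apply: epsilon_spec; exact: stepP.
have PI k : Inv k (P k) by elim: k => [//|k /PS []].
have [X HX] : exists X, forall k, (P k).1 <= X <= (P k).1 + w / 2 ^ k.
  apply: nested_lim => // k; have [_ [q _]] := PS k (PI k).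
  have := WS k; rewrite /W in q *; lra.
have [Y HY] : exists Y, forall k, (P k).2 <= Y <= (P k).2 + h / 2 ^ k.
  apply: nested_lim => // k; have [_ [_ q]] := PS k (PI k).
  have := LS k; rewrite /L in q *; lra.
have [l Hl] : exists l, cdiff f (X + Y * Ci)%C l.
  apply: H; first by have := HX 0%nat; rewrite /= Rdiv_1_r.
  by have := HY 0%nat; rewrite /= Rdiv_1_r.
pose S2 := (w + h) * (w + h).
have S20 : 0 <= S2 by apply: Rmult_le_pos; lra.
(* With this precision the estimate of [rect_int_small] becomes [c * S2 / (2 * S2 + 1) / 4 ^ k],
   below the lower bound [c / 4 ^ k]. *)
have e0 : 0 < c / (2 * S2 + 1) / 2.
  apply: Rdiv_lt_0_compat; last lra.
  by apply: Rdiv_lt_0_compat => //; lra.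
have [d [dp Hd]] := Hl _ e0.
have [k Hk] := pow2_small (w + h) dp.
have [i1 [i2 [i3 [i4 i5]]]] := PI k.
have Wk := Wp k; have Lk := Lp k.
have hR : holo_rect f (P k).1 ((P k).1 + W k) (P k).2 ((P k).2 + L k).
  by move=> u v Hu Hv; apply: H; lra.
have e : (w + h) / 2 ^ k = W k + L k by rewrite /W /L; field; apply: Rgt_not_eq.
have := @rect_int_small f (P k).1 ((P k).1 + W k) (P k).2 ((P k).2 + L k)
  (X + Y * Ci)%C l (c / (2 * S2 + 1) / 2) (W k + L k) hR ltac:(lra) ltac:(lra) ltac:(lra).
have a1 x y : (P k).1 <= x <= (P k).1 + W k -> (P k).2 <= y <= (P k).2 + L k ->
   Cmod (x + y * Ci - (X + Y * Ci))%C <= W k + L k.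
  move=> Hx Hy; apply: Rle_trans (Cmod_le_abs _) _.
  have := HX k; have := HY k; rewrite -/(W k) -/(L k) => HYk HXk.
  have -> : Re (x + y * Ci - (X + Y * Ci))%C = x - X by rewrite /Re /=; ring.
  have -> : Im (x + y * Ci - (X + Y * Ci))%C = y - Y by rewrite /Im /=; ring.
  by apply: Rplus_le_compat; apply: Rabs_le; lra.
have a2 : forall q, Cmod q <= W k + L k ->
    Cmod (f (X + Y * Ci + q) - f (X + Y * Ci) - l * q)%C <= c / (2 * S2 + 1) / 2 * Cmod q.
  by move=> q Hq; apply: Hd; lra.
move=> /(_ a1 a2) a3.
have : c / 4 ^ k <= 2 * (c / (2 * S2 + 1) / 2) * ((w + h) / 2 ^ k) * ((w + h) / 2 ^ k).
  rewrite e; apply: Rle_trans i5 _; apply: Rle_trans a3 _; right; ring.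
have -> : 2 * (c / (2 * S2 + 1) / 2) * ((w + h) / 2 ^ k) * ((w + h) / 2 ^ k) =
  (c * S2 / (2 * S2 + 1)) / 4 ^ k.
  have -> : 4 ^ k = 2 ^ k * 2 ^ k by rewrite -Rpow_mult_distr; congr (_ ^ _); ring.
  rewrite /S2; field; split; last exact: Rgt_not_eq.
  by have := S20; rewrite /S2; lra.
have p4 : 0 < / 4 ^ k by apply: Rinv_0_lt_compat; apply: pow_lt; lra.
move/(Rmult_le_reg_r _ _ _ p4) => Hc.
have : c * (2 * S2 + 1) <= c * S2.
  by apply/Rle_div_r; lra.
nra.
Qed.

(** * Primitives on half-planes *)

Definition half_plane (a tau : R) (z : C) : Prop := a < Im (cis (- tau) * z)%C.

Definition holo_on (U : C -> Prop) (f : C -> C) : Prop :=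
  forall z, U z -> exists l, cdiff f z l.

(** Exchanging two opposite sides only changes the sign. Corners in any order spare a case
    distinction in [upper_primitive], where the increment may have either sign in each
    coordinate. *)
Lemma goursat (f : C -> C) (x1 x2 y1 y2 : R) :
  holo_rect f (Rmin x1 x2) (Rmax x1 x2) (Rmin y1 y2) (Rmax y1 y2) ->
  rect_int f x1 x2 y1 y2 = 0.
Proof.
have base u1 u2 v1 v2 : u1 <= u2 -> v1 <= v2 -> holo_rect f u1 u2 v1 v2 ->
    rect_int f u1 u2 v1 v2 = 0.
  move=> hu hv; have := @goursat_le f u1 (u2 - u1) v1 (v2 - v1) ltac:(lra) ltac:(lra).
  have -> : u1 + (u2 - u1) = u2 by ring.
  by have -> : v1 + (v2 - v1) = v2 by ring.
move=> H.
have [[a1 a2] [b1 b2]] : (Rmin x1 x2 <= x1 <= Rmax x1 x2 /\ Rmin x1 x2 <= x2 <= Rmax x1 x2)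
  /\ (Rmin y1 y2 <= y1 <= Rmax y1 y2 /\ Rmin y1 y2 <= y2 <= Rmax y1 y2).
  by rewrite /Rmin /Rmax; do 2!case: Rle_dec => ?; lra.
have S1 := lint_swap (holo_rect_h H b1 a1 a2).
have S2 := lint_swap (holo_rect_h H b2 a1 a2).
have S3 := lint_swap (holo_rect_v H a1 b1 b2).
have S4 := lint_swap (holo_rect_v H a2 b1 b2).
have neg u : (- u = 0 -> u = 0)%C by move=> h; have -> : u = (- - u)%C by [ring]; rewrite h; ring.
move: H {a1 a2 b1 b2}; rewrite /Rmin /Rmax.
case: (Rle_dec x1 x2) => hx; case: (Rle_dec y1 y2) => hy H.
- exact: base.
- apply: neg; rewrite -(base x1 x2 y2 y1) //; last lra.
  by rewrite /rect_int S3 S4; ring.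
- apply: neg; rewrite -(base x2 x1 y1 y2) //; last lra.
  by rewrite /rect_int S1 S2; ring.
- rewrite -(base x2 x1 y2 y1) //; try lra.
  by rewrite /rect_int S1 S2 S3 S4; ring.
Qed.

Lemma lint_near_const (f : C -> C) (c z v : C) (a b K : R) : Cmod v = 1 ->
  (forall t, Rmin a b <= t <= Rmax a b -> exists l, cdiff f (z + t * v)%C l) ->
  (forall t, Rmin a b <= t <= Rmax a b -> Cmod (f (z + t * v) - c)%C <= K) ->
  Cmod (lint f z v a b - c * ((b - a) * v))%C <= K * Rabs (b - a).
Proof.
move=> v1.
have base u w : u <= w ->
  (forall t, u <= t <= w -> exists l, cdiff f (z + t * v)%C l) ->
  (forall t, u <= t <= w -> Cmod (f (z + t * v) - c)%C <= K) ->
  Cmod (lint f z v u w - c * ((w - u) * v))%C <= K * (w - u).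
  move=> uw H1 H2.
  have -> : (c * ((w - u) * v) = (c * (z + w * v) + 0) - (c * (z + u * v) + 0))%C by ring.
  apply: (@lint_approx f (fun=> c) (fun w => c * w + 0)%C (fun=> 0%C)) => // t Ht.
    exact: cdiff_affine.
  exact: cdiff_const.
move=> H1 H2; case: (Rle_dec a b) => h.
  rewrite Rmin_left // Rmax_right // in H1 H2.
  rewrite Rabs_pos_eq; last lra.
  exact: base.
have S := lint_swap H1.
rewrite Rmin_right ?Rmax_left in H1 H2; try lra.
rewrite Rabs_left; last lra.
have := base b a ltac:(lra) H1 H2; rewrite S => B.
have -> : K * - (b - a) = K * (a - b) by ring.
apply: Rle_trans B; right; rewrite -Cmod_opp; congr Cmod; ring.
Qed.

Lemma Rmin_Rmax_bound (a b t d : R) : Rabs (b - a) < d ->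
  Rmin a b <= t <= Rmax a b -> Rabs (t - a) < d.
Proof.
rewrite /Rmin /Rmax; case: Rle_dec => ? /Rabs_def2 ? ?; apply: Rabs_def1; lra.
Qed.

(** The primitive is the integral along a path that runs horizontally at height [a + 1], then
    vertically. For an increment, Goursat's theorem between the heights [y0] and [y] moves the new
    horizontal piece up to height [y], next to [z], where [f] is almost [f z]. *)
Lemma upper_primitive (a : R) (f : C -> C) :
  holo_on (fun z => a < Im z) f ->
  exists F, forall z, a < Im z -> cdiff F z (f z).
Proof.
move=> Hf; pose y0 := a + 1.
exists (fun z => lint f (y0 * Ci) 1 0 (Re z) + lint f (Re z) Ci y0 (Im z))%C.
move=> z Hz eps He.
have He2 : 0 < eps / 2 by lra.
have [l Hl] := Hf z Hz.
have [K [d [Kp [dp HK]]]] := cdiff_near Hl.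
have pt (x y : R) : a < y -> exists l, cdiff f (x + y * Ci)%C l.
  move=> Hy; apply: Hf.
  by have -> : Im (x + y * Ci)%C = y by [rewrite /Im /=; ring].
have pt' (x y : R) : a < y -> exists l, cdiff f (y * Ci + x * 1)%C l.
  by move=> Hy; rewrite Cmult_1_r Cplus_comm; exact: pt.
have mn u v t : a < u -> a < v -> Rmin u v <= t <= Rmax u v -> a < t.
  by rewrite /Rmin /Rmax; case: Rle_dec => ?; lra.
(* [d / 2], as two coordinate displacements below [r] add up to less than [d]; [eps / 2 / K / 2]
   keeps the variation of [f] within [eps / 2]; [Im z - a] keeps the path in the half-plane. *)
set r := Rmin (d / 2) (Rmin (eps / 2 / K / 2) (Im z - a)).
have r1 : r <= d / 2 by exact: Rmin_l.
have r2 : r <= eps / 2 / K / 2 by apply: Rle_trans (Rmin_r _ _) (Rmin_l _ _).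
have r3 : r <= Im z - a by apply: Rle_trans (Rmin_r _ _) (Rmin_r _ _).
have eK : 0 < eps / 2 / K / 2.
  by apply: Rdiv_lt_0_compat; last lra; apply: Rdiv_lt_0_compat.
exists r; split; first by repeat apply: Rmin_pos; lra.
move=> h hr.
set x := Re z; set y := Im z; set x' := Re (z + h)%C; set y' := Im (z + h)%C.
have ex : x' - x = Re h by rewrite /x' /x /Re /=; ring.
have ey : y' - y = Im h by rewrite /y' /y /Im /=; ring.
have bx : Rabs (x' - x) < r by rewrite ex; apply: Rle_lt_trans (re_le_Cmod _) hr.
have byy : Rabs (y' - y) < r by rewrite ey; apply: Rle_lt_trans (im_le_Cmod _) hr.
have ay' : a < y' by have := Rabs_def2 _ _ byy; rewrite -/y in r3; lra.
have ay0 : a < y0 by rewrite /y0; lra.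
have C1 : lint f (y0 * Ci) 1 0 x' = (lint f (y0 * Ci) 1 0 x + lint f (y0 * Ci) 1 x x')%C.
  by apply: lint_Chasles => t _; exact: pt'.
have C2 : lint f x' Ci y0 y' = (lint f x' Ci y0 y + lint f x' Ci y y')%C.
  by apply: lint_Chasles => t Ht; apply: pt; apply: mn Ht.
have G : rect_int f x x' y0 y = 0.
  by apply: goursat => u v _ Hv; apply: pt; apply: mn Hv.
have near (t s : R) : Rabs (t - x) < r -> Rabs (s - y) < r ->
    Cmod (f (t + s * Ci) - f z)%C <= eps / 2.
  move=> Ht Hs.
  have e : (t + s * Ci = z + ((t - x) + (s - y) * Ci))%C.
    by rewrite {1}(C_reim z) -/x -/y; ring.
  have b : Cmod ((t - x) + (s - y) * Ci)%C < 2 * r.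
    apply: Rle_lt_trans (Cmod_triangle _ _) _.
    rewrite Cmod_mult Cmod_Ci -!RtoC_minus !Cmod_R; lra.
  rewrite e; apply: Rle_trans (HK _ _) _; first lra.
  have -> : eps / 2 = K * (eps / 2 / K) by field; lra.
  by apply: Rmult_le_compat_l; lra.
have n0 : Rabs (x - x) < r /\ Rabs (y - y) < r.
  rewrite !Rminus_diag_eq // Rabs_R0.
  have := Rle_lt_trans _ _ _ (Rabs_pos _) bx; lra.
have A1 : Cmod (lint f (y * Ci) 1 x x' - f z * ((x' - x) * 1))%C <= eps / 2 * Rabs (x' - x).
  apply: lint_near_const; first exact: Cmod_1.
    by move=> t _; exact: pt'.
  move=> t Ht; rewrite Cmult_1_r Cplus_comm; apply: near; last exact: (proj2 n0).
  exact: Rmin_Rmax_bound Ht.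
have A2 : Cmod (lint f x' Ci y y' - f z * ((y' - y) * Ci))%C <= eps / 2 * Rabs (y' - y).
  apply: lint_near_const; first exact: Cmod_Ci.
    by move=> t Ht; apply: pt; apply: mn Ht.
  move=> t Ht; apply: near => //.
  exact: Rmin_Rmax_bound Ht.
have eh : h = ((x' - x) * 1 + (y' - y) * Ci)%C.
  rewrite {1}(C_reim h) -!RtoC_minus ex ey; ring.
have -> : (lint f (y0 * Ci) 1 0 x' + lint f x' Ci y0 y' -
   (lint f (y0 * Ci) 1 0 x + lint f x Ci y0 y) - f z * h =
   (lint f (y * Ci) 1 x x' - f z * ((x' - x) * 1)) +
   (lint f x' Ci y y' - f z * ((y' - y) * Ci)) + rect_int f x x' y0 y)%C.
  by rewrite C1 C2 {1}eh /rect_int; ring.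
rewrite G Cplus_0_r; apply: Rle_trans (Cmod_triangle _ _) _.
have := re_le_Cmod h; have := im_le_Cmod h; rewrite -ex -ey => b1 b2.
have := Rmult_le_compat_l (eps / 2) _ _ ltac:(lra) b1.
have := Rmult_le_compat_l (eps / 2) _ _ ltac:(lra) b2.
lra.
Qed.

Lemma cis_add (s t : R) : cis (s + t) = (cis s * cis t)%C.
Proof. by rewrite /cis cos_plus sin_plus; apply: injective_projections => /=; ring. Qed.

Lemma cis_0 : cis 0 = 1%C.
Proof. by rewrite /cis cos_0 sin_0. Qed.

Lemma cis_opp_l (t : R) : (cis (- t) * cis t = 1)%C.
Proof. by rewrite -cis_add Rplus_opp_l cis_0. Qed.

Lemma Cmod_cis (t : R) : Cmod (cis t) = 1.
Proof.
rewrite /cis /Cmod /= !Rmult_1_r -[_ + _]/(Rsqr (cos t) + Rsqr (sin t)).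
by rewrite Rplus_comm sin2_cos2 sqrt_1.
Qed.

Lemma half_primitive (a tau : R) (f : C -> C) :
  holo_on (half_plane a tau) f ->
  exists F, forall z, half_plane a tau z -> cdiff F z (f z).
Proof.
move=> Hf.
have rot z : (cis tau * (cis (- tau) * z) = z)%C.
  by rewrite Cmult_assoc [(cis tau * _)%C]Cmult_comm cis_opp_l Cmult_1_l.
have rot' z : (cis (- tau) * (cis tau * z) = z)%C.
  by rewrite Cmult_assoc cis_opp_l Cmult_1_l.
have aff c z : cdiff (fun w => c * w)%C z c.
  by apply: cdiff_val (cdiff_scal c (cdiff_id z)); ring.
have [|F HF] := @upper_primitive a (fun w => f (cis tau * w)%C).
  move=> w Hw; have [|l Hl] := Hf (cis tau * w)%C; first by rewrite /half_plane rot'.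
  by exists (l * cis tau)%C; exact: cdiff_comp (aff _ _) Hl.
exists (fun z => cis tau * F (cis (- tau) * z))%C => z Hz.
have := cdiff_scal (cis tau) (cdiff_comp (aff (cis (- tau)) z) (HF _ Hz)).
apply: cdiff_val; rewrite rot.
by rewrite -{2}[f z]Cmult_1_r -(cis_opp_l tau); ring.
Qed.

Lemma half_plane_open (a tau : R) (z : C) : half_plane a tau z ->
  exists r, 0 < r /\ forall h, Cmod h < r -> half_plane a tau (z + h)%C.
Proof.
rewrite /half_plane => Hz; exists (Im (cis (- tau) * z)%C - a); split; first lra.
move=> h Hh; rewrite Cmult_plus_distr_l.
have : Rabs (Im (cis (- tau) * h)%C) <= Cmod h.
  by apply: Rle_trans (im_le_Cmod _) _; rewrite Cmod_mult Cmod_cis Rmult_1_l; right.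
have -> : Im (cis (- tau) * z + cis (- tau) * h)%C = Im (cis (- tau) * z)%C + Im (cis (- tau) * h)%C by [].
by move/Rabs_le_between; lra.
Qed.

Lemma half_plane_convex (a tau : R) (z w : C) (t : R) : half_plane a tau z ->
  half_plane a tau w -> 0 <= t <= 1 -> half_plane a tau (z + t * (w - z))%C.
Proof.
rewrite /half_plane => Hz Hw Ht.
have -> : Im (cis (- tau) * (z + t * (w - z)))%C =
  (1 - t) * Im (cis (- tau) * z)%C + t * Im (cis (- tau) * w)%C.
  by rewrite /Im /=; ring.
case: (Req_dec t 0) => [->|t0]; first lra.
have : 0 < t by lra.
nra.
Qed.

Lemma half_plane_le (a b tau : R) (z : C) : a <= b -> half_plane b tau z -> half_plane a tau z.
Proof. rewrite /half_plane; lra. Qed.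

Definition convex (U : C -> Prop) : Prop := forall z w t, U z -> U w ->
  0 <= t <= 1 -> U (z + t * (w - z))%C.

Lemma cdiff0_const (U : C -> Prop) (f : C -> C) : convex U ->
  (forall z, U z -> cdiff f z 0) -> forall z w, U z -> U w -> f z = f w.
Proof.
move=> cU Hf z w Uz Uw.
have : Cmod (f w - f z)%C <= 0 * Cmod (w - z)%C.
  apply: (@cdiff_le_const f (fun=> 0%C)) => t Ht; first by apply: Hf; exact: cU.
  by rewrite Cmod_0; right.
rewrite Rmult_0_l => h.
have /Cmod_eq_0 e : Cmod (f w - f z)%C = 0 by apply: Rle_antisym => //; exact: Cmod_ge_0.
have -> : f w = ((f w - f z) + f z)%C by ring.
by rewrite e Cplus_0_l.
Qed.

(** * The domain as a union of half-planes *)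

Lemma domainU_half (a tmin tmax : R) (z : C) :
  domainU a tmin tmax z <-> exists tau, tmin < tau < tmax /\ half_plane a tau z.
Proof.
split=> [[tau [d [[Ht Hd] Hz]]]|[tau [Ht Hz]]].
  by exists tau; split=> //; rewrite /half_plane; move: Hz; rewrite /on_line => ->.
by exists tau, (Im (cis (- tau) * z)%C).
Qed.

Lemma half_domainU (a tmin tmax tau : R) (z : C) : tmin < tau < tmax ->
  half_plane a tau z -> domainU a tmin tmax z.
Proof. by move=> Ht Hz; apply/domainU_half; exists tau. Qed.

Lemma domainU_le (a b tmin tmax : R) (z : C) : a <= b ->
  domainU b tmin tmax z -> domainU a tmin tmax z.
Proof.
move=> ab /domainU_half [tau [Ht Hz]]; apply/domainU_half; exists tau; split=> //.
exact: half_plane_le Hz.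
Qed.

(** A point far out at argument [(lo + hi) / 2 + PI / 2] works: its height over the direction [tau]
    is [rho * cos (tau - (lo + hi) / 2)], and over a spread of less than [PI] this cosine is at
    least [k > 0]. *)
Lemma half_planes_meet (b lo hi : R) : lo <= hi -> hi - lo < PI ->
  exists q, forall tau, lo <= tau <= hi -> half_plane b tau q.
Proof.
move=> lh w.
pose k := cos ((hi - lo) / 2).
have k0 : 0 < k by apply: cos_gt_0; lra.
pose rho := (Rabs b + 1) / k.
have r0 : 0 < rho by apply: Rdiv_lt_0_compat => //; have := Rabs_pos b; lra.
exists (rho * cis ((lo + hi) / 2 + PI / 2))%C => tau Ht; rewrite /half_plane.
have -> : (cis (- tau) * (rho * cis ((lo + hi) / 2 + PI / 2)) =
  rho * cis (PI / 2 - (tau - (lo + hi) / 2)))%C.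
  have -> : PI / 2 - (tau - (lo + hi) / 2) = - tau + ((lo + hi) / 2 + PI / 2) by field.
  by rewrite (cis_add (- tau)); ring.
have -> : Im (rho * cis (PI / 2 - (tau - (lo + hi) / 2)))%C =
  rho * cos (tau - (lo + hi) / 2).
  by rewrite -sin_shift /cis /Im /=; ring.
have kc : k <= cos (tau - (lo + hi) / 2).
  have lt_pi := PI_RGT_0.
  case: (Rle_dec 0 (tau - (lo + hi) / 2)) => h.
    by apply: cos_decr_1; lra.
  by rewrite -(cos_neg (tau - _)); apply: cos_decr_1; lra.
have : rho * k = Rabs b + 1 by rewrite /rho; field; lra.
have := Rle_abs b; have := Rmult_le_compat_l _ _ _ (Rlt_le _ _ r0) kc; lra.
Qed.

(** Three directions taken in an open interval of width at most [PI] span strictly less than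
    [PI]. *)
Lemma half_planes_meet3 (b tmin tmax t1 t2 t3 : R) : tmax - tmin <= PI ->
  tmin < t1 < tmax -> tmin < t2 < tmax -> tmin < t3 < tmax ->
  exists q, half_plane b t1 q /\ half_plane b t2 q /\ half_plane b t3 q.
Proof.
move=> w h1 h2 h3.
pose lo := Rmin t1 (Rmin t2 t3); pose hi := Rmax t1 (Rmax t2 t3).
have := Rmin_l t1 (Rmin t2 t3); have := Rmin_r t1 (Rmin t2 t3).
have := Rmax_l t1 (Rmax t2 t3); have := Rmax_r t1 (Rmax t2 t3).
have := Rmin_l t2 t3; have := Rmin_r t2 t3.
have := Rmax_l t2 t3; have := Rmax_r t2 t3.
have : tmin < lo by repeat apply: Rmin_glb_lt; lra.
have : hi < tmax by repeat apply: Rmax_lub_lt; lra.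
rewrite -/lo -/hi => *.
have [q Hq] : exists q, forall tau, lo <= tau <= hi -> half_plane b tau q.
  by apply: half_planes_meet; lra.
by exists q; split; [|split]; apply: Hq; lra.
Qed.

(* Any three of the half-planes meet: this is what makes the local solutions
   consistent, and it fails for widths above [PI]. *)
Lemma glue (T : Type) (a tmin tmax : R) (adm : T -> Prop) (sol : R -> (C -> T) -> Prop) :
  tmax - tmin <= PI ->
  (forall tau f z, tmin < tau < tmax -> sol tau f -> half_plane a tau z -> adm (f z)) ->
  (forall tau q v, tmin < tau < tmax -> half_plane a tau q -> adm v ->
     exists f, sol tau f /\ f q = v) ->
  (forall tau tau' f g q z, tmin < tau < tmax -> tmin < tau' < tmax ->
     sol tau f -> sol tau' g ->
     half_plane a tau q -> half_plane a tau' q -> f q = g q ->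
     half_plane a tau z -> half_plane a tau' z -> f z = g z) ->
  forall tau0 q0 v, tmin < tau0 < tmax -> half_plane a tau0 q0 -> adm v ->
  exists f, f q0 = v /\ forall tau, tmin < tau < tmax ->
    exists g, sol tau g /\ forall z, half_plane a tau z -> f z = g z.
Proof.
move=> w Hadm Hex Huniq tau0 q0 v Ht0 Hq0 Hv.
have [f0 [Sf0 f0q]] := Hex tau0 q0 v Ht0 Hq0 Hv.
have Hg tau : tmin < tau < tmax -> exists g, sol tau g /\
    forall z, half_plane a tau z -> half_plane a tau0 z -> g z = f0 z.
  move=> Ht; have [q [h1 [h2 _]]] := half_planes_meet3 a w Ht Ht0 Ht0.
  have [g [Sg gq]] := Hex tau q (f0 q) Ht h1 (Hadm _ _ _ Ht0 Sf0 h2).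
  by exists g; split=> // z hz hz0; apply: (Huniq tau tau0 g f0 q).
pose G tau := epsilon (inhabits (fun _ : C => v)) (fun g => sol tau g /\
    forall z, half_plane a tau z -> half_plane a tau0 z -> g z = f0 z).
have GP tau : tmin < tau < tmax -> sol tau (G tau) /\
    forall z, half_plane a tau z -> half_plane a tau0 z -> G tau z = f0 z.
  by move=> Ht; exact: (epsilon_spec _ _ (Hg tau Ht)).
have GG tau tau' z : tmin < tau < tmax -> tmin < tau' < tmax ->
    half_plane a tau z -> half_plane a tau' z -> G tau z = G tau' z.
  move=> Ht Ht' hz hz'.
  (* At a point common to all three half-planes both local solutions equal [f0], so uniqueness
     identifies them wherever their two half-planes overlap. *)
  have [q [h1 [h2 h3]]] := half_planes_meet3 a w Ht Ht' Ht0.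
  have [S1 E1] := GP _ Ht; have [S2 E2] := GP _ Ht'.
  by apply: (Huniq tau tau' _ _ q) => //; rewrite E1 // E2.
(* Each point takes its value from some chosen half-plane that contains it; by [GG] the choice is
   immaterial. *)
pose tz z := epsilon (inhabits 0) (fun tau => tmin < tau < tmax /\ half_plane a tau z).
have tzP tau z : tmin < tau < tmax -> half_plane a tau z ->
    tmin < tz z < tmax /\ half_plane a (tz z) z.
  by move=> Ht hz; apply: (epsilon_spec (inhabits 0)
    (fun tau => tmin < tau < tmax /\ half_plane a tau z)); exists tau.
exists (fun z => G (tz z) z); split.
  have [h1 h2] := tzP _ _ Ht0 Hq0.
  by rewrite (proj2 (GP _ h1)).
move=> tau Ht; exists (G tau); split; first exact: (proj1 (GP _ Ht)).
by move=> z hz; have [h1 h2] := tzP _ _ Ht hz; apply: GG.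
Qed.

Lemma cdiff_half_ext (a tau : R) (f g : C -> C) (z l : C) :
  half_plane a tau z -> (forall w, half_plane a tau w -> f w = g w) ->
  cdiff g z l -> cdiff f z l.
Proof.
move=> Hz e; have [r [r0 Hr]] := half_plane_open Hz.
by apply: (cdiff_ext_loc r0) => h Hh; rewrite e //; exact: Hr.
Qed.

Lemma half_plane_convex2 (a tau tau' : R) :
  convex (fun z => half_plane a tau z /\ half_plane a tau' z).
Proof.
by move=> z w t [h1 h2] [h3 h4] Ht; split; apply: half_plane_convex.
Qed.

(** Prescribing the value at one point fixes a primitive on a half-plane; this is the local problem
    that [glue] extends, with every value admissible. *)
Lemma domain_primitive (a tmin tmax : R) (f : C -> C) :
  tmin < tmax -> tmax - tmin <= PI -> holo_on (domainU a tmin tmax) f ->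
  exists F, forall z, domainU a tmin tmax z -> cdiff F z (f z).
Proof.
move=> lt w Hf.
pose t0 := (tmin + tmax) / 2.
have Ht0 : tmin < t0 < tmax by rewrite /t0; lra.
have [q0 [Hq0 _]] := half_planes_meet3 a w Ht0 Ht0 Ht0.
have [|||F [_ HF]] := @glue C a tmin tmax (fun=> True)
  (fun tau F => forall z, half_plane a tau z -> cdiff F z (f z)) w _ _ _ t0 q0 0%C Ht0 Hq0 I.
- by [].
- move=> tau q v Ht Hq _.
  have [|F HF] := @half_primitive a tau f.
    by move=> z Hz; apply: Hf; exact: half_domainU Hz.
  exists (fun z => F z + (v - F q))%C; split; last by ring.
  move=> z Hz; apply: cdiff_val (cdiff_plus (HF z Hz) (cdiff_const _ _)); ring.
- move=> tau tau' F G q z Ht Ht' SF SG h1 h2 e h3 h4.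
  have : (F z - G z = F q - G q)%C.
    apply: (@cdiff0_const _ (fun z => F z - G z)%C (@half_plane_convex2 a tau tau')) => //.
    move=> x [Hx Hx']; apply: cdiff_val (cdiff_minus (SF x Hx) (SG x Hx')); ring.
  rewrite e => E; have -> : F z = ((F z - G z) + G z)%C by ring.
  by rewrite E; ring.
exists F => z /domainU_half [tau [Ht Hz]].
have [G [SG e]] := HF tau Ht.
exact: cdiff_half_ext Hz e (SG z Hz).
Qed.

Lemma segment_int_ftc (f F : C -> C) (z w : C) :
  (forall t, unit_interval t -> cdiff F (segment_pt z w t) (f (segment_pt z w t))) ->
  (forall t, unit_interval t -> exists l, cdiff f (segment_pt z w t) l) ->
  segment_int f z w = (F w - F z)%C.
Proof.
move=> HF Hf.
pose df x := epsilon (inhabits (0 : C)) (cdiff f x).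
have e t : segment_pt z w t = (z + t * (w - z))%C by rewrite /segment_pt; ring.
have := @lint_ftc f F df z (w - z)%C 0 1.
rewrite Rmin_left ?Rmax_right; try lra.
have -> : (z + 1 * (w - z) = w)%C by ring.
have -> : (z + 0 * (w - z) = z)%C by ring.
move=> I; apply: (is_RInt_unique (V := C_R_CompleteNormedModule)).
apply: (is_RInt_ext (fun t => f (z + t * (w - z)) * (w - z))%C).
  by move=> t _; rewrite e.
apply: I => t Ht; rewrite -e; first exact: HF.
by apply: (epsilon_spec (inhabits (0 : C)) (cdiff f _)); exact: Hf.
Qed.

Lemma polygon_int_ftc (U : C -> Prop) (f F : C -> C) (z : C) (p : seq C) :
  holo_on U f -> (forall z, U z -> cdiff F z (f z)) ->
  polygon_in U z p -> polygon_int f z p = (F (last z p) - F z)%C.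
Proof.
move=> Hf HF; elim: p z => [|w p IH] z /=; first by move=> _; ring.
move=> [Hs Hp]; rewrite (IH _ Hp) (segment_int_ftc (F := F)); first by ring.
  by move=> t Ht; apply: HF; exact: Hs.
by move=> t Ht; apply: Hf; exact: Hs.
Qed.

(** * Lines *)

Lemma on_line_half (a tau d : R) (z : C) : a < d -> on_line tau d z -> half_plane a tau z.
Proof. by rewrite /on_line /half_plane => ? ->. Qed.

Lemma line_move (tau : R) (z : C) (s : R) :
  Im (cis (- tau) * (z + s * cis tau))%C = Im (cis (- tau) * z)%C.
Proof.
have -> : (cis (- tau) * (z + s * cis tau) = cis (- tau) * z + s * (cis (- tau) * cis tau))%C.
  by ring.
by rewrite cis_opp_l /Im /=; ring.
Qed.

Lemma line_ptE (tau d s : R) : line_pt tau d s = (line_pt tau d 0 + s * cis tau)%C.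
Proof.
rewrite /line_pt; have -> : (s, d) = ((0, d) + s)%C by
  apply: injective_projections => /=; ring.
by ring.
Qed.

Lemma on_line_pt (tau d s : R) : on_line tau d (line_pt tau d s).
Proof. by rewrite /on_line /line_pt Cmult_assoc cis_opp_l Cmult_1_l. Qed.

Lemma line_pt_of (tau : R) (z : C) :
  z = line_pt tau (Im (cis (- tau) * z)%C) (Re (cis (- tau) * z)%C).
Proof.
rewrite /line_pt -surjective_pairing Cmult_assoc [(cis tau * _)%C]Cmult_comm.
by rewrite cis_opp_l Cmult_1_l.
Qed.

Lemma line_pt_move (tau d s s' : R) :
  (line_pt tau d s + s' * cis tau)%C = line_pt tau d (s + s').
Proof. by rewrite (line_ptE tau d (s + s')) (line_ptE tau d s) RtoC_plus; ring. Qed.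

(** * Geometrically convergent series *)

(** Defined through geometric convergence, the only mode that occurs, so that identifying a sum and
    bounding its tails are the same estimate. *)
Definition gsum (a : nat -> C) : C := epsilon (inhabits (0 : C)) (fun l =>
  exists W, forall N, Cmod (l - \sum_(k < N) a k)%R <= W / 2 ^ N).

Lemma div_pow2_S (V : R) (k : nat) : V / 2 ^ S k = V / 2 ^ k / 2.
Proof. by rewrite /=; field; apply: pow_nonzero; lra. Qed.

Lemma Cmod_small0 (z : C) (W : R) : (forall N, Cmod z <= W / 2 ^ N) -> z = 0.
Proof.
move=> H; apply: Cmod_eq_0; apply: Rle_antisym; last exact: Cmod_ge_0.
apply: Rnot_gt_le => h.
by have [k Hk] := pow2_small W h; have := H k; lra.
Qed.

Lemma gsum_unique (a : nat -> C) (l : C) (W : R) :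
  (forall N, Cmod (l - \sum_(k < N) a k)%R <= W / 2 ^ N) -> gsum a = l.
Proof.
move=> H.
have [W' H'] : exists W, forall N, Cmod (gsum a - \sum_(k < N) a k)%R <= W / 2 ^ N.
  by apply: (epsilon_spec (inhabits (0 : C)) (fun l =>
    exists W, forall N, Cmod (l - \sum_(k < N) a k)%R <= W / 2 ^ N)); exists l, W.
have : (gsum a - l = 0)%C.
  apply: (@Cmod_small0 _ (W' + W)) => N.
  have -> : (gsum a - l = (gsum a - (\sum_(k < N) a k)%R) + - (l - (\sum_(k < N) a k)%R))%C.
    by ring.
  apply: Rle_trans (Cmod_triangle _ _) _; rewrite Cmod_opp Rdiv_plus_distr.
  exact: (Rplus_le_compat _ _ _ _ (H' N) (H N)).
by move=> e; have -> : gsum a = ((gsum a - l) + l)%C by [ring]; rewrite e Cplus_0_l.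
Qed.

(** The terms from index [k] on add up to at most [2 * V / 2 ^ k], so the intervals of that radius
    about the partial sums are nested. *)
Lemma real_series (a : nat -> R) (V : R) : (forall k, Rabs (a k) <= V / 2 ^ k) ->
  exists l, forall N, Rabs (l - \sum_(k < N) a k)%R <= 2 * V / 2 ^ N.
Proof.
move=> H.
have V0 : 0 <= V by have := H 0%nat; have := Rabs_pos (a 0%nat); rewrite /= Rdiv_1_r; lra.
pose s N : R := (\sum_(k < N) a k)%R.
have sS N : s (S N) = s N + a N by rewrite /s big_ord_recr.
have [X HX] : exists X, forall k, s k - 2 * V / 2 ^ k <= X <=
    (s k - 2 * V / 2 ^ k) + (4 * V) / 2 ^ k.
  apply: (@nested_lim (fun k => s k - 2 * V / 2 ^ k)) => [k|]; last lra.
  rewrite sS !div_pow2_S; have /Rabs_le_between := H k.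
  by rewrite /Rdiv; lra.
exists X => N; apply: Rabs_le; have := HX N.
by rewrite -/(s N) -[(X - s N)%R]/(X - s N) /Rdiv; lra.
Qed.

Lemma Re_sum (a : nat -> C) N : Re (\sum_(k < N) a k)%R = (\sum_(k < N) Re (a k))%R.
Proof. by elim: N => [|N IH]; rewrite ?big_ord0 ?big_ord_recr // -IH. Qed.

Lemma Im_sum (a : nat -> C) N : Im (\sum_(k < N) a k)%R = (\sum_(k < N) Im (a k))%R.
Proof. by elim: N => [|N IH]; rewrite ?big_ord0 ?big_ord_recr // -IH. Qed.

Lemma gsumP (a : nat -> C) (V : R) : (forall k, Cmod (a k) <= V / 2 ^ k) ->
  forall N, Cmod (gsum a - \sum_(k < N) a k)%R <= 4 * V / 2 ^ N.
Proof.
move=> H.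
have [x Hx] := real_series (fun k => Rle_trans _ _ _ (re_le_Cmod (a k)) (H k)).
have [y Hy] := real_series (fun k => Rle_trans _ _ _ (im_le_Cmod (a k)) (H k)).
have K N : Cmod ((x, y) - \sum_(k < N) a k)%R <= 4 * V / 2 ^ N.
  apply: Rle_trans (Cmod_le_abs _) _.
  have := Hx N; have := Hy N; rewrite -Re_sum -Im_sum.
  have -> : 4 * V / 2 ^ N = 2 * V / 2 ^ N + 2 * V / 2 ^ N by rewrite /Rdiv; ring.
  move=> h1 h2; exact: (Rplus_le_compat _ _ _ _ h2 h1).
by rewrite (gsum_unique K).
Qed.

(** By the mean value inequality the increment of the [k]-th term is at most [V / 2 ^ k * Cmod h].
    The tails therefore change by a small multiple of [Cmod h], uniformly in [h], and only a finite
    sum is left to differentiate. *)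
Lemma termwise_cdiff (f g : nat -> C -> C) (F : C -> C) (z l : C) (r V W : R) : 0 < r ->
  (forall k h, Cmod h < r -> cdiff (f k) (z + h)%C (g k (z + h)%C)) ->
  (forall k h, Cmod h < r -> Cmod (g k (z + h)%C) <= V / 2 ^ k) ->
  (forall h, Cmod h < r -> forall N,
     Cmod (F (z + h)%C - \sum_(k < N) f k (z + h)%C)%R <= W / 2 ^ N) ->
  (forall N, Cmod (l - \sum_(k < N) g k z)%R <= W / 2 ^ N) ->
  cdiff F z l.
Proof.
move=> r0 Hd Hg HF Hl eps He.
pose S N w : C := (\sum_(k < N) f k w)%R.
pose D N : C := (\sum_(k < N) g k z)%R.
have SS N w : S N.+1 w = (S N w + f N w)%C by rewrite /S big_ord_recr.
have ez : (z + 0 = z)%C by ring.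
have r0' : Cmod 0 < r by rewrite Cmod_0.
have V0 : 0 <= V.
  have := Hg 0%nat 0%C r0'; rewrite /= Rdiv_1_r; have := Cmod_ge_0 (g 0%nat (z + 0)%C); lra.
have inc k h : Cmod h < r -> Cmod (f k (z + h) - f k z)%C <= V / 2 ^ k * Cmod h.
  move=> hr; have e : (z + h - z = h)%C by ring.
  have h0 := Cmod_ge_0 h.
  have small t : 0 <= t <= 1 -> Cmod (t * h)%C < r.
    by move=> Ht; rewrite Cmod_mult Cmod_R Rabs_pos_eq; nra.
  have := @cdiff_le_const (f k) (g k) z (z + h)%C (V / 2 ^ k).
  rewrite e; apply => t Ht; [apply: Hd | apply: Hg]; exact: small.
have tail N j h : Cmod h < r ->
    Cmod ((S (N + j)%N (z + h) - S N (z + h)) - (S (N + j)%N z - S N z))%C <=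
    2 * V * (/ 2 ^ N - / 2 ^ (N + j)%N) * Cmod h.
  move=> hr; elim: j => [|j IH].
    rewrite addn0; right.
    have -> : ((S N (z + h) - S N (z + h)) - (S N z - S N z) = 0)%C by ring.
    by rewrite Cmod_0; ring.
  rewrite addnS !SS.
  have -> : (S (N + j)%N (z + h) + f (N + j)%N (z + h) - S N (z + h) -
     (S (N + j)%N z + f (N + j)%N z - S N z) =
     ((S (N + j)%N (z + h) - S N (z + h)) - (S (N + j)%N z - S N z)) +
     (f (N + j)%N (z + h) - f (N + j)%N z))%C by ring.
  apply: Rle_trans (Cmod_triangle _ _) _.
  apply: Rle_trans (Rplus_le_compat _ _ _ _ IH (inc _ _ hr)) _.
  right; rewrite /=; field; split; apply: pow_nonzero; lra.
have FS N h : Cmod h < r ->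
    Cmod ((F (z + h) - S N (z + h)) - (F z - S N z))%C <= 2 * V / 2 ^ N * Cmod h.
  move=> hr; apply: Rnot_gt_le => bad.
  (* Passage to the limit in [tail]: at index [N + k] the partial sums are so close to [F] at both
     points that the two errors together stay below the supposed excess. *)
  have [k Hk] := pow2_small (2 * W) (proj2 (Rlt_0_minus _ _) bad).
  have q1 := HF h hr (N + k)%N; have := HF 0%C r0' (N + k)%N; rewrite ez => q2.
  have q3 := tail N k h hr.
  have h0 := Cmod_ge_0 h.
  have W0 : 0 <= W.
    by have := Rle_trans _ _ _ (Cmod_ge_0 _) (Hl 0%nat); rewrite /= Rdiv_1_r.
  have pk : 0 < / 2 ^ (N + k)%N by apply: Rinv_0_lt_compat; apply: pow_lt; lra.
  have pk2 : W / 2 ^ (N + k)%N <= W / 2 ^ k.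
    apply: Rmult_le_compat_l => //; apply: Rinv_le_contravar; first by apply: pow_lt; lra.
    apply: Rle_pow; first lra.
    by apply/leP; exact: leq_addl.
  move: bad Hk.
  have -> : ((F (z + h) - S N (z + h)) - (F z - S N z) =
    (F (z + h) - S (N + k)%N (z + h)) + - (F z - S (N + k)%N z) +
    ((S (N + k)%N (z + h) - S N (z + h)) - (S (N + k)%N z - S N z)))%C by ring.
  set A := (_ + _ + _)%C => bad Hk.
  have : Cmod A <= W / 2 ^ (N + k)%N + W / 2 ^ (N + k)%N +
      2 * V * (/ 2 ^ N - / 2 ^ (N + k)%N) * Cmod h.
    apply: Rle_trans (Cmod_triangle _ _) _; apply: Rplus_le_compat => //.
    apply: Rle_trans (Cmod_triangle _ _) _; rewrite Cmod_opp.
    exact: (Rplus_le_compat _ _ _ _ q1 q2).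
  have : 0 <= V * / 2 ^ (N + k)%N * Cmod h.
    by apply: Rmult_le_pos => //; apply: Rmult_le_pos => //; lra.
  move: Hk pk2; rewrite /Rdiv; lra.
have [N HN] := pow2_small (2 * V + W) (d := eps / 2) ltac:(lra).
have dS : cdiff (S N) z (D N).
  by apply: cdiff_sum => k; have := Hd k 0%C r0'; rewrite ez.
have [d [dp Hd']] := dS _ (ltac:(lra) : 0 < eps / 2).
exists (Rmin d r); split; first exact: Rmin_pos.
move=> h hr.
have {}hd := Rlt_le_trans _ _ _ hr (Rmin_l _ _).
have {}hr := Rlt_le_trans _ _ _ hr (Rmin_r _ _).
have h0 := Cmod_ge_0 h.
have -> : (F (z + h) - F z - l * h =
  ((F (z + h) - S N (z + h)) - (F z - S N z)) + (S N (z + h) - S N z - D N * h)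
  + - ((l - D N) * h))%C by ring.
apply: Rle_trans (Cmod_triangle _ _) _.
apply: Rle_trans (Rplus_le_compat_r _ _ _ (Cmod_triangle _ _)) _.
rewrite Cmod_opp Cmod_mult.
have t1 := FS N h hr; have t2 := Hd' h hd.
have t3 : Cmod (l - D N)%C * Cmod h <= W / 2 ^ N * Cmod h.
  by apply: Rmult_le_compat_r => //; exact: Hl.
have t4 : (2 * V + W) / 2 ^ N * Cmod h <= eps / 2 * Cmod h.
  by apply: Rmult_le_compat_r => //; lra.
move: t1 t3 t4; rewrite /Rdiv; lra.
Qed.

(** * Finite sums *)

Lemma Rsum_ge0 n (f : 'I_n -> R) : (forall i, 0 <= f i) -> 0 <= (\sum_(i < n) f i)%R.
Proof.
elim: n f => [|n IH] f H; first by rewrite big_ord0; right.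
rewrite big_ord_recl; apply: Rplus_le_le_0_compat => //.
by apply: IH => i; exact: H.
Qed.

Lemma Rsum_le n (f g : 'I_n -> R) : (forall i, f i <= g i) ->
  (\sum_(i < n) f i)%R <= (\sum_(i < n) g i)%R.
Proof.
elim: n f g => [|n IH] f g H; first by rewrite !big_ord0; right.
by rewrite !big_ord_recl; apply: Rplus_le_compat => //; apply: IH => i; exact: H.
Qed.

Lemma Rsum_const n (c : R) : (\sum_(i < n) c)%R = INR n * c.
Proof.
elim: n => [|n IH]; first by rewrite big_ord0 /= Rmult_0_l.
by rewrite big_ord_recl IH S_INR; change (c + INR n * c = (INR n + 1) * c); ring.
Qed.

Lemma Rsum_term n (f : 'I_n -> R) (i : 'I_n) : (forall i, 0 <= f i) ->
  f i <= (\sum_(i < n) f i)%R.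
Proof.
elim: n f i => [|n IH] f i H; first by case: i.
rewrite big_ord_recl.
have s0 : 0 <= (\sum_(j < n) f (lift ord0 j))%R by apply: Rsum_ge0.
have K j : f (lift ord0 j) <= (\sum_(j < n) f (lift ord0 j))%R.
  exact: (IH (fun j => f (lift ord0 j))).
set s := (\sum_(j < n) f (lift ord0 j))%R in s0 K *.
change (f i <= f ord0 + s); have f0 := H ord0.
by case: (unliftP ord0 i) => [j ->|->]; [have := K j|]; lra.
Qed.

Lemma Cmod_sum_le n (f : 'I_n -> C) (K : R) : (forall i, Cmod (f i) <= K) ->
  Cmod (\sum_(i < n) f i)%R <= INR n * K.
Proof.
move=> H; rewrite -Rsum_const; apply: Rle_trans (Cmod_sum _) _; exact: Rsum_le.
Qed.

(** * Linear differential equations *)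

Definition mdiff n (X : C -> 'M[C]_n) (z : C) (L : 'M[C]_n) : Prop :=
  forall i j, cdiff (fun w => X w i j) z (L i j).

Lemma mdiff_mulmx n (X Y : C -> 'M[C]_n) (z : C) (K L : 'M[C]_n) :
  mdiff X z K -> mdiff Y z L ->
  mdiff (fun w => X w *m Y w)%R z (K *m Y z + X z *m L)%R.
Proof.
move=> HX HY i j.
apply: (cdiff_ext (f := fun w => \sum_(l < n) (X w i l * Y w l j))%R).
  by move=> w; rewrite mxE.
rewrite !mxE -big_split /=.
by apply: cdiff_sum => l; apply: cdiff_mult; [exact: HX | exact: HY].
Qed.

Lemma mdiff_const n (A : 'M[C]_n) (z : C) : mdiff (fun=> A) z 0%R.
Proof. by move=> i j; rewrite mxE; exact: cdiff_const. Qed.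

Lemma mdiff_val n (X : C -> 'M[C]_n) (z : C) (K L : 'M[C]_n) : K = L ->
  mdiff X z K -> mdiff X z L.
Proof. by move=> ->. Qed.

Lemma mdiff_ext_loc n (X Y : C -> 'M[C]_n) (z : C) (K : 'M[C]_n) (r : R) : 0 < r ->
  (forall h, Cmod h < r -> X (z + h)%C = Y (z + h)%C) -> mdiff X z K -> mdiff Y z K.
Proof. by move=> r0 e H i j; apply: (cdiff_ext_loc r0) (H i j) => h hr; rewrite e. Qed.

Lemma mdiff0_const n (U : C -> Prop) (X : C -> 'M[C]_n) : convex U ->
  (forall z, U z -> mdiff X z 0%R) -> forall z w, U z -> U w -> X z = X w.
Proof.
move=> cU H z w Uz Uw; apply/matrixP => i j.
apply: (@cdiff0_const U (fun w => X w i j)) => // x Ux.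
by have := H x Ux i j; rewrite mxE.
Qed.

Definition mholo n (U : C -> Prop) (X : C -> 'M[C]_n) : Prop :=
  forall z, U z -> exists L, mdiff X z L.

Lemma mholo_mulmx n (U : C -> Prop) (X Y : C -> 'M[C]_n) :
  mholo U X -> mholo U Y -> mholo U (fun w => X w *m Y w)%R.
Proof.
move=> HX HY z Uz; have [K HK] := HX z Uz; have [L HL] := HY z Uz.
by exists (K *m Y z + X z *m L)%R; exact: mdiff_mulmx.
Qed.

Lemma mholo_entries n (U : C -> Prop) (X : C -> 'M[C]_n) :
  (forall i j, holo_on U (fun w => X w i j)) <-> mholo U X.
Proof.
split=> [H z Uz|H i j z Uz].
  exists (\matrix_(i, j) epsilon (inhabits (0 : C)) (cdiff (fun w => X w i j) z))%R => i j.
  by rewrite mxE; apply: (epsilon_spec (inhabits (0 : C)) (cdiff _ z)); exact: H.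
by have [L HL] := H z Uz; exists (L i j); exact: HL.
Qed.

Lemma mulmx_bound n (A B : 'M[C]_n) (K L : R) (i j : 'I_n) :
  (forall i j, Cmod (A i j) <= K) -> (forall i j, Cmod (B i j) <= L) ->
  Cmod ((A *m B)%R i j) <= INR n * (K * L).
Proof.
move=> HA HB; rewrite mxE; apply: Cmod_sum_le => l.
by rewrite Cmod_mult; apply: Rmult_le_compat => //; exact: Cmod_ge_0.
Qed.

(** Differentiating the series termwise shifts the index by one, which gives [B] times the series
    itself. The iterates are left abstract, since they come both from a point, in [picard], and from
    infinity, in [far_iter]. *)
Lemma neumann_series n (B X : C -> 'M[C]_n) (Phi : nat -> C -> 'M[C]_n) (z : C)
    (r V W M : R) : 0 < r ->
  (forall h, Cmod h < r -> forall i j, Cmod (B (z + h)%C i j) <= M) ->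
  (forall k h, Cmod h < r -> forall i j, Cmod (Phi k (z + h)%C i j) <= V / 2 ^ k) ->
  (forall h, Cmod h < r -> mdiff (Phi 0%nat) (z + h)%C 0%R) ->
  (forall k h, Cmod h < r -> mdiff (Phi (S k)) (z + h)%C
     (B (z + h)%C *m Phi k (z + h)%C)%R) ->
  (forall h, Cmod h < r -> forall i j N,
     Cmod (X (z + h)%C i j - \sum_(k < N) Phi k (z + h)%C i j)%R <= W / 2 ^ N) ->
  mdiff X z (B z *m X z)%R.
Proof.
move=> r0 HB HPhi H0 HS HX i j.
have ez : (z + 0 = z)%C by ring.
have r0' : Cmod 0 < r by rewrite Cmod_0.
have W0 : 0 <= W.
  by have := Rle_trans _ _ _ (Cmod_ge_0 _) (HX 0%C r0' i j 0%nat); rewrite /= Rdiv_1_r.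
have V0 : 0 <= V.
  by have := Rle_trans _ _ _ (Cmod_ge_0 _) (HPhi 0%nat 0%C r0' i j); rewrite /= Rdiv_1_r.
have M0 : 0 <= M by exact: Rle_trans (Cmod_ge_0 _) (HB 0%C r0' i j).
have n0 := pos_INR n.
pose g k w : C := if k is k'.+1 then (B w *m Phi k' w)%R i j else 0%C.
have nM : 0 <= INR n * M by apply: Rmult_le_pos.
(* The derivative of a term involves the preceding term, whence the factors 2; the summand [W] lets
   one constant serve the function and its derivative. *)
apply: (@termwise_cdiff (fun k w => Phi k w i j) g _ z _ r (2 * (INR n * M * V))
  (2 * (INR n * M * W) + W) r0).
- move=> [|k] h hr /=; first by have := H0 h hr i j; rewrite mxE.
  exact: HS.
- move=> [|k] h hr; rewrite /g.
    rewrite Cmod_0 /= Rdiv_1_r; have := Rmult_le_pos _ _ nM V0; lra.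
  have -> : 2 * (INR n * M * V) / 2 ^ k.+1 = INR n * (M * (V / 2 ^ k)).
    by rewrite div_pow2_S; field; apply: pow_nonzero; lra.
  by apply: mulmx_bound; [exact: HB | exact: HPhi].
- move=> h hr N; apply: Rle_trans (HX h hr i j N) _.
  apply: Rmult_le_compat_r; last by have := Rmult_le_pos _ _ nM W0; lra.
  by apply: Rlt_le; apply: Rinv_0_lt_compat; apply: pow_lt; lra.
- have HXz l N : Cmod (X z l j - \sum_(k < N) Phi k z l j)%R <= W / 2 ^ N.
    by have := HX 0%C r0' l j N; rewrite ez.
  have HBz a b : Cmod (B z a b) <= M by have := HB 0%C r0' a b; rewrite ez.
  have W2 : INR n * (M * W) <= 2 * (INR n * M * W) + W.
    by have := Rmult_le_pos _ _ nM W0; lra.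
  case=> [|N].
    rewrite big_ord0 GRing.subr0 /= Rdiv_1_r; apply: Rle_trans W2.
    rewrite mxE; apply: Cmod_sum_le => l; rewrite Cmod_mult.
    apply: Rmult_le_compat => //; try exact: Cmod_ge_0.
    by have := HXz l 0%nat; rewrite big_ord0 GRing.subr0 /= Rdiv_1_r.
  rewrite big_ord_recl /g /= GRing.add0r.
  have -> : ((B z *m X z) i j - \sum_(k < N) (B z *m Phi k z) i j)%R =
    (\sum_(l < n) B z i l * (X z l j - \sum_(k < N) Phi k z l j))%R.
    rewrite mxE; under [X in (_ - X)%R]eq_bigr => k _ do rewrite mxE.
    rewrite exchange_big -GRing.sumrB /=; apply: eq_bigr => l _.
    by rewrite GRing.mulrBr GRing.mulr_sumr.
  apply: Rle_trans (_ : INR n * (M * (W / 2 ^ N)) <= _).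
    apply: Cmod_sum_le => l; rewrite Cmod_mult.
    by apply: Rmult_le_compat => //; exact: Cmod_ge_0.
  rewrite -[2 * 2 ^ N]/(2 ^ S N) div_pow2_S /Rdiv.
  have p : 0 < / 2 ^ N by apply: Rinv_0_lt_compat; apply: pow_lt; lra.
  have := Rmult_le_pos _ _ W0 (Rlt_le _ _ p); lra.
Qed.

(* The compactness of the segment makes the bound uniform for nearby segments. *)
Lemma tube_bound (g : C -> R) (q z : C) :
  (forall t, 0 <= t <= 1 -> exists d K, 0 < d /\
     forall h, Cmod h < d -> g (q + t * (z - q) + h)%C <= K) ->
  exists r M, 0 < r /\ forall t h, 0 <= t <= 1 -> Cmod h < r ->
    g (q + t * (z + h - q))%C <= M.
Proof.
move=> H; pose L := Cmod (z - q)%C + 1.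
have L1 : 1 <= L by rewrite /L; have := Cmod_ge_0 (z - q)%C; lra.
(* One number serves both as a radius and, inverted, as a bound, so that a single positive lower
   bound from compactness controls both. The factor [2 * L] absorbs the displacement along the
   segment and that of its end. *)
pose P t (d : posreal) := 0 <= t <= 1 -> forall h, Cmod h < 2 * L * d ->
  g (q + t * (z - q) + h)%C <= / d.
have HP t : exists d, P t d.
  case: (classic (0 <= t <= 1)) => Ht; last by exists (mkposreal 1 Rlt_0_1).
  have [d [K [dp HK]]] := H t Ht.
  have K1 : 0 < Rabs K + 1 by have := Rabs_pos K; lra.
  have e0 : 0 < Rmin (d / (2 * L)) (/ (Rabs K + 1)).
    apply: Rmin_pos; last exact: Rinv_0_lt_compat.
    by apply: Rdiv_lt_0_compat; lra.
  exists (mkposreal _ e0) => _ h /= hh.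
  apply: Rle_trans (HK h _) _.
    apply: Rlt_le_trans hh _.
    have -> : d = 2 * L * (d / (2 * L)) by field; lra.
    by apply: Rmult_le_compat_l; [lra|]; have -> : 2 * L * (d / (2 * L)) / (2 * L) =
      d / (2 * L) by [field; lra]; exact: Rmin_l.
  apply: Rle_trans (Rle_abs _) _; apply: Rle_trans (_ : Rabs K + 1 <= _); first lra.
  rewrite -[X in X <= _]Rinv_inv; apply: Rinv_le_contravar => //; exact: Rmin_r.
pose delta t := epsilon (inhabits (mkposreal 1 Rlt_0_1)) (P t).
have dP t : P t (delta t) by exact: (epsilon_spec _ _ (HP t)).
have [d Hd] := compactness_value_1d 0 1 delta.
exists d, (/ d); split; first exact: cond_pos.
move=> t h Ht hh; apply: Rnot_gt_le => bad.
apply: (Hd t Ht) => -[s [Hs [ts ds]]].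
have h0 := Cmod_ge_0 h.
have e : (q + t * (z + h - q) = q + s * (z - q) + ((t - s) * (z - q) + t * h))%C by ring.
have : g (q + t * (z + h - q))%C <= / (delta s).
  rewrite e; apply: (dP s Hs).
  apply: Rle_lt_trans (Cmod_triangle _ _) _.
  rewrite !Cmod_mult -RtoC_minus !Cmod_R.
  have : Rabs (t - s) * Cmod (z - q)%C <= delta s * Cmod (z - q)%C.
    by apply: Rmult_le_compat_r; [exact: Cmod_ge_0 | lra].
  have : Rabs t * Cmod h <= 1 * Cmod h.
    by apply: Rmult_le_compat_r => //; rewrite Rabs_pos_eq; lra.
  have := Rmult_le_compat_r (delta s) _ _ (Rlt_le _ _ (cond_pos _)) L1.
  rewrite /L; have := cond_pos (delta s); lra.
have : / delta s <= / d by apply: Rinv_le_contravar => //; exact: cond_pos.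
lra.
Qed.

Lemma entry_le_mxnorm n (A : 'M[C]_n) (i j : 'I_n) : Cmod (A i j) <= mxnorm A.
Proof.
apply: Rle_trans (Rsum_term (f := fun i => (\sum_(j < n) Cmod (A i j))%R) i _).
  by apply: (Rsum_term (f := fun j => Cmod (A i j))) => l; exact: Cmod_ge_0.
by move=> a; apply: Rsum_ge0 => b; exact: Cmod_ge_0.
Qed.

Lemma Csub_add (x y : C) : x = ((x - y) + y)%C.
Proof. ring. Qed.

Lemma mholo_bound n (U : C -> Prop) (B : C -> 'M[C]_n) (z : C) : mholo U B -> U z ->
  exists d K, 0 < d /\ forall h, Cmod h < d -> forall i j, Cmod (B (z + h)%C i j) <= K.
Proof.
move=> HB Uz; have [L HL] := HB z Uz.
have near : exists d, 0 < d /\ forall h, Cmod h < d ->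
    forall i j, Cmod (B (z + h)%C i j - B z i j)%C <= 1.
  have Hij i j : exists d, 0 < d /\ forall h, Cmod h < d ->
      Cmod (B (z + h)%C i j - B z i j)%C <= 1.
    have [K [d [Kp [dp HK]]]] := cdiff_near (HL i j).
    exists (Rmin d (/ K)); split; first by apply: Rmin_pos => //; exact: Rinv_0_lt_compat.
    move=> h hh; apply: Rle_trans (HK h _) _; first exact: Rlt_le_trans hh (Rmin_l _ _).
    have : Cmod h < / K by exact: Rlt_le_trans hh (Rmin_r _ _).
    move/(Rmult_lt_compat_l _ _ _ Kp); rewrite Rinv_r; lra.
  have fin m (Q : 'I_m -> C -> Prop) : (forall i, exists d, 0 < d /\ forall h, Cmod h < d -> Q i h) ->
      exists d, 0 < d /\ forall h, Cmod h < d -> forall i, Q i h.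
    elim: m Q => [|m IH] Q HQ; first by exists 1; split; [lra | move=> h _ []].
    have [d1 [p1 h1]] := HQ ord0.
    have [d2 [p2 h2]] := IH (fun i => Q (lift ord0 i)) (fun i => HQ _).
    exists (Rmin d1 d2); split; first exact: Rmin_pos.
    move=> h hh i; case: (unliftP ord0 i) => [j ->|->].
      by apply: h2; exact: Rlt_le_trans hh (Rmin_r _ _).
    by apply: h1; exact: Rlt_le_trans hh (Rmin_l _ _).
  exact: (fin n (fun i h => forall j, Cmod (B (z + h)%C i j - B z i j)%C <= 1)
    (fun i => fin n (fun j h => Cmod (B (z + h)%C i j - B z i j)%C <= 1) (Hij i))).
have [d [dp Hd]] := near.
exists d, (mxnorm (B z) + 1); split=> // h hh i j.
rewrite (Csub_add (B (z + h)%C i j) (B z i j)).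
apply: Rle_trans (Cmod_triangle _ _) _.
have := Hd h hh i j.
have := entry_le_mxnorm (B z) i j; lra.
Qed.

Definition prim (U : C -> Prop) (f : C -> C) : C -> C :=
  epsilon (inhabits ((fun=> RtoC 0) : C -> C)) (fun F : C -> C => forall z, U z -> cdiff F z (f z)).

Lemma primP (U : C -> Prop) (f : C -> C) :
  (exists F, forall z, U z -> cdiff F z (f z)) ->
  forall z, U z -> cdiff (prim U f) z (f z).
Proof.
move=> H.
exact: (epsilon_spec (inhabits ((fun=> RtoC 0) : C -> C))
  (fun F : C -> C => forall z, U z -> cdiff F z (f z)) H).
Qed.

Lemma mxnorm_le n (A : 'M[C]_n) (K : R) : (forall i j, Cmod (A i j) <= K) ->
  mxnorm A <= INR n * (INR n * K).
Proof.
by move=> H; rewrite /mxnorm -!Rsum_const; apply: Rsum_le => i; apply: Rsum_le.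
Qed.

Lemma mxnorm_ge0 n (A : 'M[C]_n) : 0 <= mxnorm A.
Proof. by apply: Rsum_ge0 => i; apply: Rsum_ge0 => j; exact: Cmod_ge_0. Qed.

(** * Picard iteration on a half-plane *)

Section HalfPlaneODE.

Variables (n : nat) (a tau : R) (B : C -> 'M[C]_n) (q : C) (v : 'M[C]_n).
Let H := half_plane a tau.
Hypotheses (HB : mholo H B) (Hq : H q).

(** These are the terms of the series, not its partial sums: all but the initial one vanish at [q],
    so that the sum takes the value [v] there. *)
Fixpoint picard (k : nat) : C -> 'M[C]_n :=
  if k is k'.+1 then fun z => (\matrix_(i, j)
    (prim H (fun w => (B w *m picard k' w) i j) z
     - prim H (fun w => (B w *m picard k' w) i j) q))%R
  else fun=> v.

Lemma picardS_of_holo (k : nat) : mholo H (picard k) ->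
  forall z, H z -> mdiff (picard k.+1) z (B z *m picard k z)%R.
Proof.
move=> Hk z Hz i j.
pose F := prim H (fun w => (B w *m picard k w)%R i j).
apply: (cdiff_ext (f := fun w => (F w - F q)%C)); first by move=> w; rewrite mxE.
have D : cdiff F z ((B z *m picard k z)%R i j).
  apply: (primP _ Hz); apply: half_primitive.
  exact: (proj2 (mholo_entries _ _) (mholo_mulmx HB Hk)).
apply: cdiff_val (cdiff_minus D (cdiff_const (F q) z)); exact: GRing.subr0.
Qed.

Lemma picard_holo (k : nat) : mholo H (picard k).
Proof.
elim: k => [|k IH] z Hz; first by exists 0%R; exact: mdiff_const.
by exists (B z *m picard k z)%R; exact: picardS_of_holo.
Qed.

Lemma picardS (k : nat) (z : C) : H z -> mdiff (picard k.+1) z (B z *m picard k z)%R.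
Proof. exact: (picardS_of_holo (picard_holo k)). Qed.

(* The weight [exp (2 K t)] makes the Picard iteration along the segment a
   contraction of ratio 1/2. *)
Lemma picard_bound (w : C) (M : R) (k : nat) (t : R) : H w ->
  (forall t, 0 <= t <= 1 -> forall i j, Cmod (B (q + t * (w - q))%C i j) <= M) ->
  0 <= t <= 1 -> forall i j,
  Cmod (picard k (q + t * (w - q))%C i j) <=
    mxnorm v / 2 ^ k * exp (2 * (INR n * M * Cmod (w - q)%C) * t).
Proof.
move=> Hw HM; set K := INR n * M * Cmod (w - q)%C.
have n0 := pos_INR n; have v0 := mxnorm_ge0 v.
have cw := Cmod_ge_0 (w - q)%C.
elim: k t => [|k IH] t Ht i j.
  rewrite /= Rdiv_1_r; apply: Rle_trans (entry_le_mxnorm _ _ _) _.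
  rewrite -{1}[mxnorm v]Rmult_1_r; apply: Rmult_le_compat_l => //.
  have M0 : 0 <= M by exact: Rle_trans (Cmod_ge_0 _) (HM _ Ht i j).
  have K0 : 0 <= 2 * K * t by repeat apply: Rmult_le_pos => //; lra.
  by have := exp_ineq1_le (2 * K * t); lra.
have M0 : 0 <= M by exact: Rle_trans (Cmod_ge_0 _) (HM _ Ht i j).
have p2 : 0 < 2 ^ k by apply: pow_lt; lra.
have W0 : 0 <= mxnorm v / 2 ^ k by exact: Rdiv_le_0_compat.
pose u s := picard k.+1 (q + s * (w - q))%C i j.
have : Cmod (u t - u 0)%C <= mxnorm v / 2 ^ k.+1 * exp (2 * K * t)
    - mxnorm v / 2 ^ k.+1 * exp (2 * K * 0).
  apply: (@mean_value_le u (fun s => ((B (q + s * (w - q)) *m picard k (q + s * (w - q)))%R i j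
     * (w - q))%C) (fun s => mxnorm v / 2 ^ k.+1 * exp (2 * K * s))
     (fun s => K * (mxnorm v / 2 ^ k * exp (2 * K * s)))); first lra.
  - move=> s Hs; apply: (cdiff_rdiff (f := fun z => picard k.+1 z i j)).
    by apply: picardS; apply: half_plane_convex => //; lra.
  - move=> s Hs; auto_derive => //; rewrite /=; field.
    by apply: Rgt_not_eq.
  - move=> s Hs; rewrite Cmod_mult.
    apply: Rle_trans (_ : INR n * (M * (mxnorm v / 2 ^ k * exp (2 * K * s))) * Cmod (w - q)%C <= _).
      apply: Rmult_le_compat_r => //; apply: mulmx_bound => a' b'; first by apply: HM; lra.
      by apply: IH; lra.
    by right; rewrite /K; ring.
have -> : u 0 = 0%C.
  rewrite /u; have -> : (q + 0 * (w - q) = q)%C by ring.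
  by rewrite /= mxE; exact: GRing.subrr.
have -> : (u t - 0 = u t)%C by ring.
rewrite Rmult_0_r exp_0 Rmult_1_r => h; apply: Rle_trans h _.
have : 0 <= mxnorm v / 2 ^ k.+1 by rewrite div_pow2_S; lra.
lra.
Qed.

Lemma half_ode : exists X : C -> 'M[C]_n, X q = v /\
  forall z, H z -> mdiff X z (B z *m X z)%R.
Proof.
exists (fun z => \matrix_(i, j) gsum (fun k => picard k z i j))%R; split.
  apply/matrixP => i j; rewrite mxE.
  apply: (@gsum_unique _ _ (Cmod (v i j))) => -[|N].
    by rewrite big_ord0 GRing.subr0 /= Rdiv_1_r; right.
  rewrite big_ord_recl /= big1.
    rewrite GRing.addr0 GRing.subrr Cmod_0.
    by apply: Rdiv_le_0_compat; [exact: Cmod_ge_0 | apply: (pow_lt 2 N.+1); lra].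
  by move=> k _; rewrite mxE GRing.subrr.
move=> z Hz.
have [r0 [r0p Hr0]] := half_plane_open Hz.
have [r1 [M [r1p HM]]] : exists r M, 0 < r /\ forall t h, 0 <= t <= 1 -> Cmod h < r ->
    mxnorm (B (q + t * (z + h - q))%C) <= M.
  apply: (@tube_bound (fun w => mxnorm (B w)) q z) => t Ht.
  have [d [K [dp HK]]] := mholo_bound HB (half_plane_convex Hq Hz Ht).
  exists d, (INR n * (INR n * K)); split=> // h hh; apply: mxnorm_le; exact: HK.
pose r := Rmin (Rmin r0 r1) 1.
have rp : 0 < r by repeat apply: Rmin_pos => //; lra.
have rr h : Cmod h < r -> Cmod h < r0 /\ Cmod h < r1 /\ Cmod h < 1.
  have := Rmin_l (Rmin r0 r1) 1; have := Rmin_r (Rmin r0 r1) 1.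
  have := Rmin_l r0 r1; have := Rmin_r r0 r1; rewrite -/r; lra.
(* The [+ 1] covers the segments from [q] to every [z + h] with [Cmod h < 1]. *)
pose V := mxnorm v * exp (2 * (INR n * M * (Cmod (z - q)%C + 1))).
have ew w : (q + 1 * (w - q) = w)%C by ring.
have M0 : 0 <= M.
  apply: Rle_trans (mxnorm_ge0 _) (HM 0 0%C _ _); first lra.
  by rewrite Cmod_0.
have bound k h : Cmod h < r -> forall i j, Cmod (picard k (z + h)%C i j) <= V / 2 ^ k.
  move=> hr i j; have [h0 [h1 h2]] := rr h hr.
  have := @picard_bound (z + h)%C M k 1 (Hr0 h h0) _ _ i j; rewrite ew => PB.
  apply: Rle_trans (PB _ _) _; first 2 last.
  - rewrite /V /Rdiv !Rmult_assoc [/ 2 ^ k * _]Rmult_comm -!Rmult_assoc.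
    apply: Rmult_le_compat_r; first by apply: Rlt_le; apply: Rinv_0_lt_compat; apply: pow_lt; lra.
    apply: Rmult_le_compat_l; first exact: mxnorm_ge0.
    rewrite !Rmult_1_r.
    have le_exp x y : x <= y -> exp x <= exp y.
      by case=> [xy|->]; [left; exact: exp_increasing | right].
    apply: le_exp; rewrite !Rmult_assoc; apply: Rmult_le_compat_l; first lra.
    apply: Rmult_le_compat_l; first exact: pos_INR.
    apply: Rmult_le_compat_l => //.
    have -> : (z + h - q = (z - q) + h)%C by ring.
    by apply: Rle_trans (Cmod_triangle _ _) _; lra.
  - move=> t Ht i' j'; apply: Rle_trans (entry_le_mxnorm _ _ _) _; exact: HM.
  - lra.
have e2 x : x - 0 = x by ring.
apply: (@neumann_series n B _ picard z r V (4 * V) M rp).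
- move=> h hr i j; have [h0 [h1 h2]] := rr h hr.
  apply: Rle_trans (entry_le_mxnorm _ _ _) _.
  by have := HM 1 h ltac:(lra) h1; rewrite ew.
- exact: bound.
- by move=> h _; exact: mdiff_const.
- by move=> k h hr; apply: picardS; apply: Hr0; exact: (proj1 (rr h hr)).
- by move=> h hr i j N; rewrite mxE; apply: gsumP => k; exact: bound.
Qed.

End HalfPlaneODE.

(* [Z] solves the adjoint equation, so that [Z X] is constant for every
   solution [X]. *)
Lemma half_fundamental n (a tau : R) (B : C -> 'M[C]_n) (q : C) :
  mholo (half_plane a tau) B -> half_plane a tau q ->
  exists X0 Z : C -> 'M[C]_n,
    [/\ X0 q = 1%:M%R,
        forall z, half_plane a tau z -> mdiff X0 z (B z *m X0 z)%R,
        forall z, half_plane a tau z -> (Z z *m X0 z = 1%:M)%R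
      & forall U X, convex U -> (forall z, U z -> half_plane a tau z) ->
          (forall z, U z -> mdiff X z (B z *m X z)%R) ->
          forall z w, U z -> U w -> (Z z *m X z = Z w *m X w)%R].
Proof.
move=> HB Hq.
have [X0 [X0q HX0]] := half_ode (1%:M)%R HB Hq.
have [|Z [Zq HZ]] := @half_ode n a tau (fun z => - (B z)^T)%R q (1%:M)%R _ Hq.
  move=> z Hz; have [L HL] := HB z Hz; exists (- L^T)%R => i j.
  rewrite !mxE; apply: (cdiff_ext (f := fun w => (- (1) * B w j i)%C)).
    by move=> w; rewrite !mxE; exact: GRing.mulN1r.
  apply: cdiff_val (cdiff_scal _ (HL j i)); exact: GRing.mulN1r.
have dZ w : half_plane a tau w -> mdiff (fun z => (Z z)^T)%R w (- ((Z w)^T *m B w))%R.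
  move=> Hw i j; apply: (cdiff_ext (f := fun w => Z w j i)); first by move=> u; rewrite mxE.
  have := HZ w Hw j i; apply: cdiff_val.
  rewrite !mxE -GRing.sumrN; apply: eq_bigr => l _.
  by rewrite !mxE GRing.mulNr GRing.mulrC.
have const U X : convex U -> (forall z, U z -> half_plane a tau z) ->
    (forall z, U z -> mdiff X z (B z *m X z)%R) ->
    forall z w, U z -> U w -> ((Z z)^T *m X z = (Z w)^T *m X w)%R.
  move=> cU UH HX.
  apply: (@mdiff0_const n U (fun z => (Z z)^T *m X z)%R) => // w Hw.
  apply: mdiff_val (mdiff_mulmx (dZ w (UH w Hw)) (HX w Hw)).
  by rewrite mulNmx mulmxA GRing.addNr.
exists X0, (fun z => (Z z)^T)%R; split=> // z Hz.
rewrite (const (half_plane a tau) X0 _ _ _ z q) // ?Zq ?X0q ?trmx1 ?mul1mx //.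
by move=> x y t; exact: half_plane_convex.
Qed.

(** The adjoint matrix [Z] makes [Z X] and [Z Y] constant, hence equal, and [Z] is invertible. The
    convex subset [U] stands for an intersection of two half-planes when solutions are glued, and
    for a smaller half-plane in the existence proof. *)
Lemma half_ode_unique n (a tau : R) (B X Y : C -> 'M[C]_n) (U : C -> Prop) (q : C) :
  mholo (half_plane a tau) B -> convex U -> (forall z, U z -> half_plane a tau z) ->
  (forall z, U z -> mdiff X z (B z *m X z)%R) ->
  (forall z, U z -> mdiff Y z (B z *m Y z)%R) ->
  U q -> X q = Y q -> forall z, U z -> X z = Y z.
Proof.
move=> HB cU UH HX HY Uq e z Uz.
have [X0 [Z [_ _ ZX cst]]] := half_fundamental HB (UH q Uq).
have {}ZX := mulmx1C (ZX z (UH z Uz)).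
rewrite -[X z]mul1mx -[Y z]mul1mx -ZX -!mulmxA; congr (_ *m _)%R.
by rewrite (cst U X cU UH HX z q) // (cst U Y cU UH HY z q) // e.
Qed.

Lemma half_ode_unit n (a tau : R) (B : C -> 'M[C]_n) (q : C) (v : 'M[C]_n) :
  mholo (half_plane a tau) B -> half_plane a tau q -> v \in unitmx ->
  exists X : C -> 'M[C]_n, X q = v /\
    forall z, half_plane a tau z -> X z \in unitmx /\ mdiff X z (B z *m X z)%R.
Proof.
move=> HB Hq Hv.
have [X0 [Z [X0q HX ZX _]]] := half_fundamental HB Hq.
exists (fun z => X0 z *m v)%R; split; first by rewrite X0q mul1mx.
move=> z Hz; split.
  by rewrite unitmx_mul Hv andbT; have [] := mulmx1_unit (ZX z Hz).
apply: mdiff_val (mdiff_mulmx (HX z Hz) (mdiff_const v z)).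
by rewrite mulmx0 GRing.addr0 mulmxA.
Qed.

(** [glue] with the invertible matrices as admissible values: a local solution that is invertible at
    one point is so on its whole half-plane. *)
Lemma domain_ode n (a tmin tmax tau : R) (B : C -> 'M[C]_n) (q : C) (v : 'M[C]_n) :
  tmax - tmin <= PI -> mholo (domainU a tmin tmax) B -> tmin < tau < tmax ->
  half_plane a tau q -> v \in unitmx ->
  exists X : C -> 'M[C]_n, X q = v /\
    forall z, domainU a tmin tmax z -> X z \in unitmx /\ mdiff X z (B z *m X z)%R.
Proof.
move=> w HB Ht Hq Hv.
have HBt t : tmin < t < tmax -> mholo (half_plane a t) B.
  by move=> ht z Hz; apply: HB; exact: half_domainU Hz.
have [|||X [Xq HX]] := @glue 'M[C]_n a tmin tmax (fun v => v \in unitmx)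
  (fun t X => forall z, half_plane a t z -> X z \in unitmx /\ mdiff X z (B z *m X z)%R)
  w _ _ _ tau q v Ht Hq Hv.
- by move=> t X z ht HX /HX [].
- move=> t p u ht hp hu.
  by have [X [Xp HX]] := half_ode_unit (HBt t ht) hp hu; exists X.
- move=> t t' X Y p z ht ht' HX HY hp hp' e hz hz'.
  apply: (half_ode_unique (HBt t ht) (@half_plane_convex2 a t t') _ _ _ (conj hp hp') e) => //.
  + by move=> x [].
  + by move=> x [/HX []].
  + by move=> x [_ /HY []].
exists X; split=> // z /domainU_half [t [ht hz]].
have [Y [HY e]] := HX t ht.
have [r [r0 Hr]] := half_plane_open hz.
have [u d] := HY z hz.
rewrite e //; split=> //; apply: (mdiff_ext_loc r0) d => h hh.
by rewrite e //; exact: Hr.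
Qed.

(** * The complex exponential *)

Lemma cexp_add (z w : C) : cexp (z + w)%C = (cexp z * cexp w)%C.
Proof.
rewrite /cexp; have -> : Re (z + w)%C = Re z + Re w by [].
have -> : Im (z + w)%C = Im z + Im w by [].
rewrite exp_plus cos_plus sin_plus; apply: injective_projections => /=; ring.
Qed.

Lemma cexp_0 : cexp 0 = 1.
Proof. by rewrite /cexp /= exp_0 cos_0 sin_0; apply: injective_projections => /=; ring. Qed.

Lemma cexp_cis (x y : R) : cexp (x + y * Ci)%C = (exp x * cis y)%C.
Proof.
rewrite /cexp; have -> : Re (x + y * Ci)%C = x by rewrite /Re /=; ring.
by have -> : Im (x + y * Ci)%C = y by rewrite /Im /=; ring.
Qed.

Lemma Cmod_cexp (z : C) : Cmod (cexp z) = exp (Re z).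
Proof.
rewrite (C_reim z) cexp_cis Cmod_mult Cmod_cis Cmod_R Rmult_1_r Rabs_pos_eq.
  by congr exp; rewrite /Re /=; ring.
exact: Rlt_le (exp_pos _).
Qed.

Lemma cexp_opp_l (z : C) : (cexp (- z) * cexp z = 1)%C.
Proof. by rewrite -cexp_add -cexp_0; congr cexp; ring. Qed.

Lemma exp_le (x y : R) : x <= y -> exp x <= exp y.
Proof. by case=> [xy|->]; [left; exact: exp_increasing | right]. Qed.

Lemma rdiff_ext (u v : R -> C) (t : R) (l : C) : (forall s, u s = v s) ->
  rdiff u t l -> rdiff v t l.
Proof.
by move=> e [h1 h2]; split; [apply: is_derive_ext h1 | apply: is_derive_ext h2];
  move=> s; rewrite e.
Qed.

Lemma rdiff_minus (u v : R -> C) (t : R) (l m : C) : rdiff u t l -> rdiff v t m ->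
  rdiff (fun s => u s - v s)%C t (l - m)%C.
Proof.
move=> [h1 h2] [h3 h4].
by split; [exact: (is_derive_minus (V := R_NormedModule) _ _ _ _ _ h1 h3)
  | exact: (is_derive_minus (V := R_NormedModule) _ _ _ _ _ h2 h4)].
Qed.

Lemma rdiff_cexp_line (h : C) (t : R) :
  rdiff (fun s => cexp (s * h)%C) t (cexp (t * h) * h)%C.
Proof.
have Er (s : R) : Re (s * h)%C = s * Re h by rewrite /Re /=; ring.
have Ei (s : R) : Im (s * h)%C = s * Im h by rewrite /Im /=; ring.
rewrite /rdiff /cexp; split.
  apply: (is_derive_ext (fun s => exp (s * Re h) * cos (s * Im h))).
    by move=> s; rewrite Er Ei /Re /=; ring.
  by auto_derive => //; rewrite Er Ei /Re /Im /=; ring.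
apply: (is_derive_ext (fun s => exp (s * Re h) * sin (s * Im h))).
  by move=> s; rewrite Er Ei /Im /=; ring.
by auto_derive => //; rewrite Er Ei /Re /Im /=; ring.
Qed.

(** The mean value inequality along the segment from 0 to [h], for [cexp] and then for [cexp] minus
    its linear part; the constant 3 bounds [exp 1]. *)
Lemma cexp_taylor (h : C) : Cmod h <= 1 ->
  Cmod (cexp h - 1 - h)%C <= 3 * Cmod h * Cmod h.
Proof.
move=> h1; have h0 := Cmod_ge_0 h.
have B (t : R) : 0 <= t <= 1 -> Cmod (cexp (t * h)%C) <= 3.
  move=> Ht; rewrite Cmod_cexp; apply: Rle_trans exp_le_3; apply: exp_le.
  apply: Rle_trans (Rle_abs _) _; apply: Rle_trans (re_le_Cmod _) _.
  rewrite Cmod_mult Cmod_R Rabs_pos_eq; nra.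
have A (t : R) : 0 <= t <= 1 -> Cmod (cexp (t * h) - 1)%C <= 3 * Cmod h.
  move=> Ht; have := @mean_value_le (fun s => cexp (s * h)%C) (fun s => cexp (s * h) * h)%C
    (fun s => 3 * Cmod h * s) (fun=> 3 * Cmod h) 0 t.
  have -> : (0 * h = 0)%C by ring.
  rewrite cexp_0 Rmult_0_r Rminus_0_r => M; apply: Rle_trans (M _ _ _ _) _; try lra.
  - by move=> s _; exact: rdiff_cexp_line.
  - by move=> s _; auto_derive => //; ring.
  - by move=> s Hs; rewrite Cmod_mult; apply: Rmult_le_compat_r => //; apply: B; lra.
  - by have : 0 <= 3 * Cmod h by [lra]; nra.
have := @mean_value_le (fun s => cexp (s * h) - 1 - s * h)%C (fun s => (cexp (s * h) - 1) * h)%C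
    (fun s => 3 * Cmod h * Cmod h * s) (fun=> 3 * Cmod h * Cmod h) 0 1 Rle_0_1.
have -> : (0 * h = 0)%C by ring.
have -> : (1 * h = h)%C by ring.
rewrite cexp_0; have -> : (cexp h - 1 - h - (1 - 1 - 0) = cexp h - 1 - h)%C by ring.
rewrite Rmult_0_r Rminus_0_r Rmult_1_r; apply.
- move=> s _.
  apply: (rdiff_ext (u := fun s => cexp (s * h) - (1 + s * h))%C) => [u|]; first by ring.
  have -> : ((cexp (s * h) - 1) * h = cexp (s * h) * h - 1 * h)%C by ring.
  apply: rdiff_minus; first exact: rdiff_cexp_line.
  exact: (cdiff_rdiff (cdiff_id _)).
- by move=> s _; auto_derive => //; ring.
- by move=> s Hs; rewrite Cmod_mult; apply: Rmult_le_compat_r => //; exact: A.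
Qed.

Lemma cdiff_cexp (z : C) : cdiff cexp z (cexp z).
Proof.
move=> eps He; have e0 := exp_pos (Re z).
have d0 : 0 < eps / (3 * exp (Re z)) by apply: Rdiv_lt_0_compat; lra.
exists (Rmin 1 (eps / (3 * exp (Re z)))); split; first by apply: Rmin_pos; lra.
move=> h hh; have h0 := Cmod_ge_0 h.
have h1 : Cmod h <= 1 by have := Rmin_l 1 (eps / (3 * exp (Re z))); lra.
have h2 : Cmod h <= eps / (3 * exp (Re z)).
  by have := Rmin_r 1 (eps / (3 * exp (Re z))); lra.
have -> : (cexp (z + h) - cexp z - cexp z * h = cexp z * (cexp h - 1 - h))%C.
  by rewrite cexp_add; ring.
rewrite Cmod_mult Cmod_cexp.
apply: Rle_trans (Rmult_le_compat_l _ _ _ (Rlt_le _ _ e0) (cexp_taylor h1)) _.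
have -> : exp (Re z) * (3 * Cmod h * Cmod h) = Cmod h * (3 * exp (Re z)) * Cmod h by ring.
by apply: Rmult_le_compat_r => //; apply/Rle_div_r; lra.
Qed.

(** * Primitives vanishing at the end of every line *)

Definition tends_to (u : R -> C) (L : C) : Prop :=
  forall eps, 0 < eps -> exists S, forall s, S <= s -> Cmod (u s - L)%C <= eps.

(** On a long rectangle inside the half-strip the horizontal sides contribute about [L1 - L2] times
    the length, whereas the vertical sides stay bounded; the total being zero, the limits must
    agree. *)
Lemma strip_limits (f : C -> C) (y1 y2 K : R) (L1 L2 : C) : y1 <= y2 ->
  (forall x y : R, 0 <= x -> y1 <= y <= y2 -> exists l, cdiff f (x + y * Ci)%C l) ->
  (forall x y : R, 0 <= x -> y1 <= y <= y2 -> Cmod (f (x + y * Ci)%C) <= K) ->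
  tends_to (fun x => f (x + y1 * Ci)%C) L1 ->
  tends_to (fun x => f (x + y2 * Ci)%C) L2 -> L1 = L2.
Proof.
move=> y12 Hf HK H1 H2.
have : (L1 - L2 = 0)%C; last by move=> e; rewrite (Csub_add L1 L2) e Cplus_0_l.
apply: Cmod_eq_0; apply: Rle_antisym; last exact: Cmod_ge_0.
set c := Cmod _; apply: Rnot_gt_le => c0.
have [X1 HX1] := H1 (c / 4) ltac:(lra); have [X2 HX2] := H2 (c / 4) ltac:(lra).
pose X := Rmax 0 (Rmax X1 X2).
have X0 : 0 <= X by exact: Rmax_l.
have X1X : X1 <= X by apply: Rle_trans (Rmax_l _ _) (Rmax_r _ _).
have X2X : X2 <= X by apply: Rle_trans (Rmax_r _ _) (Rmax_r _ _).
have K0 : 0 <= K by apply: Rle_trans (Cmod_ge_0 _) (HK 0 y1 _ _); lra.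
(* The sides of a rectangle of length [D] give [c * D <= c / 2 * D + 2 * K * (y2 - y1)], which this
   length violates. *)
pose D := 2 * (2 * K * (y2 - y1) + 1) / c.
have Ky : 0 <= K * (y2 - y1) by apply: Rmult_le_pos; lra.
have D0 : 0 < D by apply: Rdiv_lt_0_compat => //; lra.
pose N := X + D.
have G : rect_int f X N y1 y2 = 0.
  apply: goursat => x y; rewrite (Rmin_left X N) ?(Rmax_right X N) ?(Rmin_left y1) ?(Rmax_right y1) //;
    try (rewrite /N; lra).
  by move=> Hx Hy; apply: Hf; lra.
have e (x y : R) : (y * Ci + x * 1 = x + y * Ci)%C by ring.
have h1 : Cmod (lint f (y1 * Ci) 1 X N - L1 * ((N - X) * 1))%C <= c / 4 * Rabs (N - X).
  apply: lint_near_const; first exact: Cmod_1.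
    move=> t; rewrite Rmin_left ?Rmax_right /N; try lra.
    by move=> Ht; rewrite e; apply: Hf; lra.
  move=> t; rewrite Rmin_left ?Rmax_right /N; try lra.
  by move=> Ht; rewrite e; apply: HX1; lra.
have h2 : Cmod (lint f (y2 * Ci) 1 X N - L2 * ((N - X) * 1))%C <= c / 4 * Rabs (N - X).
  apply: lint_near_const; first exact: Cmod_1.
    move=> t; rewrite Rmin_left ?Rmax_right /N; try lra.
    by move=> Ht; rewrite e; apply: Hf; lra.
  move=> t; rewrite Rmin_left ?Rmax_right /N; try lra.
  by move=> Ht; rewrite e; apply: HX2; lra.
have h3 x : 0 <= x -> Cmod (lint f x Ci y1 y2 - 0 * ((y2 - y1) * Ci))%C <= K * Rabs (y2 - y1).
  move=> Hx; apply: lint_near_const; first exact: Cmod_Ci.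
    by move=> t; rewrite Rmin_left ?Rmax_right // => Ht; apply: Hf.
  move=> t; rewrite Rmin_left ?Rmax_right // => Ht.
  have -> : (f (x + t * Ci) - 0 = f (x + t * Ci))%C by ring.
  exact: HK.
have h4 := h3 X X0; have := h3 N ltac:(rewrite /N; lra).
rewrite !Rabs_pos_eq in h1 h2 h4 *; try (rewrite /N; lra); move=> h5.
have NX : N - X = D by rewrite /N; ring.
have NXC : (N - X)%C = D by rewrite -RtoC_minus NX.
rewrite NX NXC in h1 h2.
move: h1 h2 h4 h5 G; rewrite /rect_int.
set a1 := lint f (y1 * Ci) 1 X N; set a2 := lint f (y2 * Ci) 1 X N.
set b1 := lint f X Ci y1 y2; set b2 := lint f N Ci y1 y2.
move=> h1 h2 h4 h5 G.
have cD : c * D <= c / 4 * D + c / 4 * D + (K * (y2 - y1) + K * (y2 - y1)).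
  have -> : c * D = Cmod ((L1 - L2) * D)%C by rewrite Cmod_mult Cmod_R Rabs_pos_eq //; lra.
  have -> : ((L1 - L2) * D = (- (a1 - L1 * (D * 1)) + (a2 - L2 * (D * 1))) +
    ((b1 - 0 * ((y2 - y1) * Ci)) + - (b2 - 0 * ((y2 - y1) * Ci)))
    + (a1 + b2 - a2 - b1))%C by ring.
  rewrite G Cplus_0_r; apply: Rle_trans (Cmod_triangle _ _) _.
  apply: Rplus_le_compat; apply: Rle_trans (Cmod_triangle _ _) _;
    by rewrite Cmod_opp; apply: Rplus_le_compat.
have : c * D = 2 * (2 * K * (y2 - y1) + 1) by rewrite /D; field; lra.
lra.
Qed.

Lemma monotone_limit (u : R -> R) (K : R) :
  (forall s t, 0 <= s -> s <= t -> u s <= u t) -> (forall s, 0 <= s -> u s <= K) ->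
  exists l, forall eps, 0 < eps -> exists S, 0 <= S /\ forall s, S <= s -> Rabs (u s - l) <= eps.
Proof.
move=> mono ub.
have [l [Hl1 Hl2]] : {m | is_lub (fun r => exists s, 0 <= s /\ r = u s) m}.
  apply: completeness; first by exists K => r [s [Hs ->]]; exact: ub.
  by exists (u 0), 0; split=> //; lra.
exists l => eps He.
have [S [S0 HS]] : exists S, 0 <= S /\ l - eps < u S.
  apply: NNPP => bad; have : l <= l - eps; last lra.
  apply: Hl2 => r [s [Hs ->]]; apply: Rnot_gt_le => h; apply: bad; exists s; split=> //; lra.
exists S; split=> // s Hs; apply: Rabs_le; have := mono S s S0 Hs.
have : u s <= l by apply: Hl1; exists s; split=> //; lra.
lra.
Qed.

Lemma tends_to_shift (u : R -> C) (L : C) (r : R) :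
  tends_to u L -> tends_to (fun s => u (s + r)) L.
Proof.
move=> H eps He; have [S HS] := H _ He; exists (S - r) => s Hs.
by apply: HS; lra.
Qed.

Lemma tends_to_ext (u v : R -> C) (L : C) : (forall s, u s = v s) ->
  tends_to u L -> tends_to v L.
Proof.
by move=> e H eps He; have [S HS] := H _ He; exists S => s Hs; rewrite -e; exact: HS.
Qed.

Lemma tends_to_le (u : R -> C) (L z : C) (K : R) : tends_to u L ->
  (forall s, 0 <= s -> Cmod (u s - z)%C <= K) -> Cmod (z - L)%C <= K.
Proof.
move=> H HK; apply: Rnot_gt_le => c0.
have [S HS] := H (Cmod (z - L)%C - K) ltac:(lra).
have e : exists s, 0 <= s /\ S + 1 <= s.
  by exists (Rmax 0 (S + 1)); split; [exact: Rmax_l | exact: Rmax_r].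
have [s [s0 sS]] := e.
have [S' HS'] := H ((Cmod (z - L)%C - K) / 2) ltac:(lra).
have t0 : 0 <= Rmax 0 S' by exact: Rmax_l.
have := HS' _ (Rmax_r 0 S'); have := HK _ t0; set x := u _.
have := Cmod_triangle (- (x - z))%C (x - L)%C; rewrite Cmod_opp.
have -> : (- (x - z) + (x - L) = z - L)%C by ring.
lra.
Qed.

(** For each coordinate of [u], its sum with [M] is monotone and bounded, as is [M] itself; the
    coordinate converges as the difference of the two. *)
Lemma dominated_limit (u : R -> C) (M : R -> R) (K : R) :
  (forall s t, 0 <= s -> s <= t -> Cmod (u t - u s)%C <= M t - M s) ->
  (forall s, 0 <= s -> M s - M 0 <= K) -> exists L, tends_to u L.
Proof.
move=> H HK.
have Mm s t : 0 <= s -> s <= t -> M s <= M t.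
  by move=> s0 st; have := H s t s0 st; have := Cmod_ge_0 (u t - u s)%C; lra.
have part (p : C -> R) : (forall x y, p (x - y)%C = p x - p y) ->
    (forall x, Rabs (p x) <= Cmod x) ->
    exists l, forall eps, 0 < eps -> exists S, 0 <= S /\
      forall s, S <= s -> Rabs (p (u s) - l) <= eps.
  move=> psub ple.
  have P s t : 0 <= s -> s <= t -> Rabs (p (u t) - p (u s)) <= M t - M s.
    by move=> s0 st; rewrite -psub; apply: Rle_trans (ple _) (H _ _ s0 st).
  have [l Hl] := @monotone_limit (fun s => p (u s) + M s) (p (u 0) + M 0 + 2 * K)
    (fun s t s0 st => ltac:(have /Rabs_le_between := P s t s0 st; lra))
    (fun s s0 => ltac:(have /Rabs_le_between := P 0 s (Rle_refl 0) s0; have := HK s s0; lra)).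
  have [m Hm] := @monotone_limit M (M 0 + K) Mm (fun s s0 => ltac:(have := HK s s0; lra)).
  exists (l - m) => eps He.
  have [S1 [S10 h1]] := Hl (eps / 2) ltac:(lra).
  have [S2 [S20 h2]] := Hm (eps / 2) ltac:(lra).
  exists (Rmax S1 S2); split; first by apply: Rle_trans S10 (Rmax_l _ _).
  move=> s Hs.
  have := Rmax_l S1 S2; have := Rmax_r S1 S2 => m1 m2.
  have {}h1 := h1 s ltac:(lra); have {}h2 := h2 s ltac:(lra).
  have -> : p (u s) - (l - m) = (p (u s) + M s - l) + - (M s - m) by ring.
  by apply: Rle_trans (Rabs_triang _ _) _; rewrite Rabs_Ropp; lra.
have [x Hx] := part Re (fun _ _ => erefl) re_le_Cmod.
have [y Hy] := part Im (fun _ _ => erefl) im_le_Cmod.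
exists (x, y) => eps He.
have [S1 [_ h1]] := Hx (eps / 2) ltac:(lra); have [S2 [_ h2]] := Hy (eps / 2) ltac:(lra).
exists (Rmax S1 S2) => s Hs.
have := Rmax_l S1 S2; have := Rmax_r S1 S2 => m1 m2.
apply: Rle_trans (Cmod_le_abs _) _.
have {}h1 := h1 s ltac:(lra); have {}h2 := h2 s ltac:(lra).
by move: h1 h2; rewrite /Re /Im /=; rewrite /Rminus; lra.
Qed.

(** * Limits of a primitive along rays *)

(** Says that the L^1 norm of [rho] on the line is at most [e], through a nondecreasing primitive
    that can serve as the majorant in the mean value inequality. *)
Definition line_bound (rho : C -> R) (tau d e : R) : Prop :=
  exists N : R -> R, (forall s, is_derive N s (rho (line_pt tau d s))) /\
    forall s t, s <= t -> 0 <= N t - N s <= e.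

(** The height over [t], times [sin (t2 - t1)], is the combination of the heights over [t1] and [t2]
    with coefficients [sin (t2 - t)] and [sin (t - t1)], whose sum is at least [sin (t2 - t1)]. Thus
    the whole sector of rays between two lines through [z] stays in the domain. *)
Lemma crossing_half_plane (D t1 t2 t : R) (z : C) : 0 < D -> t1 < t2 -> t2 - t1 < PI ->
  half_plane D t1 z -> half_plane D t2 z -> t1 <= t <= t2 -> half_plane D t z.
Proof.
rewrite /half_plane => D0 t12 w h1 h2 Ht.
have pi := PI_RGT_0.
have [Et|Et] := Req_dec t t1; first by rewrite Et.
have [Et'|Et'] := Req_dec t t2; first by rewrite Et'.
have s0 : 0 < sin (t2 - t1) by apply: sin_gt_0; lra.
have sA : 0 < sin (t2 - t) by apply: sin_gt_0; lra.
have sB : 0 < sin (t - t1) by apply: sin_gt_0; lra.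
have E : sin (t2 - t1) * Im (cis (- t) * z)%C =
    sin (t2 - t) * Im (cis (- t1) * z)%C + sin (t - t1) * Im (cis (- t2) * z)%C.
  by rewrite /cis /Im /= !cos_neg !sin_neg !sin_minus; ring.
have S : sin (t2 - t1) <= sin (t2 - t) + sin (t - t1).
  have -> : t2 - t1 = (t2 - t) + (t - t1) by ring.
  rewrite sin_plus.
  have := COS_bound (t - t1); have := COS_bound (t2 - t); nra.
apply: (Rmult_lt_reg_l (sin (t2 - t1))) => //; rewrite E.
nra.
Qed.

Section RayPrimitive.

Variables (D tmin tmax sigma E : R) (g : C -> C) (rho c : C -> R).
Let U := domainU D tmin tmax.
Hypotheses (D0 : 0 < D) (lt_t : tmin < tmax) (width : tmax - tmin <= PI).
Hypothesis sigma1 : sigma = 1 \/ sigma = -1.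
Hypothesis c0 : forall z, 0 <= c z.
Hypothesis dom : forall tau z s, tmin < tau < tmax -> half_plane D tau z -> 0 <= s ->
  Cmod (g (z + s * (sigma * cis tau))%C) <= c z * rho (z + s * (sigma * cis tau))%C.
Hypothesis HE : forall tau d, tmin < tau < tmax -> D < d -> line_bound rho tau d E.

Variable Q : C -> C.
Hypothesis HQ : forall z, U z -> cdiff Q z (g z).

Let sigma2 : sigma * sigma = 1.
Proof. by case: sigma1 => ->; ring. Qed.

Lemma ray_in (tau s : R) (z : C) : half_plane D tau z -> half_plane D tau (z + s * (sigma * cis tau))%C.
Proof.
rewrite /half_plane; have -> : (s * (sigma * cis tau) = RtoC (s * sigma) * cis tau)%C.
  by rewrite RtoC_mult; ring.
by rewrite line_move.
Qed.

(** The majorant is [c z] times the primitive of [rho] along the line; the outer factor [sigma]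
    makes it nondecreasing also when the line is traversed backwards. *)
Lemma ray_increment (tau e : R) (z : C) : tmin < tau < tmax -> half_plane D tau z ->
  line_bound rho tau (Im (cis (- tau) * z)%C) e ->
  exists M : R -> R, (forall s, 0 <= s -> M s - M 0 <= c z * e) /\
    forall s t, 0 <= s -> s <= t ->
    Cmod (Q (z + t * (sigma * cis tau)) - Q (z + s * (sigma * cis tau)))%C <= M t - M s.
Proof.
move=> Ht Hz [N [dN HN]].
set d := Im _ in dN; pose s0 := Re (cis (- tau) * z)%C.
have ez (s : R) : (z + s * (sigma * cis tau))%C = line_pt tau d (s0 + sigma * s).
  by rewrite -line_pt_move -(line_pt_of tau z) RtoC_mult; ring.
exists (fun s => c z * (sigma * N (s0 + sigma * s))); split.
  move=> s Hs; rewrite -Rmult_minus_distr_l; apply: Rmult_le_compat_l => //.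
  case: sigma1 => ->.
    by have := HN (s0 + 1 * 0) (s0 + 1 * s) ltac:(lra); lra.
  by have := HN (s0 + -1 * s) (s0 + -1 * 0) ltac:(lra); lra.
move=> s t Hs st.
apply: (@mean_value_le (fun s => Q (z + s * (sigma * cis tau))%C)
  (fun s => g (z + s * (sigma * cis tau)) * (sigma * cis tau))%C
  (fun s => c z * (sigma * N (s0 + sigma * s)))
  (fun s => c z * rho (z + s * (sigma * cis tau))%C)) => // u Hu.
- by apply: cdiff_rdiff; apply: HQ; apply: (half_domainU Ht); exact: ray_in.
- rewrite ez; have dNu := dN (s0 + sigma * u).
  auto_derive; first by exists (rho (line_pt tau d (s0 + sigma * u))).
  rewrite (is_derive_unique _ _ _ dNu).
  transitivity (c z * rho (line_pt tau d (s0 + sigma * u)) * (sigma * sigma)); first by ring.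
  by rewrite sigma2 Rmult_1_r.
- rewrite !Cmod_mult Cmod_cis Cmod_R.
  have -> : Rabs sigma = 1 by case: sigma1 => ->; rewrite /Rabs; case: Rcase_abs; lra.
  by rewrite !Rmult_1_r; apply: dom => //; lra.
Qed.

Definition ray_limit (tau : R) (z L : C) : Prop :=
  tends_to (fun s => Q (z + s * (sigma * cis tau))%C) L.

Lemma ray_bounded (tau e : R) (z : C) (s : R) : tmin < tau < tmax -> half_plane D tau z ->
  line_bound rho tau (Im (cis (- tau) * z)%C) e -> 0 <= s ->
  Cmod (Q (z + s * (sigma * cis tau)) - Q z)%C <= c z * e.
Proof.
move=> Ht Hz /(ray_increment Ht Hz) [M [HM inc]] Hs.
have := inc 0 s (Rle_refl 0) Hs; have := HM s Hs.
have -> : (z + 0 * (sigma * cis tau) = z)%C by ring.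
lra.
Qed.

Lemma ray_limit_ex (tau : R) (z : C) : tmin < tau < tmax -> half_plane D tau z ->
  exists L, ray_limit tau z L.
Proof.
move=> Ht Hz; have [M [HM inc]] := ray_increment Ht Hz (HE Ht Hz).
exact: dominated_limit inc HM.
Qed.

Lemma ray_limit_le (tau e : R) (z L : C) : tmin < tau < tmax -> half_plane D tau z ->
  line_bound rho tau (Im (cis (- tau) * z)%C) e -> ray_limit tau z L ->
  Cmod (Q z - L)%C <= c z * e.
Proof.
move=> Ht Hz He HL; apply: tends_to_le HL _ => s Hs.
exact: ray_bounded.
Qed.

(* Two lines through [z]: in the coordinate [w], [z + sigma * cexp w], the sector
   between them is a half-strip. *)
Lemma ray_limit_cross (t1 t2 : R) (z L1 L2 : C) : t1 < t2 ->
  tmin < t1 < tmax -> tmin < t2 < tmax -> half_plane D t1 z -> half_plane D t2 z ->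
  ray_limit t1 z L1 -> ray_limit t2 z L2 -> L1 = L2.
Proof.
move=> t12 Ht1 Ht2 h1 h2 H1 H2.
have mid t : t1 <= t <= t2 -> tmin < t < tmax /\ half_plane D t z.
  by move=> Ht; split; [lra | apply: (crossing_half_plane D0 t12 _ h1 h2 Ht); lra].
have e (x y : R) : (z + sigma * cexp (x + y * Ci) = z + exp x * (sigma * cis y))%C.
  by rewrite cexp_cis; ring.
have lim t L : ray_limit t z L ->
    tends_to (fun x => Q (z + sigma * cexp (x + t * Ci))%C) L.
  move=> H eps He; have [S HS] := H eps He; exists S => x Hx.
  by rewrite e; apply: HS; have := exp_ineq1_le x; lra.
apply: (@strip_limits (fun w => Q (z + sigma * cexp w)%C) t1 t2 (c z * E + Cmod (Q z)));
  first lra; last 1 first.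
- exact: lim.
- move=> x y Hx Hy; have [Ht Hh] := mid y Hy.
  exists (g (z + sigma * cexp (x + y * Ci)) * (sigma * cexp (x + y * Ci)))%C.
  apply: (cdiff_comp (f := fun w => (z + sigma * cexp w)%C)).
    apply: (cdiff_ext (f := fun w => (sigma * cexp w + z)%C)); first by move=> w; ring.
    apply: cdiff_val (cdiff_plus (cdiff_scal sigma (cdiff_cexp _)) (cdiff_const z _)); ring.
  by apply: HQ; rewrite e; apply: (half_domainU Ht); exact: ray_in.
- move=> x y Hx Hy; have [Ht Hh] := mid y Hy; rewrite e.
  rewrite (Csub_add (Q _) (Q z)); apply: Rle_trans (Cmod_triangle _ _) _.
  apply: Rplus_le_compat_r; apply: (ray_bounded (tau := y)) => //; first exact: HE.
  exact: Rlt_le (exp_pos _).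
- exact: lim.
Qed.

Lemma ray_limit_line (tau r : R) (z L : C) :
  ray_limit tau z L -> ray_limit tau (z + r * cis tau)%C L.
Proof.
move=> H; have := tends_to_shift (sigma * r) H; apply: tends_to_ext => s.
congr Q; rewrite RtoC_plus RtoC_mult.
have s2 : (sigma * sigma = 1)%C by rewrite -RtoC_mult sigma2.
have -> : (z + (s + sigma * r) * (sigma * cis tau) =
   z + (s * (sigma * cis tau) + (sigma * sigma) * r * cis tau))%C by ring.
by rewrite s2; ring.
Qed.

Lemma lines_cross (t1 t2 d1 d2 : R) : t1 < t2 -> t2 - t1 < PI ->
  exists z, Im (cis (- t1) * z)%C = d1 /\ Im (cis (- t2) * z)%C = d2.
Proof.
move=> t12 w; have k0 : 0 < sin (t2 - t1) by apply: sin_gt_0; lra.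
set k := sin (t2 - t1) in k0.
exists (RtoC (d1 / k) * cis t2 - RtoC (d2 / k) * cis t1)%C.
have ek : sin t2 * cos t1 - cos t2 * sin t1 = k by rewrite -sin_minus.
split; rewrite /cis /Im /= cos_neg sin_neg.
  transitivity (d1 / k * (sin t2 * cos t1 - cos t2 * sin t1)); first by ring.
  by rewrite ek; field; lra.
transitivity (d2 / k * (sin t2 * cos t1 - cos t2 * sin t1)); first by ring.
by rewrite ek; field; lra.
Qed.

(** Moving a base point along its line does not change the limit, so both base points may be moved
    to the point where the lines cross. *)
Lemma ray_limit_lt (t1 t2 : R) (z1 z2 L1 L2 : C) : t1 < t2 ->
  tmin < t1 < tmax -> tmin < t2 < tmax -> half_plane D t1 z1 -> half_plane D t2 z2 ->
  ray_limit t1 z1 L1 -> ray_limit t2 z2 L2 -> L1 = L2.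
Proof.
move=> t12 Ht1 Ht2 h1 h2 H1 H2.
have [z [e1 e2]] := @lines_cross t1 t2 (Im (cis (- t1) * z1)%C) (Im (cis (- t2) * z2)%C) t12 ltac:(lra).
have on_same t x : Im (cis (- t) * z)%C = Im (cis (- t) * x)%C ->
    exists r : R, z = (x + r * cis t)%C.
  move=> e; exists (Re (cis (- t) * z)%C - Re (cis (- t) * x)%C).
  rewrite {1}(line_pt_of t z) e {2}(line_pt_of t x) line_pt_move; congr line_pt.
  by ring.
have [r1 E1] := on_same t1 z1 e1; have [r2 E2] := on_same t2 z2 e2.
apply: (ray_limit_cross (z := z) t12 Ht1 Ht2).
- by rewrite /half_plane e1.
- by rewrite /half_plane e2.
- by rewrite E1; exact: ray_limit_line.
- by rewrite E2; exact: ray_limit_line.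
Qed.

Lemma ray_limit_unique (t1 t2 : R) (z1 z2 L1 L2 : C) :
  tmin < t1 < tmax -> tmin < t2 < tmax -> half_plane D t1 z1 -> half_plane D t2 z2 ->
  ray_limit t1 z1 L1 -> ray_limit t2 z2 L2 -> L1 = L2.
Proof.
move=> Ht1 Ht2 h1 h2 H1 H2.
case: (Rtotal_order t1 t2) => [lt|[eq|gt]]; last 1 first.
- by symmetry; apply: (ray_limit_lt (t1 := t2) (t2 := t1)) H2 H1.
- exact: (ray_limit_lt lt) H1 H2.
(* Parallel lines do not cross; each is compared with a line of a third direction. *)
pose t3 := (t1 + tmax) / 2.
have Ht3 : tmin < t3 < tmax by rewrite /t3; lra.
have t13 : t1 < t3 by rewrite /t3; lra.
have [z3 [h3 _]] := half_planes_meet3 D width Ht3 Ht3 Ht3.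
have [L3 H3] := ray_limit_ex Ht3 h3.
rewrite (ray_limit_lt t13 Ht1 Ht3 h1 h3 H1 H3).
by rewrite (ray_limit_lt (t1 := t2) _ Ht2 Ht3 h2 h3 H2 H3) // -eq.
Qed.

End RayPrimitive.

(** All rays share one limit; subtracting it leaves a primitive bounded by what remains along the
    ray. The uniform [E] provides the limits, while [e] keeps the finer bound available on each
    single line. *)
Lemma ray_primitive (D tmin tmax sigma E : R) (g : C -> C) (rho c : C -> R) :
  0 < D -> tmin < tmax -> tmax - tmin <= PI -> sigma = 1 \/ sigma = -1 ->
  holo_on (domainU D tmin tmax) g -> (forall z, 0 <= c z) ->
  (forall tau z s, tmin < tau < tmax -> half_plane D tau z -> 0 <= s ->
    Cmod (g (z + s * (sigma * cis tau))%C) <= c z * rho (z + s * (sigma * cis tau))%C) ->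
  (forall tau d, tmin < tau < tmax -> D < d -> line_bound rho tau d E) ->
  exists Q, (forall z, domainU D tmin tmax z -> cdiff Q z (g z)) /\
    forall tau z e, tmin < tau < tmax -> half_plane D tau z ->
      line_bound rho tau (Im (cis (- tau) * z)%C) e -> Cmod (Q z) <= c z * e.
Proof.
move=> D0 lt w s1 Hg c0 dom HE.
have [Q0 HQ0] := domain_primitive lt w Hg.
pose t0 := (tmin + tmax) / 2.
have Ht0 : tmin < t0 < tmax by rewrite /t0; lra.
have [z0 [h0 _]] := half_planes_meet3 D w Ht0 Ht0 Ht0.
have [L HL] := ray_limit_ex s1 c0 dom HE HQ0 Ht0 h0.
exists (fun z => Q0 z - L)%C; split.
  move=> z Hz; apply: cdiff_val (cdiff_minus (HQ0 z Hz) (cdiff_const L z)); ring.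
move=> tau z e Ht Hz He.
have [L' HL'] := ray_limit_ex s1 c0 dom HE HQ0 Ht Hz.
rewrite (ray_limit_unique D0 lt w s1 c0 dom HE HQ0 Ht0 Ht h0 Hz HL HL').
exact: (ray_limit_le s1 c0 dom HQ0 Ht Hz He HL').
Qed.

(** * Simple connectedness bounds the width *)

Lemma domainU_Cmod (a tmin tmax : R) (z : C) : domainU a tmin tmax z -> a < Cmod z.
Proof.
move=> /domainU_half [tau [_ Hz]]; apply: Rlt_le_trans Hz _.
apply: Rle_trans (Rle_abs _) _; apply: Rle_trans (im_le_Cmod _) _.
by rewrite Cmod_mult Cmod_cis Rmult_1_l; right.
Qed.

(** Three directions suffice, the middle one and its rotations by [h] and [- h]: for every [theta]
    one of them has [sin (theta - tau) >= k], so the radius [(a + 1) / k] reaches beyond [a]. *)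
Lemma circle_in_domain (a tmin tmax : R) : 0 < a -> PI < tmax - tmin ->
  exists r, 0 < r /\ forall theta, domainU a tmin tmax (r * cis theta)%C.
Proof.
move=> a0 w; have pi := PI_RGT_0.
pose tm := (tmin + tmax) / 2.
(* Strictly between [PI / 2] and both [PI] and the half-width, so that [sin h > 0], [cos h < 0] and
   the rotated directions are admissible. *)
pose h := (PI / 2 + Rmin ((tmax - tmin) / 2) PI) / 2.
have [h1 [h2 h3]] : PI / 2 < h /\ h < PI /\ h < (tmax - tmin) / 2.
  by rewrite /h /Rmin; case: Rle_dec => ?; lra.
have S0 : 0 < sin h by apply: sin_gt_0; lra.
have C0 : cos h < 0 by apply: cos_lt_0; lra.
have [S1 C1] : sin h <= 1 /\ - 1 <= cos h by have := SIN_bound h; have := COS_bound h; lra.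
pose k := Rmin (sin h) (- cos h) / 4.
have k0 : 0 < k by rewrite /k; have := Rmin_pos _ _ S0 (Ropp_0_gt_lt_contravar _ C0); lra.
have kS : 4 * k <= sin h by rewrite /k; have := Rmin_l (sin h) (- cos h); lra.
have kC : 4 * k <= - cos h by rewrite /k; have := Rmin_r (sin h) (- cos h); lra.
(* [s] and [c] are the sine and cosine of the angle from the middle direction, up to the sign of
   [c]. When [s < k], a rotation by [h] towards the appropriate side raises the sine to at least
   [k]. *)
have key (s c : R) : s * s + c * c = 1 -> 0 <= c -> s < k -> k <= - s * - cos h + c * sin h.
  move=> sc c0' sk.
  have k4 : k <= / 4 by lra.
  case: (Rle_dec s 0) => s0.
    have : 1 <= - s + c by nra.
    by nra.
  have : 3 / 4 <= c by nra.
  by nra.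
have dir theta : exists tau, tmin < tau < tmax /\ k <= sin (theta - tau).
  have sc := sin2_cos2 (theta - tm); rewrite /Rsqr in sc.
  case: (Rle_dec k (sin (theta - tm))) => hs.
    by exists tm; split=> //; rewrite /tm; lra.
  case: (Rle_dec 0 (cos (theta - tm))) => hc.
    exists (tm - h); split; first by rewrite /tm; lra.
    have -> : theta - (tm - h) = (theta - tm) + h by ring.
    rewrite sin_plus; have := key _ _ sc hc ltac:(lra); lra.
  exists (tm + h); split; first by rewrite /tm; lra.
  have -> : theta - (tm + h) = (theta - tm) - h by ring.
  rewrite sin_minus.
  have := key (sin (theta - tm)) (- cos (theta - tm)) ltac:(lra) ltac:(lra) ltac:(lra); lra.
exists ((a + 1) / k); split; first by apply: Rdiv_lt_0_compat; lra.
move=> theta; have [tau [Ht Hs]] := dir theta.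
apply: (half_domainU Ht); rewrite /half_plane.
have -> : (cis (- tau) * (RtoC ((a + 1) / k) * cis theta) =
   RtoC ((a + 1) / k) * cis (theta - tau))%C.
  by rewrite /Rminus cis_add; ring.
have -> : Im (RtoC ((a + 1) / k) * cis (theta - tau))%C = (a + 1) / k * sin (theta - tau).
  by rewrite /cis /Im /=; ring.
have : (a + 1) / k * k <= (a + 1) / k * sin (theta - tau).
  by apply: Rmult_le_compat_l => //; apply: Rlt_le; apply: Rdiv_lt_0_compat; lra.
have -> : (a + 1) / k * k = a + 1 by field; lra.
lra.
Qed.

(** * Winding numbers of sampled curves *)

Definition arg_near1 (z : C) : R := atan (Im z / Re z).

Lemma near1_parts (z : C) : Cmod (z - 1)%C <= / 4 -> 3 / 4 <= Re z /\ Rabs (Im z) <= / 4.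
Proof.
move=> Hz; have := Rle_trans _ _ _ (re_le_Cmod _) Hz; have := Rle_trans _ _ _ (im_le_Cmod _) Hz.
have -> : Im (z - 1)%C = Im z by rewrite /Im /=; ring.
have -> : Re (z - 1)%C = Re z - 1 by rewrite /Re /=; ring.
by move=> h1 /Rabs_le_between h2; split=> //; lra.
Qed.

Lemma arg_near1P (z : C) : Cmod (z - 1)%C <= / 4 ->
  Rabs (arg_near1 z) < PI / 4 /\ exists m, 0 < m /\ z = (m * cis (arg_near1 z))%C.
Proof.
move=> /near1_parts [hr hi].
have r0 : 0 < Re z by lra.
have [x1 x2] : -1 < Im z / Re z < 1.
  have /Rabs_le_between := hi => ?; split.
    by apply/(Rlt_div_r _ _ _ r0); lra.
  by apply/(Rlt_div_l _ _ _ r0); lra.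
split.
  by apply: Rabs_def1; rewrite -?atan_1 -?atan_opp; apply: atan_increasing; lra.
have s0 : 0 < sqrt (1 + (Im z / Re z)²) by apply: sqrt_lt_R0; have := Rle_0_sqr (Im z / Re z); lra.
exists (Re z * sqrt (1 + (Im z / Re z)²)); split; first exact: Rmult_lt_0_compat.
rewrite /arg_near1 /cis cos_atan sin_atan.
by apply: injective_projections; rewrite -/(Re z) -/(Im z) /=; field; split; lra.
Qed.

(** Both sums are arguments of one number and lie strictly between [- PI / 2] and [PI / 2]; their
    difference has zero sine and modulus below [PI]. The two products are the two ways across a mesh
    cell of a homotopy. *)
Lemma arg_near1_mul (z1 z2 w1 w2 : C) :
  Cmod (z1 - 1)%C <= / 4 -> Cmod (z2 - 1)%C <= / 4 ->
  Cmod (w1 - 1)%C <= / 4 -> Cmod (w2 - 1)%C <= / 4 ->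
  (z1 * z2 = w1 * w2)%C -> arg_near1 z1 + arg_near1 z2 = arg_near1 w1 + arg_near1 w2.
Proof.
move=> /arg_near1P [a1 [m1 [p1 e1]]] /arg_near1P [a2 [m2 [p2 e2]]].
move=> /arg_near1P [b1 [n1 [q1 f1]]] /arg_near1P [b2 [n2 [q2 f2]]].
rewrite {1}e1 {1}e2 {1}f1 {1}f2.
set A1 := arg_near1 z1 in a1 *; set A2 := arg_near1 z2 in a2 *.
set B1 := arg_near1 w1 in b1 *; set B2 := arg_near1 w2 in b2 *.
have -> : (m1 * cis A1 * (m2 * cis A2) = RtoC (m1 * m2) * cis (A1 + A2))%C.
  by rewrite cis_add RtoC_mult; ring.
have -> : (n1 * cis B1 * (n2 * cis B2) = RtoC (n1 * n2) * cis (B1 + B2))%C.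
  by rewrite cis_add RtoC_mult; ring.
have p := Rmult_lt_0_compat _ _ p1 p2; have q := Rmult_lt_0_compat _ _ q1 q2.
set m := m1 * m2 in p *; set k := n1 * n2 in q *.
move=> e; have mk : m = k.
  have := f_equal Cmod e; rewrite !Cmod_mult !Cmod_cis !Cmod_R !Rabs_pos_eq; lra.
rewrite mk in e.
have sc : sin (A1 + A2 - (B1 + B2)) = 0.
  have [ec es] : k * cos (A1 + A2) = k * cos (B1 + B2) /\ k * sin (A1 + A2) = k * sin (B1 + B2).
    move: e => [h1 h2]; split; lra.
  apply: (Rmult_eq_reg_l k); last lra.
  rewrite sin_minus Rmult_0_r Rmult_minus_distr_l -Rmult_assoc es.
  rewrite -Rmult_assoc ec; ring.
move: a1 a2 b1 b2 => /Rabs_def2 ? /Rabs_def2 ? /Rabs_def2 ? /Rabs_def2 ?.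
case: (Rtotal_order (A1 + A2) (B1 + B2)) => [h|[//|h]].
  have : 0 < sin (B1 + B2 - (A1 + A2)) by apply: sin_gt_0; lra.
  have -> : B1 + B2 - (A1 + A2) = - (A1 + A2 - (B1 + B2)) by ring.
  rewrite sin_neg sc; lra.
have : 0 < sin (A1 + A2 - (B1 + B2)) by apply: sin_gt_0; lra.
rewrite sc; lra.
Qed.

(** The total change of argument along the samples, without division by [2 * PI]. *)
Fixpoint winding (x : nat -> C) (N : nat) : R :=
  if N is N'.+1 then winding x N' + arg_near1 (x N / x N')%C else 0.

(** Going from [x k] to [y k.+1] through [y k] or through [x k.+1] changes the argument by the same
    amount; summed over [k], the transverse contributions telescope. *)
Lemma winding_homotopy (x y : nat -> C) (N : nat) :
  (forall k, x k <> 0) -> (forall k, y k <> 0) ->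
  (forall k, (k <= N)%coq_nat -> Cmod (y k / x k - 1)%C <= / 4) ->
  (forall k, (k < N)%coq_nat -> Cmod (x k.+1 / x k - 1)%C <= / 4) ->
  (forall k, (k < N)%coq_nat -> Cmod (y k.+1 / y k - 1)%C <= / 4) ->
  winding y N - winding x N = arg_near1 (y N / x N)%C - arg_near1 (y 0%nat / x 0%nat)%C.
Proof.
move=> x0 y0; elim: N => [|N IH] h1 h2 h3 /=; first by ring.
have {}IH := IH (fun k hk => h1 k (le_S _ _ hk)) (fun k hk => h2 k (le_S _ _ hk))
  (fun k hk => h3 k (le_S _ _ hk)).
have := @arg_near1_mul (y N.+1 / y N)%C (y N / x N)%C (y N.+1 / x N.+1)%C (x N.+1 / x N)%C
  (h3 N (le_n _)) (h1 N (le_S _ _ (le_n _))) (h1 N.+1 (le_n _)) (h2 N (le_n _)).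
have -> : (y N.+1 / y N * (y N / x N) = y N.+1 / x N.+1 * (x N.+1 / x N))%C.
  by field; split; [exact: x0 | split; [exact: x0 | exact: y0]].
by move/(_ erefl); lra.
Qed.

Lemma arg_near1_1 : arg_near1 1 = 0.
Proof. by rewrite /arg_near1 /Im /Re /= /Rdiv Rmult_0_l atan_0. Qed.

Lemma winding_const (c : C) (x : nat -> C) (N : nat) : c <> 0 ->
  (forall k, (k <= N)%coq_nat -> x k = c) -> winding x N = 0.
Proof.
move=> c0; elim: N => [//|N IH] H /=.
rewrite IH ?Rplus_0_l; last by move=> k hk; apply: H; exact: le_S.
rewrite !H; [|exact: le_S (le_n _)|exact: le_n].
have -> : (c / c = 1)%C by field.
exact: arg_near1_1.
Qed.

Lemma winding_pos (x : nat -> C) (N : nat) : (0 < N)%coq_nat ->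
  (forall k, (k < N)%coq_nat -> 0 < arg_near1 (x k.+1 / x k)%C) -> 0 < winding x N.
Proof.
case: N => [/Nat.lt_irrefl //|N] _ H.
have : 0 <= winding x N.
  elim: N H => [|N IH] H /=; first by right.
  apply: Rplus_le_le_0_compat; first by apply: IH => k hk; apply: H; exact: le_S.
  by left; apply: H; exact: le_S (le_n _).
by move=> h /=; have := H N (le_n _); lra.
Qed.

Lemma unif_cont_square (h : R * R -> C) (e : R) : 0 < e ->
  (let square p := unit_interval (fst p) /\ unit_interval (snd p) in
   continuous_on (T := prod_UniformSpace R_UniformSpace R_UniformSpace)
     (U := C_UniformSpace) square h) ->
  exists d, 0 < d /\ forall x y x' y', 0 <= x <= 1 -> 0 <= y <= 1 -> 0 <= x' <= 1 ->
    0 <= y' <= 1 -> Rabs (x - x') < d -> Rabs (y - y') < d ->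
    Cmod (h (x', y') - h (x, y))%C <= e.
Proof.
move=> e0 Hh.
(* The radius is doubled so that a neighbour of a point covered by [(u, v)] is covered as well. *)
pose P u v (d : posreal) := 0 <= u <= 1 -> 0 <= v <= 1 -> forall x y, 0 <= x <= 1 ->
  0 <= y <= 1 -> Rabs (x - u) < 2 * d -> Rabs (y - v) < 2 * d ->
  Cmod (h (x, y) - h (u, v))%C <= e / 2.
have HP u v : exists d, P u v d.
  case: (classic (0 <= u <= 1 /\ 0 <= v <= 1)) => [[Hu Hv]|bad]; last first.
    by exists (mkposreal 1 Rlt_0_1) => Hu Hv; case: bad.
  have e4 : 0 < e / 4 by lra.
  have [d Hd] := Hh (u, v) (conj Hu Hv) _
    (locally_ball (T := C_UniformSpace) (h (u, v)) (mkposreal _ e4)).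
  have d2 : 0 < d / 2 by have := cond_pos d; lra.
  exists (mkposreal _ d2) => _ _ x y Hx Hy /= hx hy.
  have [b1 b2] : ball (M := C_UniformSpace) (h (u, v)) (e / 4) (h (x, y)).
    apply: Hd; last by [].
    by split; rewrite /ball /= /AbsRing_ball /abs /minus /plus /opp /= -/(Rminus _ _); lra.
  move: b1 b2; rewrite /ball /= /AbsRing_ball /abs /minus /plus /opp /= -!/(Rminus _ _) => b1 b2.
  apply: Rle_trans (Cmod_le_abs _) _.
  by apply: Rle_trans (_ : e / 4 + e / 4 <= _); [apply: Rplus_le_compat; left | lra].
pose delta u v := epsilon (inhabits (mkposreal 1 Rlt_0_1)) (P u v).
have dP u v : P u v (delta u v) by exact: (epsilon_spec _ _ (HP u v)).
have [d Hd] := compactness_value_2d 0 1 0 1 delta.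
exists d; split; first exact: cond_pos.
move=> x y x' y' Hx Hy Hx' Hy' hx hy; apply: Rnot_gt_le => bad.
apply: (Hd x y Hx Hy) => -[u [v [Hu [Hv [xu [yv ds]]]]]].
have dp := cond_pos (delta u v).
have := dP u v Hu Hv x y Hx Hy ltac:(lra) ltac:(lra).
have hx' : Rabs (x' - u) < 2 * delta u v.
  have -> : x' - u = - (x - x') + (x - u) by ring.
  by apply: Rle_lt_trans (Rabs_triang _ _) _; rewrite Rabs_Ropp; lra.
have hy' : Rabs (y' - v) < 2 * delta u v.
  have -> : y' - v = - (y - y') + (y - v) by ring.
  by apply: Rle_lt_trans (Rabs_triang _ _) _; rewrite Rabs_Ropp; lra.
have := dP u v Hu Hv x' y' Hx' Hy' hx' hy'.
have := Cmod_triangle (h (x', y') - h (u, v))%C (- (h (x, y) - h (u, v)))%C.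
rewrite Cmod_opp.
have -> : (h (x', y') - h (u, v) + - (h (x, y) - h (u, v)) = h (x', y') - h (x, y))%C by ring.
lra.
Qed.

(** With a larger width, the circle of [circle_in_domain] would be null-homotopic in [U], where all
    moduli exceed [a]. On a fine mesh the winding is the same for all rows of the homotopy, yet it
    is positive on the circle and zero on the constant loop. *)
Lemma simply_connected_width (a tmin tmax : R) : 0 < a ->
  simply_connected (domainU a tmin tmax) -> tmax - tmin <= PI.
Proof.
move=> a0 [_ sc]; apply: Rnot_gt_le => w.
have pi := PI_RGT_0.
have [r [r0 Hr]] := circle_in_domain a0 w.
pose g (t : R) := (r * cexp (t * (RtoC (2 * PI) * Ci)))%C.
have gE (t : R) : g t = (r * cis (2 * PI * t))%C.
  rewrite /g; have -> : (t * (RtoC (2 * PI) * Ci) = 0 + RtoC (2 * PI * t) * Ci)%C.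
    by rewrite !RtoC_mult; ring.
  by rewrite cexp_cis exp_0 Cmult_1_l.
have g01 : g 0 = g 1.
  by rewrite !gE Rmult_0_r Rmult_1_r cis_0 /cis cos_2PI sin_2PI.
have gp : path_in (domainU a tmin tmax) g.
  split; last by move=> t _; rewrite gE; exact: Hr.
  move=> t _; apply: filterlim_filter_le_1 (filter_le_within _) _.
  pose v := (RtoC (2 * PI) * Ci)%C.
  apply: (@rdiff_continuous _ _ (r * cexp (0 + t * v) * v)%C).
  apply: (rdiff_ext (u := fun s => (r * cexp (0 + s * v))%C)).
    by move=> s; rewrite Cplus_0_l.
  exact: (cdiff_rdiff (cdiff_scal r (cdiff_cexp _))).
have [h [hc hU h01 hst]] := sc g gp g01.
(* As moduli exceed [a], neighbours within [a / 4] have a quotient within [/ 4] of 1. *)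
have [d [d0 Hd]] := unif_cont_square (ltac:(lra) : 0 < a / 4) hc.
(* A mesh below [/ 8] keeps the angle of one step on the circle below [PI / 2]. *)
have m0 : 0 < Rmin d (/ 8) by apply: Rmin_pos; lra.
have [N [N0d N0p]] := archimed_cor1 _ m0.
have Np : 0 < INR N by apply: lt_0_INR.
have Nd : / INR N < d by apply: Rlt_le_trans N0d (Rmin_l _ _).
have N8 : / INR N < / 8 by apply: Rlt_le_trans N0d (Rmin_r _ _).
(* The cap at 1 keeps mesh points in the square for every index. *)
pose q k := Rmin 1 (INR k / INR N).
have q01 k : 0 <= q k <= 1.
  split; last exact: Rmin_l.
  by apply: Rmin_glb; [lra | apply: Rdiv_le_0_compat => //; exact: pos_INR].
have qS k : Rabs (q k - q k.+1) < d.
  have dS : INR k.+1 / INR N = INR k / INR N + / INR N by rewrite S_INR; field; lra.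
  have iN : 0 < / INR N by exact: Rinv_0_lt_compat.
  rewrite /q dS /Rmin; do 2!case: Rle_dec => ?; apply: Rabs_def1; lra.
have q0 : q 0%nat = 0 by rewrite /q /= /Rdiv Rmult_0_l Rmin_right; lra.
have qN : q N = 1 by rewrite /q /Rdiv Rinv_r ?Rmin_left; lra.
pose x i k := h (q i, q k).
have xU i k : domainU a tmin tmax (x i k) by apply: hU; split; exact: q01.
have xa i k : a < Cmod (x i k) by exact: domainU_Cmod (xU i k).
have x0 i k : x i k <> 0.
  by move=> e; have := xa i k; rewrite e Cmod_0; lra.
have ratio (u v : C) : u <> 0 -> a < Cmod u -> Cmod (v - u)%C <= a / 4 ->
    Cmod (v / u - 1)%C <= / 4.
  move=> u0 ua vu; have -> : (v / u - 1 = (v - u) / u)%C by field.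
  rewrite Cmod_div //; apply/Rle_div_l; lra.
have dd : Rabs (q 0%nat - q 0%nat) < d by rewrite Rminus_diag_eq // Rabs_R0.
have r1 i k : Cmod (x i k.+1 / x i k - 1)%C <= / 4.
  apply: ratio => //; apply: Hd => //.
  by rewrite Rminus_diag_eq // Rabs_R0.
have r2 i k : Cmod (x i.+1 k / x i k - 1)%C <= / 4.
  apply: ratio => //; apply: Hd => //.
  by rewrite Rminus_diag_eq // Rabs_R0.
have W i : winding (x i) N = winding (x 0%nat) N.
  elim: i => [//|i <-].
  have := @winding_homotopy (x i) (x i.+1) N (x0 i) (x0 i.+1) (fun k _ => r2 i k)
    (fun k _ => r1 i k) (fun k _ => r1 i.+1 k).
  have e0 j : x j 0%nat = g 0 by rewrite /x q0; exact: (proj1 (hst _ (q01 j))).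
  have e1 j : x j N = g 0 by rewrite /x qN; exact: (proj2 (hst _ (q01 j))).
  rewrite !e0 !e1; lra.
have WN : winding (x N) N = 0.
  apply: (@winding_const (g 0)) => [|k _].
    by have := x0 0%nat 0%nat; rewrite /x q0 (proj1 (hst 0 _)) //; have := q01 0%nat; rewrite q0.
  by rewrite /x qN; exact: (proj2 (h01 _ (q01 k))).
have : 0 < winding (x 0%nat) N; last by rewrite -(W N) WN; lra.
apply: winding_pos => // k hk.
have iN : 0 < / INR N by exact: Rinv_0_lt_compat.
have qk j : (j <= N)%coq_nat -> q j = INR j / INR N.
  by move=> hj; rewrite /q Rmin_right //; apply/(Rle_div_l _ _ _ Np); rewrite Rmult_1_l; exact: le_INR.
have xk j : (j <= N)%coq_nat -> x 0%nat j = (r * cis (2 * PI * (INR j / INR N)))%C.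
  by move=> hj; rewrite /x q0 (proj1 (h01 _ (q01 j))) gE qk.
rewrite (xk k) ?(xk k.+1) //; last exact: Nat.lt_le_incl.
have -> : 2 * PI * (INR k.+1 / INR N) = 2 * PI * / INR N + 2 * PI * (INR k / INR N).
  by rewrite S_INR; field; lra.
set al := 2 * PI * / INR N.
have cn t : cis t <> 0 by move=> e; have := Cmod_cis t; rewrite e Cmod_0; lra.
rewrite cis_add.
have -> : (r * (cis al * cis (2 * PI * (INR k / INR N))) / (r * cis (2 * PI * (INR k / INR N)))
   = cis al)%C.
  by field; split; [exact: cn | move/RtoC_inj; lra].
have al0 : 0 < al by apply: Rmult_lt_0_compat; lra.
have al1 : al < PI / 2.
  have : 2 * PI * / INR N < 2 * PI * / 8 by apply: Rmult_lt_compat_l; lra.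
  rewrite /al; lra.
rewrite /arg_near1 /cis /Im /Re /= -atan_0; apply: atan_increasing.
by apply: Rdiv_lt_0_compat; [apply: sin_gt_0 | apply: cos_gt_0]; lra.
Qed.

(** * Exponential gauge and the hypotheses on the coefficients *)

Lemma analytic_mholo n (U : C -> Prop) (M : C -> 'M[C]_n) :
  analytic_on U M -> mholo U M.
Proof.
move=> H; apply/mholo_entries => i j z Uz.
by have [l Hl] := H z Uz i j; exists l; apply/is_derive_cdiff.
Qed.

(** A row vector killed by [1 + F] satisfies [v = - v F], so its l^1 norm is at most [mxnorm F]
    times itself. *)
Lemma unitmx_1D n (F : 'M[C]_n) : mxnorm F < 1 -> (1%:M + F)%R \in unitmx.
Proof.
move=> HF; rewrite -row_free_unit -kermx_eq0; apply/negPn/negP => /rowV0Pn [v /sub_kermxP vF v0].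
pose S : R := (\sum_(j < n) Cmod (v ord0 j))%R.
have vj j : v ord0 j = (- \sum_(i < n) v ord0 i * F i j)%R.
  have := f_equal (fun A : 'rV[C]_n => A ord0 j) vF.
  rewrite mulmxDr mulmx1 !mxE => /eqP; by rewrite GRing.addr_eq0 => /eqP ->.
have S0 : 0 < S.
  have [j vj0] : exists j, v ord0 j <> RtoC 0.
    apply: NNPP => bad; move/eqP: v0; apply; apply/rowP => j; rewrite mxE.
    by apply: NNPP => h; apply: bad; exists j.
  apply: Rlt_le_trans (Rsum_term (f := fun j => Cmod (v ord0 j)) j _); first exact/Cmod_gt_0.
  by move=> k; exact: Cmod_ge_0.
have SF : S <= mxnorm F * S.
  have -> : mxnorm F * S = (\sum_(i < n) (mxnorm F * Cmod (v ord0 i))%R)%R.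
    by rewrite -GRing.mulr_sumr.
  apply: Rle_trans (_ : (\sum_(j < n) \sum_(i < n) (Cmod (v ord0 i) * Cmod (F i j))%R)%R <= _).
    apply: Rsum_le => j; rewrite {1}vj.
    rewrite -[X in Cmod X]/(Copp _) Cmod_opp; apply: Rle_trans (Cmod_sum _) _.
    by apply: Rsum_le => i; right; exact: Cmod_mult.
  rewrite exchange_big; apply: Rsum_le => i /=; rewrite -GRing.mulr_sumr GRing.mulrC.
  apply: Rmult_le_compat_r; first exact: Cmod_ge_0.
  apply: (Rsum_term (f := fun i => (\sum_(j < n) Cmod (F i j))%R)) => a.
  by apply: Rsum_ge0 => b; exact: Cmod_ge_0.
nra.
Qed.

Lemma exp_diag_mull n (v : 'I_n -> C) (A : 'M[C]_n) (i j : 'I_n) :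
  (exp_diag v *m A)%R i j = (cexp (v i) * A i j)%C.
Proof. by rewrite /exp_diag mul_diag_mx !mxE. Qed.

Lemma exp_diag_mulr n (v : 'I_n -> C) (A : 'M[C]_n) (i j : 'I_n) :
  (A *m exp_diag v)%R i j = (A i j * cexp (v j))%C.
Proof. by rewrite /exp_diag mul_mx_diag !mxE. Qed.

Lemma exp_diag_opp n (v : 'I_n -> C) :
  (exp_diag (fun i => - v i)%C *m exp_diag v = 1%:M)%R.
Proof.
apply/matrixP => i j; rewrite exp_diag_mulr !mxE.
case: (eqVneq i j) => [->|_]; first by rewrite !GRing.mulr1n cexp_opp_l.
by rewrite !GRing.mulr0n Cmult_0_l.
Qed.

Lemma exp_diag_unit n (v : 'I_n -> C) : exp_diag v \in unitmx.
Proof. by have [] := mulmx1_unit (exp_diag_opp v). Qed.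

Lemma Cmod_continuous (u : R -> C) (t : R) (l : C) : rdiff u t l ->
  continuous (fun s => Cmod (u s)) t.
Proof.
move=> H; apply: (continuous_ext (fun s => norm (u s : C_R_NormedModule))).
  by move=> s; rewrite Cmod_norm.
apply: (continuous_comp (V := C_R_NormedModule) u norm).
  exact: rdiff_continuous H.
exact: (filterlim_norm (V := C_R_NormedModule)).
Qed.

Lemma Rsum_continuous n (f : 'I_n -> R -> R) (t : R) :
  (forall i, continuous (f i) t) -> continuous (fun s => (\sum_(i < n) f i s)%R) t.
Proof.
elim: n f => [|n IH] f H.
  apply: (continuous_ext (fun=> 0)); first by move=> s; rewrite big_ord0.
  exact: continuous_const.
apply: (continuous_ext (fun s => plus (f ord0 s) (\sum_(i < n) f (lift ord0 i) s)%R)).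
  by move=> s; rewrite big_ord_recl.
by apply: (continuous_plus (V := R_NormedModule)); [exact: H | apply: IH => i; exact: H].
Qed.

Lemma mxnorm_line_continuous n (a tau d s : R) (M : C -> 'M[C]_n) :
  mholo (half_plane a tau) M -> a < d ->
  continuous (fun s => mxnorm (M (line_pt tau d s))) s.
Proof.
move=> HM Hd; have [L HL] := HM _ (on_line_half Hd (on_line_pt tau d s)).
apply: Rsum_continuous => i; apply: Rsum_continuous => j.
apply: (@Cmod_continuous _ _ (L i j * cis tau)%C).
apply: (rdiff_ext (u := fun s => M (line_pt tau d 0 + s * cis tau)%C i j)).
  by move=> u; rewrite -line_ptE.
by apply: (cdiff_rdiff (f := fun w => M w i j)); rewrite -line_ptE; exact: HL.
Qed.

(** The integrand being nonnegative, the integral over a bounded window grows with the window;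
    enlarged far enough, it is within [eps - l] of the improper integral [l], hence below [eps]. *)
Lemma good_decay_bound n (a tmin tmax : R) (M : C -> 'M[C]_n) :
  mholo (domainU a tmin tmax) M -> good_decay a tmin tmax M ->
  forall eps, 0 < eps -> exists D, forall tau d, tmin < tau < tmax -> a < d -> D < d ->
    line_bound (fun z => mxnorm (M z)) tau d eps.
Proof.
move=> HM [HL1 Hdec] eps He; have [D HD] := Hdec eps He.
exists D => tau d Ht ad Dd.
have HMt : mholo (half_plane a tau) M by move=> z Hz; apply: HM; exact: half_domainU Hz.
pose f s := mxnorm (M (line_pt tau d s)).
have cf s : continuous f s by exact: mxnorm_line_continuous ad.
have ex u v : ex_RInt f u v by apply: ex_RInt_continuous => z _; exact: cf.
have f0 s : 0 <= f s by exact: mxnorm_ge0.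
have pos u v : u <= v -> 0 <= RInt f u v by move=> uv; apply: RInt_ge_0.
have Ch u v w : RInt f u v + RInt f v w = RInt f u w.
  exact: (RInt_Chasles f u v w (ex u v) (ex v w)).
exists (fun s => RInt f 0 s); split.
  move=> s; apply: (is_derive_RInt f _ 0 s); last exact: cf.
  by apply: filter_forall => u; apply: RInt_correct.
move=> s t st.
have -> : RInt f 0 t - RInt f 0 s = RInt f s t by rewrite -(Ch 0 s t); ring.
split; first exact: pos.
have := HD tau d (conj Ht ad) Dd; rewrite /L1_norm_on_line -/f; set l : R := RInt_gen _ _ _ => le.
have I : is_RInt_gen f (Rbar_locally m_infty) (Rbar_locally p_infty) l.
  have proper x : ProperFilter' (Rbar_locally x).
    exact: Proper_StrongProper (Rbar_locally_filter x).
  exact: (@RInt_gen_correct R_CompleteNormedModule _ _ (proper _) (proper _) f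
    (HL1 tau d (conj Ht ad))).
have el : 0 < eps - l by lra.
have [P Q [S1 HP] [S2 HQ] HPQ] := I _ (locally_ball l (mkposreal _ el)).
pose u := Rmin s (S1 - 1); pose v := Rmax t (S2 + 1).
have us : u <= s by exact: Rmin_l.
have tv : t <= v by exact: Rmax_l.
have Pu : P u by apply: HP; have := Rmin_r s (S1 - 1); rewrite -/u; lra.
have Qv : Q v by apply: HQ; have := Rmax_r t (S2 + 1); rewrite -/v; lra.
have [y [Iy By]] := HPQ u v Pu Qv.
have ey : RInt f u v = y by exact: is_RInt_unique Iy.
have {}By : Rabs (y - l) < eps - l := By.
rewrite -ey in By; have {}By := Rabs_def2 _ _ By.
have := pos _ _ us; have := pos _ _ tv.
have := Ch u s v; have := Ch s t v; lra.
Qed.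

(** A lower bound says that [Re (P i - P j)] drops by a bounded amount when a line is followed
    forwards, an upper bound says so backwards. The sign depends on [(i, j)] but not on the line,
    because the L-condition bounds all lines together. *)
Lemma L_condition_sign n (a tmin tmax : R) (Lam : C -> 'M[C]_n) (P : 'I_n -> C -> C) :
  mholo (domainU a tmin tmax) Lam ->
  (forall i z, domainU a tmin tmax z -> cdiff (P i) z (Lam z i i)) ->
  L_condition a tmin tmax Lam -> forall i j, exists sigma M,
  [/\ sigma = 1 \/ sigma = -1, 0 <= M &
    forall tau z s, tmin < tau < tmax -> half_plane a tau z -> 0 <= s ->
      Re (P i z - P j z)%C
      - Re (P i (z + s * (sigma * cis tau)) - P j (z + s * (sigma * cis tau)))%C <= M].
Proof.
move=> HL HP HLc i j.
case: (eqVneq i j) => [->|ij].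
  exists 1, 0; split; [by left | by right | move=> tau z s _ _ _].
  by right; rewrite /Re /=; ring.
pose f w := (Lam w i i - Lam w j j)%C.
have seg tau z s : tmin < tau < tmax -> half_plane a tau z -> 0 <= s ->
    L_set a tmin tmax Lam i j
      (Re (P i (z + s * cis tau) - P j (z + s * cis tau) - (P i z - P j z)))%C.
  move=> Ht Hz Hs; exists z, (z + s * cis tau)%C; split.
    exists tau, (Im (cis (- tau) * z)%C), (Re (cis (- tau) * z)%C),
      (Re (cis (- tau) * z)%C + s); split=> //; first by lra.
      exact: line_pt_of.
    by rewrite -line_pt_move -line_pt_of.
  congr Re; symmetry.
  have inU t : unit_interval t -> domainU a tmin tmax (segment_pt z (z + s * cis tau)%C t).
    move=> Ht'; apply: (half_domainU Ht); rewrite /half_plane.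
    have -> : segment_pt z (z + s * cis tau) t = (z + RtoC (t * s) * cis tau)%C.
      by rewrite /segment_pt RtoC_mult; ring.
    by rewrite line_move.
  apply: (segment_int_ftc (F := fun w => P i w - P j w)%C) => t Ht'.
    exact: cdiff_minus (HP i _ (inU t Ht')) (HP j _ (inU t Ht')).
  have [L HL'] := HL _ (inU t Ht').
  by exists (L i i - L j j)%C; exact: cdiff_minus (HL' i i) (HL' j j).
case: (HLc i j ij) => -[M HM].
  exists (-1), (Rabs M); split; [by right | exact: Rabs_pos | move=> tau z s Ht Hz Hs].
  set z1 := (z + s * (RtoC (-1) * cis tau))%C.
  have Hz1 : half_plane a tau z1.
    rewrite /half_plane /z1; have -> : (s * (RtoC (-1) * cis tau) = RtoC (- s) * cis tau)%C.
      by rewrite RtoC_opp /RtoC; apply: injective_projections => /=; ring.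
    by rewrite line_move.
  have := HM _ (seg tau z1 s Ht Hz1 Hs).
  have -> : (z1 + s * cis tau = z)%C.
    by rewrite /z1; apply: injective_projections => /=; ring.
  have := Rle_abs M; rewrite /Re /=; lra.
exists 1, (Rabs M); split; [by left | exact: Rabs_pos | move=> tau z s Ht Hz Hs].
have := HM _ (seg tau z s Ht Hz Hs).
have -> : (RtoC 1 * cis tau = cis tau)%C by ring.
have := Rle_abs (- M); rewrite Rabs_Ropp /Re /=; lra.
Qed.

(** The best direction is [th - PI / 2], perpendicular to the point; clamped to the range from
    [alpha - dl] to [beta + dl], it stays admissible and [th - tau] stays between [dl] and
    [PI - dl]. *)
Lemma sector_line (tmin tmax alpha beta : R) : tmin < alpha -> alpha <= beta -> beta < tmax ->
  exists k, 0 < k /\ forall z, in_sector alpha beta z ->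
    exists tau, tmin < tau < tmax /\ k * Cmod z <= Im (cis (- tau) * z)%C.
Proof.
move=> h1 h2 h3; have pi := PI_RGT_0.
pose dl := Rmin (Rmin ((alpha - tmin) / 2) ((tmax - beta) / 2)) (PI / 2).
have d0 : 0 < dl by rewrite /dl; repeat apply: Rmin_pos; lra.
have d1 : dl <= PI / 2 by exact: Rmin_r.
have d2 : dl <= (alpha - tmin) / 2 by apply: Rle_trans (Rmin_l _ _) (Rmin_l _ _).
have d3 : dl <= (tmax - beta) / 2 by apply: Rle_trans (Rmin_l _ _) (Rmin_r _ _).
exists (sin dl); split; first by apply: sin_gt_0; lra.
move=> z [r [th [r0 Hth ->]]].
have [tau [Ht Hd]] : exists tau, tmin < tau < tmax /\ dl <= th - tau <= PI - dl.
  case: (Rle_dec (th - PI / 2) (alpha - dl)) => c1.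
    by exists (alpha - dl); lra.
  case: (Rle_dec (beta + dl) (th - PI / 2)) => c2.
    by exists (beta + dl); lra.
  by exists (th - PI / 2); lra.
exists tau; split=> //.
have -> : Im (cis (- tau) * (r * cis th))%C = r * sin (th - tau).
  have -> : (cis (- tau) * (r * cis th) = r * cis (th - tau))%C.
    by rewrite /Rminus cis_add; ring.
  by rewrite /cis /Im /=; ring.
rewrite Cmod_mult Cmod_cis Cmod_R Rabs_pos_eq; last lra.
rewrite Rmult_1_r Rmult_comm; apply: Rmult_le_compat_l; first lra.
case: (Rle_dec (th - tau) (PI / 2)) => c; first by apply: sin_incr_1; lra.
by rewrite -(sin_PI_x (th - tau)); apply: sin_incr_1; lra.
Qed.

(** * Existence *)

Lemma gsum_shift (a : nat -> C) (V : R) : (forall k, Cmod (a k.+1) <= V / 2 ^ k) ->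
  Cmod (gsum a - a 0%nat)%C <= 4 * V.
Proof.
move=> H; pose b k := a k.+1.
have Hb := gsumP (a := b) H.
have V0 : 0 <= V by have := Rle_trans _ _ _ (Cmod_ge_0 _) (H 0%nat); rewrite /= Rdiv_1_r.
have b0 : Cmod (gsum b) <= 4 * V.
  by have := Hb 0%nat; rewrite big_ord0 GRing.subr0 /= Rdiv_1_r.
have -> : gsum a = (a 0%nat + gsum b)%C.
  apply: (@gsum_unique _ _ (Cmod (a 0%nat) + 8 * V)) => -[|N].
    rewrite big_ord0 GRing.subr0 /= Rdiv_1_r; apply: Rle_trans (Cmod_triangle _ _) _; lra.
  rewrite big_ord_recl.
  have -> : (a 0%nat + gsum b - (a (@ord0 N : nat) + \sum_(i < N) a (lift ord0 i)))%R =
     (gsum b - \sum_(i < N) b i)%R.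
    by rewrite /b GRing.opprD GRing.addrACA GRing.subrr GRing.add0r.
  apply: Rle_trans (Hb N) _; rewrite div_pow2_S.
  have p : 0 < / 2 ^ N by apply: Rinv_0_lt_compat; apply: pow_lt; lra.
  have := Rmult_le_pos _ _ (Cmod_ge_0 (a 0%nat)) (Rlt_le _ _ p).
  rewrite /Rdiv; lra.
by have -> : (a 0%nat + gsum b - a 0%nat = gsum b)%C by ring.
Qed.

(** * The solution far from the origin *)

Section FarSolution.

Variables (n : nat) (D tmin tmax M E0 : R) (Rm : C -> 'M[C]_n) (P : 'I_n -> C -> C).
Let U := domainU D tmin tmax.
Let rho z := mxnorm (Rm z).

Definition gauged (z : C) : 'M[C]_n :=
  (\matrix_(i, j) (cexp (- (P i z - P j z))%C * Rm z i j)%R)%R.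

Hypotheses (D0 : 0 < D) (lt_t : tmin < tmax) (width : tmax - tmin <= PI).
Hypotheses (HR : mholo U Rm) (HP : forall i, holo_on U (P i)).
Variable sigma : 'I_n -> 'I_n -> R.
Hypothesis sigma1 : forall i j, sigma i j = 1 \/ sigma i j = -1.
Hypothesis Hsigma : forall i j tau z s, tmin < tau < tmax -> half_plane D tau z -> 0 <= s ->
  Re (P i z - P j z)%C - Re (P i (z + s * (sigma i j * cis tau))
                            - P j (z + s * (sigma i j * cis tau)))%C <= M.
Hypothesis HE : forall tau d, tmin < tau < tmax -> D < d -> line_bound rho tau d E0.
Hypothesis HE0 : exp M * E0 <= / 2.

Let weight i j z := exp (- Re (P i z - P j z)%C).

Lemma gauged_holo : mholo U gauged.
Proof.
apply/mholo_entries => i j z Uz.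
have [L HL] := HR Uz; have [l Hl] := HP i Uz; have [m Hm] := HP j Uz.
eexists; apply: (cdiff_ext (f := fun w => (cexp (- (1) * (P i w - P j w)) * Rm w i j)%C)).
  by move=> w; rewrite mxE; congr (cexp _ * _)%R; ring.
apply: cdiff_mult (HL i j).
apply: cdiff_comp (cdiff_cexp _).
exact: cdiff_scal (cdiff_minus Hl Hm).
Qed.

(** Since [weight i j = weight i l * weight l j], every summand of the product carries the same
    weight, and the sum over [l] involves only a row of [Rm]. *)
Lemma gauged_mul_bound (k : nat) (Phi : 'M[C]_n) (z : C) (i j : 'I_n) :
  (forall i j, Cmod (Phi i j) <= weight i j z / 2 ^ k) ->
  Cmod ((gauged z *m Phi)%R i j) <= weight i j z / 2 ^ k * rho z.
Proof.
move=> H; rewrite mxE; apply: Rle_trans (Cmod_sum _) _.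
have p : 0 < 2 ^ k by apply: pow_lt; lra.
pose c := weight i j z / 2 ^ k.
apply: Rle_trans (_ : (\sum_(l < n) (c * Cmod (Rm z i l)))%R <= _).
  apply: Rsum_le => l; rewrite mxE -[X in Cmod X]/(Cmult (Cmult _ _) _).
  rewrite Cmod_mult (Cmod_mult (cexp _)) Cmod_cexp.
  change (exp (- Re (P i z - P l z)%C) * Cmod (Rm z i l) * Cmod (Phi l j) <= c * Cmod (Rm z i l)).
  have e : weight i j z = weight i l z * weight l j z.
    by rewrite /weight -exp_plus; congr exp; rewrite /Re /=; ring.
  apply: Rle_trans (Rmult_le_compat_l _ _ _ _ (H l j)) _.
    by apply: Rmult_le_pos; [exact: Rlt_le (exp_pos _) | exact: Cmod_ge_0].
  by right; rewrite /c e -/(weight i l z) /Rdiv; ring.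
rewrite -GRing.mulr_sumr; apply: Rmult_le_compat_l.
  by apply: Rdiv_le_0_compat => //; exact: Rlt_le (exp_pos _).
apply: (Rsum_term (f := fun i => (\sum_(j < n) Cmod (Rm z i j))%R)) => a.
by apply: Rsum_ge0 => b; exact: Cmod_ge_0.
Qed.

Definition far_bounded (k : nat) (Phi : C -> 'M[C]_n) : Prop := mholo U Phi /\
  forall z, U z -> forall i j, Cmod (Phi z i j) <= weight i j z / 2 ^ k.

(** Taken with [e = E0], the bound gives the gain of a factor 2 at each step; taken with the smaller
    [e] of a remote line, it gives the o(1). *)
Definition far_next (k : nat) (Phi Psi : C -> 'M[C]_n) : Prop :=
  (forall z, U z -> mdiff Psi z (gauged z *m Phi z)%R) /\
  forall tau z e, tmin < tau < tmax -> half_plane D tau z ->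
    line_bound rho tau (Im (cis (- tau) * z)%C) e ->
    forall i j, Cmod (Psi z i j) <= exp M * weight i j z / 2 ^ k * e.

(** Entries are integrated separately, as the end [sigma i j] varies with them. From [z] towards
    that end the weight grows at most by the factor [exp M], which lets it be frozen at [z]. *)
Lemma far_next_ex (k : nat) (Phi : C -> 'M[C]_n) : far_bounded k Phi ->
  exists Psi, far_next k Phi Psi.
Proof.
move=> [HPhi BPhi].
have p : 0 < 2 ^ k by apply: pow_lt; lra.
pose Prop_ij i j (Q : C -> C) :=
  (forall z, U z -> cdiff Q z ((gauged z *m Phi z)%R i j)) /\
  forall tau z e, tmin < tau < tmax -> half_plane D tau z ->
    line_bound rho tau (Im (cis (- tau) * z)%C) e ->
    Cmod (Q z) <= exp M * weight i j z / 2 ^ k * e.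
have ex i j : exists Q, Prop_ij i j Q.
  apply: (ray_primitive (c := fun z => exp M * weight i j z / 2 ^ k) D0 lt_t width (sigma1 i j) _ _ _ HE).
  - exact: (proj2 (mholo_entries _ _) (mholo_mulmx gauged_holo HPhi)).
  - move=> z; apply: Rdiv_le_0_compat => //; apply: Rmult_le_pos; exact: Rlt_le (exp_pos _).
  - move=> tau z s Ht Hz Hs; set w := (z + _)%C.
    have Hw : half_plane D tau w by exact: ray_in.
    have Uw : U w by exact: half_domainU Hw.
    apply: Rle_trans (gauged_mul_bound i j (BPhi w Uw)) _.
    apply: Rmult_le_compat_r; first exact: mxnorm_ge0.
    apply: Rmult_le_compat_r; first by apply: Rlt_le; exact: Rinv_0_lt_compat.
    rewrite /weight -exp_plus; apply: exp_le.
    by have := Hsigma i j Ht Hz Hs; rewrite -/w; lra.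
pose Q i j := epsilon (inhabits ((fun=> RtoC 0) : C -> C)) (Prop_ij i j).
have HQ i j : Prop_ij i j (Q i j) by exact: (epsilon_spec _ _ (ex i j)).
exists (fun z => \matrix_(i, j) Q i j z)%R; split.
  move=> z Uz i j; apply: (cdiff_ext (f := Q i j)); first by move=> w; rewrite mxE.
  exact: (proj1 (HQ i j)).
by move=> tau z e Ht Hz He i j; rewrite mxE; exact: (proj2 (HQ i j)) Ht Hz He.
Qed.

Lemma far_next_bounded (k : nat) (Phi Psi : C -> 'M[C]_n) : far_next k Phi Psi ->
  far_bounded k.+1 Psi.
Proof.
move=> [dPsi BPsi]; split; first by move=> z Uz; eexists; exact: dPsi.
move=> z /domainU_half [tau [Ht Hz]] i j.
apply: Rle_trans (BPsi tau z E0 Ht Hz (HE Ht Hz) i j) _.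
have p : 0 < / 2 ^ k by apply: Rinv_0_lt_compat; apply: pow_lt; lra.
have wp : 0 < weight i j z by exact: exp_pos.
rewrite div_pow2_S /Rdiv.
have := Rmult_le_compat_l _ _ _ (Rlt_le _ _ (Rmult_lt_0_compat _ _ wp p)) HE0.
lra.
Qed.

Fixpoint far_iter (k : nat) : C -> 'M[C]_n :=
  if k is k'.+1 then epsilon (inhabits ((fun=> 0%R) : C -> 'M[C]_n)) (far_next k' (far_iter k'))
  else fun=> 1%:M%R.

Lemma far_iter_bounded (k : nat) : far_bounded k (far_iter k).
Proof.
elim: k => [|k IH].
  split; first by move=> z _; eexists; exact: mdiff_const.
  move=> z _ i j; rewrite /= mxE Rdiv_1_r.
  case: (eqVneq i j) => [->|_].
    rewrite GRing.mulr1n Cmod_1 /weight; right.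
    by have -> : (P j z - P j z = 0)%C by [ring]; rewrite /= Ropp_0 exp_0.
  rewrite GRing.mulr0n Cmod_0; exact: Rlt_le (exp_pos _).
exact: far_next_bounded (epsilon_spec _ _ (far_next_ex IH)).
Qed.

Lemma far_iterS (k : nat) : far_next k (far_iter k) (far_iter k.+1).
Proof. exact: (epsilon_spec _ _ (far_next_ex (far_iter_bounded k))). Qed.

(** Every iterate after the identity carries the factor [e], hence so does the deviation of the sum
    from the identity. For differentiability the weights are bounded by a constant near each
    point. *)
Lemma far_solution : exists X : C -> 'M[C]_n,
  (forall z, U z -> mdiff X z (gauged z *m X z)%R) /\
  forall tau z e, tmin < tau < tmax -> half_plane D tau z ->
    line_bound rho tau (Im (cis (- tau) * z)%C) e ->
    forall i j, Cmod (X z i j - (1%:M : 'M[C]_n)%R i j)%C <= 4 * (exp M * weight i j z * e).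
Proof.
exists (fun z => \matrix_(i, j) gsum (fun k => far_iter k z i j))%R; split; last first.
  move=> tau z e Ht Hz He i j; rewrite mxE.
  apply: (@gsum_shift (fun k => far_iter k z i j)) => k.
  apply: Rle_trans (proj2 (far_iterS k) tau z e Ht Hz He i j) _.
  by right; rewrite /Rdiv; ring.
move=> z Uz.
have [tau [Ht Hz]] := proj1 (domainU_half _ _ _ _) Uz.
have [r0 [r0p Hr0]] := half_plane_open Hz.
have HPm : mholo U (fun w => \matrix_(i, j) (P i w - P j w)%C)%R.
  apply/mholo_entries => i j w Uw.
  have [l Hl] := HP i Uw; have [m Hm] := HP j Uw.
  exists (l - m)%C; apply: (cdiff_ext (f := fun w => (P i w - P j w)%C)).
    by move=> u; rewrite mxE.
  exact: cdiff_minus.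
have [r1 [K [r1p HK]]] := mholo_bound HPm Uz.
have [r2 [K2 [r2p HK2]]] := mholo_bound gauged_holo Uz.
pose r := Rmin (Rmin r0 r1) r2.
have rp : 0 < r by repeat apply: Rmin_pos.
have rr h : Cmod h < r -> Cmod h < r0 /\ Cmod h < r1 /\ Cmod h < r2.
  have := Rmin_l (Rmin r0 r1) r2; have := Rmin_r (Rmin r0 r1) r2.
  have := Rmin_l r0 r1; have := Rmin_r r0 r1; rewrite -/r; lra.
have inU h : Cmod h < r -> U (z + h)%C.
  by move=> /rr [h0 _]; apply: (half_domainU Ht); exact: Hr0.
have bound k h : Cmod h < r -> forall i j, Cmod (far_iter k (z + h)%C i j) <= exp K / 2 ^ k.
  move=> hr i j; have [h0 [h1 h2]] := rr h hr.
  apply: Rle_trans (proj2 (far_iter_bounded k) _ (inU h hr) i j) _.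
  apply: Rmult_le_compat_r; first by apply: Rlt_le; apply: Rinv_0_lt_compat; apply: pow_lt; lra.
  apply: exp_le; have := HK h h1 i j; rewrite mxE.
  set w := (P i _ - P j _)%C => hw.
  by have := Rle_trans _ _ _ (re_le_Cmod w) hw => /Rabs_le_between; lra.
apply: (@neumann_series n gauged _ far_iter z r (exp K) (4 * exp K) K2 rp).
- by move=> h hr; apply: HK2; have [_ [_ h2]] := rr h hr.
- exact: bound.
- by move=> h _; exact: mdiff_const.
- by move=> k h hr; apply: (proj1 (far_iterS k)); exact: inU.
- by move=> h hr i j N; rewrite mxE; apply: gsumP => k; exact: bound.
Qed.

End FarSolution.

Lemma exp_diag_ext n (u v : 'I_n -> C) : (forall i, u i = v i) -> exp_diag u = exp_diag v.
Proof. by move=> e; apply/matrixP => i j; rewrite !mxE e. Qed.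

Lemma gauge_mdiff n (Lam : 'M[C]_n) (P : 'I_n -> C -> C) (z : C) : is_diag_mx Lam ->
  (forall i, cdiff (P i) z (Lam i i)) ->
  mdiff (fun w => exp_diag (fun i => P i w)) z (Lam *m exp_diag (fun i => P i z))%R.
Proof.
move=> /is_diag_mxP HL HP i j; rewrite exp_diag_mulr.
case: (eqVneq i j) => [<-|ij].
  apply: (cdiff_ext (f := fun w => cexp (P i w))).
    by move=> w; rewrite !mxE eqxx GRing.mulr1n.
  by apply: cdiff_val (cdiff_comp (HP i) (cdiff_cexp _)); rewrite Cmult_comm.
apply: (cdiff_ext (f := fun w => RtoC 0)).
  by move=> w; rewrite !mxE (negbTE ij) GRing.mulr0n.
apply: cdiff_val (cdiff_const _ _); rewrite HL //.
by rewrite -[X in _ = X]/(Cmult 0 _) Cmult_0_l.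
Qed.

Lemma gauge_gauged n (Rm : C -> 'M[C]_n) (P : 'I_n -> C -> C) (z : C) :
  (exp_diag (fun i => P i z) *m gauged Rm P z = Rm z *m exp_diag (fun i => P i z))%R.
Proof.
apply/matrixP => i j; rewrite exp_diag_mull exp_diag_mulr mxE.
rewrite -[(_ * _)%R]/(Cmult _ _) Cmult_assoc -cexp_add.
have -> : (P i z + - (P i z - P j z) = P j z)%C by ring.
by rewrite Cmult_comm.
Qed.

(** Conjugation multiplies the entry [(i, j)] by [cexp (v i - v j)], whose modulus is the inverse of
    the weight. *)
Lemma gauge_conj_bound n (X : 'M[C]_n) (v : 'I_n -> C) (K : R) :
  (forall i j, Cmod (X i j - (1%:M : 'M[C]_n)%R i j)%C <= exp (- Re (v i - v j)%C) * K) ->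
  mxnorm (exp_diag v *m X *m exp_diag (fun i => - v i)%C - 1%:M)%R <= INR n * (INR n * K).
Proof.
move=> H; apply: mxnorm_le => i j.
have -> : (exp_diag v *m X *m exp_diag (fun i => - v i)%C - 1%:M)%R i j =
    (cexp (v i - v j) * (X i j - (1%:M : 'M[C]_n)%R i j))%C.
  rewrite [LHS]mxE exp_diag_mulr exp_diag_mull mxE.
  rewrite -[LHS]/(Cplus _ (Copp _)).
  have -> : (cexp (v i) * X i j * cexp (- v j) = cexp (v i - v j) * X i j)%C.
    by rewrite [cexp (v i - v j)%C]cexp_add; ring.
  have aux1 (x : C) : (1 * x + - (1) = 1 * (x - 1))%C by ring.
  have aux2 (c x : C) : (c * x + - 0 = c * (x - 0))%C by ring.
  rewrite !mxE; case: (eqVneq i j) => [->|ij].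
    rewrite GRing.mulr1n; have -> : (v j - v j = 0)%C by ring.
    by rewrite cexp_0; exact: aux1.
  by rewrite GRing.mulr0n; exact: aux2.
rewrite Cmod_mult Cmod_cexp.
apply: Rle_trans (Rmult_le_compat_l _ _ _ (Rlt_le _ _ (exp_pos _)) (H i j)) _.
by rewrite -Rmult_assoc -exp_plus Rplus_opp_r exp_0 Rmult_1_l; right.
Qed.

Lemma asymptotic_existence (n : nat) (a tmin tmax : R) (Lam Rm : C -> 'M[C]_n) (zo : C) :
  0 < a -> tmin < tmax -> tmax - tmin <= PI ->
  mholo (domainU a tmin tmax) Lam -> mholo (domainU a tmin tmax) Rm ->
  (forall z, domainU a tmin tmax z -> is_diag_mx (Lam z)) ->
  L_condition a tmin tmax Lam -> good_decay a tmin tmax Rm ->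
  exists Y : C -> 'M[C]_n, asymptotic_solution a tmin tmax Lam Rm Y zo.
Proof.
move=> a0 lt w HL HR Hdiag HLc Hdec.
set U := domainU a tmin tmax.
pose P0 i := prim U (fun z => Lam z i i).
have HLi i : holo_on U (fun z => Lam z i i) by exact: (proj2 (mholo_entries _ _) HL).
have dP0 i z : U z -> cdiff (P0 i) z (Lam z i i).
  by apply: primP; exact: domain_primitive lt w (HLi i).
(* Normalized to vanish at [zo], so that [P i z] is the integral in the asymptotic formula. *)
pose P i z := (P0 i z - P0 i zo)%C.
have dP i z : U z -> cdiff (P i) z (Lam z i i).
  move=> Uz; apply: cdiff_val (cdiff_minus (dP0 i z Uz) (cdiff_const _ _)); ring.
pose sm i j (p : R * R) := [/\ p.1 = 1 \/ p.1 = -1, 0 <= p.2 &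
    forall tau z s, tmin < tau < tmax -> half_plane a tau z -> 0 <= s ->
      Re (P i z - P j z)%C
      - Re (P i (z + s * (p.1 * cis tau)) - P j (z + s * (p.1 * cis tau)))%C <= p.2].
have sm_ex i j : exists p, sm i j p.
  by have [s [M HsM]] := L_condition_sign HL dP HLc i j; exists (s, M).
pose SM i j := epsilon (inhabits (0, 0)) (sm i j).
have HSM i j : sm i j (SM i j) by exact: (epsilon_spec _ _ (sm_ex i j)).
pose M : R := (\sum_(i < n) \sum_(j < n) (SM i j).2)%R.
have SMM i j : (SM i j).2 <= M.
  have pos x y : 0 <= (SM x y).2 by case: (HSM x y).
  apply: Rle_trans (Rsum_term (f := fun i => (\sum_(j < n) (SM i j).2)%R) i _).
    exact: (Rsum_term (f := fun j => (SM i j).2)).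
  by move=> x; apply: Rsum_ge0 => y; exact: pos.
have eM := exp_pos M.
pose N := INR n; have N0 : 0 <= N by exact: pos_INR.
have NN : 0 <= N * N by exact: Rmult_le_pos.
(* Chosen so that [exp M * E0 <= / 2], for the iteration, and [4 * (N * N) * exp M * E0 < 1], for
   the invertibility of [X] at [q]. *)
pose E0 := / (4 * (N * N) + 2) / exp M.
have E0p : 0 < E0.
  by apply: Rdiv_lt_0_compat => //; apply: Rinv_0_lt_compat; lra.
have eE0 : exp M * E0 = / (4 * (N * N) + 2) by rewrite /E0; field; lra.
have eE0' : exp M * E0 <= / 2 by rewrite eE0; apply: Rinv_le_contravar; lra.
have [D1 HD1] := good_decay_bound HR Hdec E0p.
pose D := Rmax (a + 1) D1.
have aD : a < D by have := Rmax_l (a + 1) D1; rewrite -/D; lra.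
have D1D : D1 <= D by exact: Rmax_r.
have DU z : domainU D tmin tmax z -> U z by apply: domainU_le; lra.
have Da t z : half_plane D t z -> half_plane a t z by apply: half_plane_le; lra.
have [X [dX BX]] : exists X : C -> 'M[C]_n,
  (forall z, domainU D tmin tmax z -> mdiff X z (gauged Rm P z *m X z)%R) /\
  forall tau z e, tmin < tau < tmax -> half_plane D tau z ->
    line_bound (fun z => mxnorm (Rm z)) tau (Im (cis (- tau) * z)%C) e ->
    forall i j, Cmod (X z i j - (1%:M : 'M[C]_n)%R i j)%C <=
      4 * (exp M * exp (- Re (P i z - P j z)%C) * e).
  apply: (@far_solution n D tmin tmax M E0 Rm P ltac:(lra) lt w _ _ (fun i j => (SM i j).1)) => //.
  - by move=> z /DU; exact: HR.
  - by move=> i z /DU Uz; exists (Lam z i i); exact: dP.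
  - by move=> i j; case: (HSM i j).
  - move=> i j tau z s Ht Hz Hs; apply: Rle_trans (SMM i j).
    by case: (HSM i j) => _ _; apply => //; exact: Da.
  - by move=> tau d Ht Hd; apply: HD1 => //; lra.
(* With [E] the gauge, [E X = (1 + G) E]: this is the error term of the asymptotic formula. *)
pose G z := (exp_diag (fun i => P i z) *m X z *m exp_diag (fun i => - P i z)%C - 1%:M)%R.
have BG tau z e : tmin < tau < tmax -> half_plane D tau z ->
    line_bound (fun z => mxnorm (Rm z)) tau (Im (cis (- tau) * z)%C) e ->
    mxnorm (G z) <= N * (N * (4 * (exp M * e))).
  move=> Ht Hz He; apply: gauge_conj_bound => i j.
  by apply: Rle_trans (BX tau z e Ht Hz He i j) _; right; ring.
pose t0 := (tmin + tmax) / 2.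
have Ht0 : tmin < t0 < tmax by rewrite /t0; lra.
have [q [hq _]] := half_planes_meet3 D w Ht0 Ht0 Ht0.
have Xq : X q \in unitmx.
  have : mxnorm (G q) < 1.
    have Hl := HD1 t0 (Im (cis (- t0) * q)%C) Ht0 (Rlt_trans _ _ _ aD hq) (Rle_lt_trans _ _ _ D1D hq).
    apply: Rle_lt_trans (BG t0 q E0 Ht0 hq Hl) _.
    rewrite eE0.
    have -> : N * (N * (4 * / (4 * (N * N) + 2))) = 4 * (N * N) / (4 * (N * N) + 2).
      by field; lra.
    by apply/Rlt_div_l; lra.
  move/unitmx_1D; rewrite /G GRing.addrC GRing.subrK !unitmx_mul.
  by case/andP => /andP [].
have HB : mholo U (gauged Rm P).
  by apply: gauged_holo => // i z Uz; exists (Lam z i i); exact: dP.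
(* [X] is controlled only far out; [Xg] solves the same equation on all of [U], starting from the
   value of [X] at [q]. *)
have [Xg [Xgq HXg]] := domain_ode w HB Ht0 (Da _ _ hq) Xq.
have HBt t : tmin < t < tmax -> mholo (half_plane a t) (gauged Rm P).
  by move=> Ht z Hz; apply: HB; exact: half_domainU Hz.
have agree t p : tmin < t < tmax -> half_plane D t p -> Xg p = X p ->
    forall z, half_plane D t z -> Xg z = X z.
  move=> Ht hp e.
  apply: (half_ode_unique (HBt t Ht) _ (Da t) _ _ hp e).
  - by move=> x y s; exact: half_plane_convex.
  - by move=> z Hz; apply: (proj2 (HXg z _)); exact: half_domainU (Da _ _ Hz).
  - by move=> z Hz; apply: dX; exact: half_domainU Hz.
have XgX z : domainU D tmin tmax z -> Xg z = X z.
  move=> /domainU_half [t [Ht Hz]].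
  have [p [h1 [h2 _]]] := half_planes_meet3 D w Ht0 Ht Ht.
  exact: (agree t p Ht h2 (agree t0 q Ht0 hq Xgq p h1)).
pose Y z := (exp_diag (fun i => P i z) *m Xg z)%R.
exists Y; split.
  move=> z Uz; have [uX dXg] := HXg z Uz; split.
    by rewrite unitmx_mul exp_diag_unit uX.
  move=> i j; apply/is_derive_cdiff; move: i j.
  apply: mdiff_val (mdiff_mulmx (gauge_mdiff (Hdiag z Uz) (fun i => dP i z Uz)) dXg).
  by rewrite mulmxA gauge_gauged -!mulmxA -mulmxDl.
move=> alpha beta h1 h2 h3.
exists (fun z => Y z *m exp_diag (fun i => - P i z)%C - 1%:M)%R; split.
  move=> z p Uz _ Hp lp.
  rewrite (@exp_diag_ext _ (fun i => polygon_int (fun w => Lam w i i) zo p) (fun i => P i z));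
    last first.
    move=> i; rewrite (polygon_int_ftc (U := U) (F := P i) (HLi i) (fun z Uz => dP i z Uz) Hp) lp.
    by rewrite /P; ring.
  by rewrite GRing.addrC GRing.subrK -mulmxA exp_diag_opp mulmx1.
move=> eps He.
have [k [k0 Hk]] := sector_line h1 h2 h3.
pose e := eps / (4 * (N * N) * exp M + 1).
have NM : 0 <= 4 * (N * N) * exp M by apply: Rmult_le_pos; lra.
have ep : 0 < e by apply: Rdiv_lt_0_compat; lra.
have [D2 HD2] := good_decay_bound HR Hdec ep.
exists ((Rabs D + Rabs D2) / k) => z Uz Hz Bz.
have [tau [Ht Hd]] := Hk z Hz.
have big : Rabs D + Rabs D2 < Im (cis (- tau) * z)%C.
  apply: Rlt_le_trans Hd; rewrite Rmult_comm.
  by apply/(Rlt_div_l _ _ _ k0).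
have hz : half_plane D tau z.
  by rewrite /half_plane; have := Rle_abs D; have := Rabs_pos D2; lra.
have d2 : D2 < Im (cis (- tau) * z)%C.
  by have := Rle_abs D2; have := Rabs_pos D; lra.
have Hl := HD2 tau (Im (cis (- tau) * z)%C) Ht (Rlt_trans _ _ _ aD hz) d2.
rewrite /Y (XgX z (half_domainU Ht hz)).
apply: Rle_lt_trans (BG tau z e Ht hz Hl) _.
have -> : N * (N * (4 * (exp M * e))) = 4 * (N * N) * exp M * e by ring.
have -> : eps = (4 * (N * N) * exp M + 1) * e by rewrite /e; field; lra.
lra.
Qed.

(** * Uniqueness *)

Lemma mxnorm_add n (A B : 'M[C]_n) : mxnorm (A + B)%R <= mxnorm A + mxnorm B.
Proof.
change (mxnorm (A + B)%R <= (mxnorm A + mxnorm B)%R).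
rewrite /mxnorm -big_split /=; apply: Rsum_le => i; rewrite -big_split /=.
by apply: Rsum_le => j; rewrite mxE; exact: Cmod_triangle.
Qed.

Lemma mxnorm_opp n (A : 'M[C]_n) : mxnorm (- A)%R = mxnorm A.
Proof.
apply: eq_bigr => i _; apply: eq_bigr => j _; rewrite mxE; exact: Cmod_opp.
Qed.

Lemma mxnorm_mul n (A B : 'M[C]_n) : mxnorm (A *m B)%R <= mxnorm A * mxnorm B.
Proof.
change (mxnorm (A *m B)%R <= (mxnorm A * mxnorm B)%R).
have row l : (\sum_(j < n) Cmod (B l j))%R <= mxnorm B.
  apply: (Rsum_term (f := fun i => (\sum_(j < n) Cmod (B i j))%R)) => a.
  by apply: Rsum_ge0 => b; exact: Cmod_ge_0.
rewrite {1 2}/mxnorm GRing.mulr_suml; apply: Rsum_le => i.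
rewrite GRing.mulr_suml.
apply: Rle_trans (_ : (\sum_(j < n) \sum_(l < n) (Cmod (A i l) * Cmod (B l j))%R)%R <= _).
  apply: Rsum_le => j; rewrite mxE; apply: Rle_trans (Cmod_sum _) _.
  by apply: Rsum_le => l; right; exact: Cmod_mult.
rewrite exchange_big; apply: Rsum_le => l /=; rewrite -GRing.mulr_sumr.
by apply: Rmult_le_compat_l; [exact: Cmod_ge_0 | exact: row].
Qed.

(* [G - 1 = F2 - F1 - F1 (G - 1)] *)
Lemma near_identity n (F1 F2 G : 'M[C]_n) : (1%:M + F2 = (1%:M + F1) *m G)%R ->
  mxnorm F1 <= / 2 -> mxnorm (G - 1%:M)%R <= 2 * (mxnorm F1 + mxnorm F2).
Proof.
move=> e h1; set D := (G - 1%:M)%R.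
have eD : D = (F2 + (- F1 + - (F1 *m D)))%R.
  have eG : G = (D + 1%:M)%R by rewrite /D GRing.subrK.
  move: e; rewrite eG mulmxDl mul1mx mulmxDr mulmx1 => e.
  apply: (GRing.addIr (1%:M)%R); rewrite [in RHS]GRing.addrC GRing.addrA e.
  by rewrite -GRing.opprD (GRing.addrC F1) GRing.addrK.
have D0 := mxnorm_ge0 D.
have t1 := mxnorm_add (- F1)%R (- (F1 *m D))%R.
have t2 : mxnorm D <= mxnorm F2 + mxnorm (- F1 + - (F1 *m D))%R by rewrite {1}eD; exact: mxnorm_add.
have t3 := Rle_trans _ _ _ t2 (Rplus_le_compat_l _ _ _ t1).
rewrite !mxnorm_opp in t3; have t4 := mxnorm_mul F1 D.
have t5 := Rmult_le_compat_r _ _ _ D0 h1.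
lra.
Qed.

(** Polar coordinates: as [d > 0], the point [(s, d)] has argument [acos (s / r)], in the range from
    0 to [PI]. So both ends of a line lie in the sector with [alpha = beta = tau]. *)
Lemma line_pt_in_sector (tau d s : R) : 0 < d -> in_sector tau tau (line_pt tau d s).
Proof.
move=> d0; pose r := sqrt (s * s + d * d).
have sd : 0 < s * s + d * d by nra.
have r0 : 0 < r by exact: sqrt_lt_R0.
have rr : r * r = s * s + d * d by apply: sqrt_sqrt; lra.
have dr : 0 < d / r by apply: Rdiv_lt_0_compat.
have q2 : s / r * (s / r) + d / r * (d / r) = 1.
  have -> : s / r * (s / r) + d / r * (d / r) = (s * s + d * d) / (r * r) by field; lra.
  by rewrite rr; field; lra.
have x1 : -1 <= s / r <= 1.
  have x2 : s / r * (s / r) <= 1 by have := Rmult_lt_0_compat _ _ dr dr; lra.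
  by move: x2; set x := s / r => x2; nra.
have := acos_bound (s / r) => ab.
exists r, (tau + acos (s / r)); split=> //; first by lra.
have sa : sin (acos (s / r)) = d / r.
  rewrite sin_acos // /Rsqr.
  have -> : 1 - s / r * (s / r) = Rsqr (d / r) by rewrite /Rsqr; lra.
  by apply: sqrt_Rsqr; lra.
rewrite /line_pt cis_add.
have -> : (s, d) = (r * cis (acos (s / r)))%C.
  by rewrite /cis cos_acos // sa; apply: injective_projections => /=; field; lra.
by ring.
Qed.

Lemma line_pt_far (tau d s : R) : Rabs s <= Cmod (line_pt tau d s).
Proof.
by rewrite /line_pt Cmod_mult Cmod_cis Rmult_1_l; exact: (re_le_Cmod (s, d)).
Qed.

Lemma half_plane_segment (a tau : R) (z w : C) (t : R) : half_plane a tau z ->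
  half_plane a tau w -> unit_interval t -> half_plane a tau (segment_pt z w t).
Proof.
move=> Hz Hw Ht; have -> : segment_pt z w t = (z + t * (w - z))%C by rewrite /segment_pt; ring.
exact: half_plane_convex.
Qed.

Lemma asymptotic_uniqueness (n : nat) (a tmin tmax : R) (Lam Rm Y1 Y2 : C -> 'M[C]_n) (zo : C) :
  0 < a -> tmin < tmax -> tmax - tmin <= PI ->
  mholo (domainU a tmin tmax) Lam -> mholo (domainU a tmin tmax) Rm ->
  L_condition a tmin tmax Lam -> domainU a tmin tmax zo ->
  asymptotic_solution a tmin tmax Lam Rm Y1 zo ->
  asymptotic_solution a tmin tmax Lam Rm Y2 zo ->
  forall z, domainU a tmin tmax z -> Y1 z = Y2 z.
Proof.
move=> a0 lt w HL HR HLc Uzo [S1 A1] [S2 A2] z Uz.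
set U := domainU a tmin tmax in HL HR S1 S2 *.
have HLi i : holo_on U (fun z => Lam z i i) by exact: (proj2 (mholo_entries _ _) HL).
pose P i := prim U (fun z => Lam z i i).
have dP i x : U x -> cdiff (P i) x (Lam x i i).
  by apply: primP; exact: domain_primitive lt w (HLi i).
have [tau [Ht Hz]] := proj1 (domainU_half _ _ _ _) Uz.
have [t1 [Ht1 Hzo]] := proj1 (domainU_half _ _ _ _) Uzo.
(* A point in the half-planes of both [zo] and [z], through which a path of two segments leads from
   [zo] to any point of the latter. *)
have [q [q1 [q2 _]]] := half_planes_meet3 a w Ht1 Ht Ht.
have HU p : half_plane a tau p -> U p by exact: half_domainU.
have poly p : half_plane a tau p -> polygon_in U zo [:: q; p].
  move=> Hp; split; first by move=> t It; apply: (half_domainU Ht1); exact: half_plane_segment.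
  split; first by move=> t It; apply: HU; exact: half_plane_segment.
  exact: HU.
pose E p := exp_diag (fun i => P i p - P i zo)%C.
have [F1 [F1E F1o]] := A1 tau tau (proj1 Ht) (Rle_refl _) (proj2 Ht).
have [F2 [F2E F2o]] := A2 tau tau (proj1 Ht) (Rle_refl _) (proj2 Ht).
have EP p : half_plane a tau p ->
    exp_diag (fun i => polygon_int (fun w => Lam w i i) zo [:: q; p]) = E p.
  move=> Hp; apply: exp_diag_ext => i.
  by rewrite (polygon_int_ftc (U := U) (F := P i) (HLi i) (fun x Ux => dP i x Ux) (poly p Hp)).
have dY Y : fundamental_solution U (fun x => Lam x + Rm x)%R Y ->
    forall p, U p -> mdiff Y p ((Lam p + Rm p) *m Y p)%R.
  by move=> S p Up i j; apply/is_derive_cdiff; have [_] := S p Up; exact.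
pose Cm := (invmx (Y1 z) *m Y2 z)%R.
have HA : mholo (half_plane a tau) (fun x => Lam x + Rm x)%R.
  move=> x Hx; have [K1 h1] := HL x (HU x Hx); have [K2 h2] := HR x (HU x Hx).
  exists (K1 + K2)%R => i j; rewrite mxE.
  apply: (cdiff_ext (f := fun w => (Lam w i j + Rm w i j)%C)); first by move=> u; rewrite mxE.
  by apply: cdiff_plus; [exact: h1 | exact: h2].
have Y21 p : half_plane a tau p -> Y2 p = (Y1 p *m Cm)%R.
  apply: (half_ode_unique (Y := (fun p => Y1 p *m Cm)%R) (q := z) HA _ (fun x h => h) _ _ Hz).
  - by move=> x y t; exact: half_plane_convex.
  - by move=> x Hx; apply: (dY _ S2); exact: HU.
  - move=> x Hx; apply: mdiff_val (mdiff_mulmx (dY _ S1 x (HU _ Hx)) (mdiff_const Cm x)).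
    by rewrite mulmx0 GRing.addr0 mulmxA.
  - by rewrite /Cm mulmxA mulmxV ?mul1mx //; case: (S1 z Uz).
(* Along a line, [Cm] conjugated by the exponentials is the quotient of the two factors [1 + o(1)],
   hence tends to the identity at both ends. *)
have limC eta : 0 < eta -> exists B, forall s, B < Rabs s -> forall i j,
    Cmod (cexp (P i (line_pt tau (a + 1) s) - P j (line_pt tau (a + 1) s)
       - (P i zo - P j zo)) * Cm i j - (1%:M : 'M[C]_n)%R i j)%C <= eta.
  move=> eta0.
  (* [/ 2] meets the hypothesis of [near_identity], whose bound [2 * (eta / 4 + eta / 4)] is then
     [eta]. *)
  have m0 : 0 < Rmin (eta / 4) (/ 2) by apply: Rmin_pos; lra.
  have [B1 HB1] := F1o _ m0; have [B2 HB2] := F2o _ m0.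
  exists (Rmax B1 B2) => s Hs i j; set p := line_pt tau (a + 1) s.
  have Hp : half_plane a tau p by apply: (on_line_half (d := a + 1)); [lra | exact: on_line_pt].
  have sp : in_sector tau tau p by apply: line_pt_in_sector; lra.
  have bp : Rmax B1 B2 < Cmod p by exact: Rlt_le_trans Hs (line_pt_far _ _ _).
  have {}HB1 := HB1 p (HU p Hp) sp (Rle_lt_trans _ _ _ (Rmax_l _ _) bp).
  have {}HB2 := HB2 p (HU p Hp) sp (Rle_lt_trans _ _ _ (Rmax_r _ _) bp).
  have m1 := Rmin_l (eta / 4) (/ 2); have m2 := Rmin_r (eta / 4) (/ 2).
  have e1 := F1E p [:: q; p] (HU p Hp) sp (poly p Hp) erefl.
  have e2 := F2E p [:: q; p] (HU p Hp) sp (poly p Hp) erefl.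
  rewrite EP // in e1 e2.
  pose E' := exp_diag (fun i => - (P i p - P i zo))%C.
  have EE : (E p *m E' = 1%:M)%R by exact: mulmx1C (exp_diag_opp _).
  pose G := (E p *m Cm *m E')%R.
  have eG : (1%:M + F2 p = (1%:M + F1 p) *m G)%R.
    have : ((1%:M + F2 p) *m (E p *m E') = (1%:M + F1 p) *m G)%R.
      by rewrite mulmxA -e2 (Y21 p Hp) e1 /G !mulmxA.
    by rewrite EE mulmx1.
  have u1 := near_identity eG ltac:(lra).
  have u2 := entry_le_mxnorm (G - 1%:M)%R i j.
  have <- : (G - 1%:M)%R i j = (cexp (P i p - P j p - (P i zo - P j zo)) * Cm i j
      - (1%:M : 'M[C]_n)%R i j)%C.
    rewrite [LHS]mxE; congr (_ + _)%R; last by rewrite mxE.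
    rewrite /G exp_diag_mulr exp_diag_mull.
    have -> : (P i p - P j p - (P i zo - P j zo) = (P i p - P i zo) + - (P j p - P j zo))%C by ring.
    by rewrite [in RHS]cexp_add; exact: GRing.mulrAC.
  by apply: Rle_trans u2 _; apply: Rle_trans u1 _; lra.
suff C1 : Cm = (1%:M)%R by rewrite (Y21 z Hz) C1 mulmx1.
apply/matrixP => i j; case: (eqVneq i j) => [<-|ij].
  have : (Cm i i - (1%:M : 'M[C]_n)%R i i = 0)%C.
    apply: Cmod_eq_0; apply: Rle_antisym; last exact: Cmod_ge_0.
    apply: Rnot_gt_le => h.
    have [|B HB] := limC (Cmod (Cm i i - (1%:M : 'M[C]_n)%R i i)%C / 2); first lra.
    have := HB (Rabs B + 1) ltac:(rewrite Rabs_pos_eq; have := Rle_abs B; have := Rabs_pos B; lra) i i.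
    set p := line_pt _ _ _.
    have -> : (P i p - P i p - (P i zo - P i zo) = 0)%C by ring.
    by rewrite cexp_0 Cmult_1_l; lra.
  by move=> e; rewrite (Csub_add (Cm i i) ((1%:M : 'M[C]_n)%R i i)) e Cplus_0_l.
have [sg [M [sg1 M0 HM]]] := L_condition_sign HL dP HLc i j.
have d0 : (1%:M : 'M[C]_n)%R i j = RtoC 0 by rewrite mxE (negbTE ij).
rewrite d0; apply: Cmod_eq_0; apply: Rle_antisym; last exact: Cmod_ge_0.
apply: Rnot_gt_le => h.
pose p0 := line_pt tau (a + 1) 0.
have Hp0 : half_plane a tau p0 by apply: (on_line_half (d := a + 1)); [lra | exact: on_line_pt].
(* Towards the end given by [sg], [Re (P i - P j)] never falls below its value at [p0] minus [M];
   the exponential factor keeps modulus at least [k], so a nonzero [Cm i j] could not be carried to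
   0. *)
pose k := exp (Re (P i p0 - P j p0)%C - M - Re (P i zo - P j zo)%C).
have k0 : 0 < k by exact: exp_pos.
have kC : 0 < k * Cmod (Cm i j) by exact: Rmult_lt_0_compat.
have [|B HB] := limC (k * Cmod (Cm i j) / 2); first lra.
pose s := Rabs B + 1.
have s0 : 0 <= s by rewrite /s; have := Rabs_pos B; lra.
have ep : (p0 + s * (sg * cis tau))%C = line_pt tau (a + 1) (sg * s).
  have -> : sg * s = 0 + sg * s by ring.
  by rewrite -line_pt_move RtoC_mult /p0; ring.
have Bs : B < Rabs (sg * s).
  rewrite Rabs_mult; have -> : Rabs sg = 1 by case: sg1 => ->; rewrite /Rabs; case: Rcase_abs; lra.
  by rewrite Rmult_1_l Rabs_pos_eq // /s; have := Rle_abs B; lra.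
have := HB (sg * s) Bs i j; have := HM tau p0 s Ht Hp0 s0; rewrite ep d0.
set p := line_pt tau _ _ => h1.
have -> : (cexp (P i p - P j p - (P i zo - P j zo)) * Cm i j - 0 =
  cexp (P i p - P j p - (P i zo - P j zo)) * Cm i j)%C by ring.
rewrite Cmod_mult Cmod_cexp => h2.
have : k <= exp (Re (P i p - P j p - (P i zo - P j zo))%C).
  apply: exp_le; move: h1; rewrite /Re /=; lra.
move=> /(Rmult_le_compat_r (Cmod (Cm i j)) _ _ (Cmod_ge_0 _)); lra.
Qed.

Theorem theorem1p1 (n : nat) (a tmin tmax : R) (Lam Rm : C -> 'M[C]_n) :
  (1 <= n)%N ->
  (0 < a) -> (tmin < tmax) ->
  simply_connected (domainU a tmin tmax) ->
  analytic_on (domainU a tmin tmax) Lam ->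
  analytic_on (domainU a tmin tmax) Rm ->
  (forall z, domainU a tmin tmax z -> is_diag_mx (Lam z)) ->
  L_condition a tmin tmax Lam ->
  good_decay a tmin tmax Rm ->
  forall zo : C, domainU a tmin tmax zo ->
  (exists Y : C -> 'M[C]_n, asymptotic_solution a tmin tmax Lam Rm Y zo) /\
  (forall Y1 Y2 : C -> 'M[C]_n,
     asymptotic_solution a tmin tmax Lam Rm Y1 zo ->
     asymptotic_solution a tmin tmax Lam Rm Y2 zo ->
     forall z, domainU a tmin tmax z -> Y1 z = Y2 z).
Proof.
move=> _ a0 lt sc /analytic_mholo HL /analytic_mholo HR Hdiag HLc Hdec zo Uzo.
have w := simply_connected_width a0 sc.
by split; [exact: asymptotic_existence | move=> Y1 Y2; exact: asymptotic_uniqueness].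
Qed.
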